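(* Let $A\in\mathbb{R}^{n\times n}$ and $b\in\mathbb{R}^n$ (no controllability assumption). Let $\rho_0$ belong to the Schwartz class on $\mathbb{R}^n$ and let $\rho$ be the solution, with $\rho(0)=\rho_0$, of the forward Fokker–Planck equation $$\partial_t\rho=-\operatorname{div}(Ax\,\rho)+\frac12(b\cdot\nabla)^2\rho,\qquad t\ge0,\ x\in\mathbb{R}^n.$$ For $\theta\ge0$ set $$\mathcal{E}_\theta(t)=\theta\,\|\rho(t)\|_{L^2}^2+\int_{\mathbb{R}^n}(\nabla\rho(t))^\top G_t(A,b)\,\nabla\rho(t)\,dx.$$ Then, for every $\theta\ge0$, $$\frac{d}{dt}\big(e^{t\operatorname{tr}A}\mathcal{E}_\theta(t)\big)=-e^{t\operatorname{tr}A}\bigg((\theta-1)\,\|(b\cdot\nabla)\rho\|_{L^2}^2+\int_{\mathbb{R}^n}\big((b\cdot\nabla)\nabla\rho\big)^\top G_t(A,b)\big((b\cdot\nabla)\nabla\rho\big)\,dx\bigg).$$ Consequently, $e^{t\operatorname{tr}A}\mathcal{E}_\theta(t)$ is nonincreasing in $t$ for every initial datum when $\theta\ge1$. If $b\neq0$, then $\theta=1$ is the smallest coefficient $\theta\geq 0$ with this universal monotonicity property (i.e. monotonicity for every initial datum).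
   Context: $L^2=L^2(\mathbb{R}^n)$; $b\cdot\nabla$ is the directional derivative along $b$, and $(b\cdot\nabla)\nabla\rho$ is the vector field obtained by applying it to each component of $\nabla\rho$. For $t\ge0$, $G_t(A,b)=\int_0^te^{sA}bb^\top e^{sA^\top}\,ds$, so $G_0=0$. The solution is the forward evolution associated with $dX_t=AX_t\,dt+b\,dW_t$ ($W$ a real Brownian motion): $\rho(t,\cdot)$ is the convolution of $x\mapsto e^{-t\operatorname{tr}A}\rho_0(e^{-tA}x)$ with the centered (possibly degenerate) Gaussian measure of covariance $G_t(A,b)$. *)

(* Defs.v *)
From HB Require Import structures.
From mathcomp Require Import all_boot all_order all_algebra.
From mathcomp Require Import all_classical all_reals all_analysis.
From mathcomp Require Import measurable_realfun.

Set Implicit Arguments.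
Unset Strict Implicit.
Unset Printing Implicit Defensive.

Import Order.TTheory GRing.Theory Num.Theory.
Import numFieldNormedType.Exports.

Local Open Scope classical_set_scope.
Local Open Scope ring_scope.

(* Vectors of R^n are the columns 'cV[R]_n, R : realType. *)

Section measurable_cV.
Context {R : realType} {n : nat}.

Definition cV_coord (i : 'I_n) (x : 'cV[R]_n) : measurableTypeR R := x i 0.

Let cV_set0 : g_sigma_preimage cV_coord set0.
Proof. exact: sigma_algebra0. Qed.

Let cV_setC X : g_sigma_preimage cV_coord X -> g_sigma_preimage cV_coord (~` X).
Proof. exact: sigma_algebraC. Qed.

Let cV_bigcup (F : (set 'cV[R]_n)^nat) :
  (forall i, g_sigma_preimage cV_coord (F i)) ->
  g_sigma_preimage cV_coord (\bigcup_i F i).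
Proof. exact: sigma_algebra_bigcup. Qed.

(* The Borel sigma-algebra of R^n, generated by the coordinates. *)
HB.instance Definition _ := @isMeasurable.Build default_measure_display
  'cV[R]_n (g_sigma_preimage cV_coord) cV_set0 cV_setC cV_bigcup.

Lemma measurable_cV_coord (i : 'I_n) : measurable_fun [set: 'cV[R]_n] (cV_coord i).
Proof.
move=> _ Y mY; rewrite setTI; apply: sub_sigma_algebra => /=.
rewrite -bigcup_seq/=; exists i => /=; first by rewrite mem_index_enum.
by exists Y => //; rewrite setTI.
Qed.

Lemma measurable_fun_cVP d (T : measurableType d) (f : T -> 'cV[R]_n) :
  (forall i, measurable_fun [set: T] (cV_coord i \o f)) ->
  measurable_fun [set: T] f.
Proof.
move=> mf.
have sf : g_sigma_preimage (fun i => cV_coord i \o f) `<=` measurable.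
  apply: smallest_sub; first exact: sigma_algebra_measurable.
  rewrite -bigcup_seq/= => X [i _] [B mB <-]; exact: mf.
move=> _ X mX; apply: sf; rewrite g_sigma_preimage_comp.
by exists X.
Qed.

End measurable_cV.

Section power_measure.
Context {R : realType}.

Definition cV_cons {n} (p : measurableTypeR R * 'cV[R]_n) : 'cV[R]_n.+1 :=
  \col_i oapp (fun j => p.2 j 0) p.1 (unlift ord0 i).

Definition cV_uncons {n} (x : 'cV[R]_n.+1) : measurableTypeR R * 'cV[R]_n :=
  (x ord0 0, \col_j x (lift ord0 j) 0).

Lemma cV_consK n : cancel (@cV_cons n) cV_uncons.
Proof.
case=> a x; rewrite /cV_uncons /cV_cons mxE unlift_none/=; congr pair.
by apply/colP => j; rewrite !mxE liftK.
Qed.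

Lemma measurable_cV_cons n : measurable_fun setT (@cV_cons n).
Proof.
apply: measurable_fun_cVP => i.
case: (unliftP ord0 i) => [j ->|->].
  rewrite (_ : _ \o _ = cV_coord j \o snd).
    exact: measurableT_comp (measurable_cV_coord j) measurable_snd.
  by apply/funext => p; rewrite /= /cV_coord mxE liftK.
rewrite (_ : _ \o _ = fst); first exact: measurable_fst.
by apply/funext => p; rewrite /= /cV_coord mxE unlift_none.
Qed.

Lemma measurable_cV_uncons n : measurable_fun setT (@cV_uncons n).
Proof.
apply: measurable_fun_pair; first exact: measurable_cV_coord.
apply: measurable_fun_cVP => i.
rewrite (_ : _ \o _ = cV_coord (lift ord0 i)); first exact: measurable_cV_coord.
by apply/funext => x; rewrite /= /cV_coord mxE.
Qed.

Section step.
Variables (n : nat) (mu : {sigma_finite_measure set (measurableTypeR R) -> \bar R})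
  (nu : {sigma_finite_measure set 'cV[R]_n -> \bar R}).

Definition cons_measure : set 'cV[R]_n.+1 -> \bar R :=
  pushforward (mu \x nu)%E cV_cons.


Let mcons := @measurable_cV_cons n.

Let cons0 : cons_measure set0 = 0%E.
Proof. by rewrite /cons_measure /pushforward preimage_set0 measure0. Qed.

Let cons_ge0 X : (0 <= cons_measure X)%E.
Proof. exact: measure_ge0. Qed.

Let cons_sigma_additive : semi_sigma_additive cons_measure.
Proof. exact: (@measure_semi_sigma_additive _ _ _ (pushforward (mu \x nu)%E cV_cons)). Qed.

HB.instance Definition _ := isMeasure.Build _ _ _ cons_measure
  cons0 cons_ge0 cons_sigma_additive.

Let cons_sigma_finite : sigma_finite setT cons_measure.
Proof.
(* The sigma-finite instance of mu \x nu is shadowed by the (sub)probability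
   ones, so it cannot be inferred here. *)
have /sigma_finiteP[F [TF ndF Foo]] := sigma_finiteT mu.
have /sigma_finiteP[G [TG ndG Goo]] := sigma_finiteT nu.
exists (fun k => cV_uncons @^-1` (F k `*` G k)).
  apply/esym; rewrite -subTset => x _.
  have : [set: measurableTypeR R] (cV_uncons x).1 by [].
  have : [set: 'cV[R]_n] (cV_uncons x).2 by [].
  rewrite TF TG => -[j _ Gx] [k _ Fx]; exists (maxn j k) => //; split.
    by move: Fx; exact/subsetPset/ndF/leq_maxr.
  by move: Gx; exact/subsetPset/ndG/leq_maxl.
move=> k; have [mF Fk] := Foo k; have [mG Gk] := Goo k; split.
  rewrite -[X in measurable X]setTI; apply: measurable_cV_uncons => //.
  exact: measurableX.
rewrite /cons_measure /pushforward -comp_preimage.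
rewrite (_ : _ \o _ = id); last by apply/funext; exact: cV_consK.
by rewrite preimage_id product_measure1E// lte_mul_pinfty// ge0_fin_numE.
Qed.

HB.instance Definition _ := Measure_isSigmaFinite.Build _ _ _ cons_measure
  cons_sigma_finite.

End step.

(* The n-fold product of mu, transported from R * (R * ...) to 'cV[R]_n. *)
Fixpoint power_measure
    (mu : {sigma_finite_measure set (measurableTypeR R) -> \bar R}) (n : nat) :
    {sigma_finite_measure set 'cV[R]_n -> \bar R} :=
  if n is n'.+1 then cons_measure mu (power_measure mu n') else dirac (0 : 'cV[R]_0).

End power_measure.

Definition lebesgue_cV {R : realType} (n : nat) :=
  power_measure (@lebesgue_measure R) n.

Section gaussian.
Context {R : realType} {n : nat}.

Definition std_gaussian := power_measure (normal_prob (0 : R) 1) n.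

(* Law of S *m Z for Z standard Gaussian and S *m S^T = V.  Such an S exists
   when V is positive semidefinite, possibly singular, and the law depends on V
   only; for other V the value is irrelevant. *)
Definition gaussian_root (V : 'M[R]_n) : 'M[R]_n :=
  get [set S : 'M[R]_n | S *m S^T = V].

Definition gaussian (V : 'M[R]_n) : set 'cV[R]_n -> \bar R :=
  pushforward std_gaussian (mulmx (gaussian_root V)).

Lemma measurable_mulmx_cV (S : 'M[R]_n) :
  measurable_fun [set: 'cV[R]_n] (mulmx S : 'cV[R]_n -> 'cV[R]_n).
Proof.
apply: measurable_fun_cVP => i.
rewrite (_ : _ \o _ = fun x : 'cV[R]_n => \sum_j S i j * cV_coord j x).
  apply: measurable_sum => j; apply: measurable_funM => //.
  exact: measurable_cV_coord.
by apply/funext => x; rewrite /= /cV_coord mxE.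
Qed.

Section measure.
Variable V : 'M[R]_n.
Let mroot := measurable_mulmx_cV (gaussian_root V).

Let gaussian0 : gaussian V set0 = 0%E.
Proof. by rewrite /gaussian /pushforward preimage_set0 measure0. Qed.

Let gaussian_ge0 X : (0 <= gaussian V X)%E.
Proof. exact: measure_ge0. Qed.

Let gaussian_sigma_additive : semi_sigma_additive (gaussian V).
Proof.
exact: (@measure_semi_sigma_additive _ _ _
  (pushforward std_gaussian (mulmx (gaussian_root V)))).
Qed.

HB.instance Definition _ := isMeasure.Build _ _ _ (gaussian V)
  gaussian0 gaussian_ge0 gaussian_sigma_additive.

End measure.
End gaussian.

Section calculus.
Context {R : realType} {n : nat}.
Implicit Types (f : 'cV[R]_n -> R) (b x : 'cV[R]_n).

Definition gradient f x : 'cV[R]_n := \col_i 'D_(delta_mx i 0) f x.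

(* (b . grad) applied to each component of grad f *)
Definition dgradient b f x : 'cV[R]_n :=
  \col_i 'D_b (fun y => gradient f y i 0) x.

(* A multi-index derivative is given by the list of its differentiation
   directions; requiring differentiability of all of them (as schwartz does)
   amounts to smoothness, and then the order of the list is irrelevant. *)
Fixpoint iter_partial (s : seq 'I_n) f : 'cV[R]_n -> R :=
  if s is i :: s' then fun x => 'D_(delta_mx i 0) (iter_partial s' f) x else f.

Definition schwartz f :=
  (forall (s : seq 'I_n) x, differentiable (iter_partial s f) x) /\
  (forall (a : 'I_n -> nat) (s : seq 'I_n), exists C : R, forall x,
     `|(\prod_i x i 0 ^+ a i) * iter_partial s f x| <= C).

Definition L2norm f : R := fine ('N[lebesgue_cV n]_2%:E[EFin \o f])%E.

Definition convolution f (mu : {measure set 'cV[R]_n -> \bar R}) x : R :=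
  \int[mu]_z f (x - z).

End calculus.

Section fokker_planck.
Context {R : realType} {n : nat}.
Variables (A : 'M[R]_n) (b : 'cV[R]_n).

Definition expmx (M : 'M[R]_n) : 'M[R]_n :=
  limn (series (fun k => k`!%:R^-1 *: M ^+ k)).

Definition gramian (t : R) : 'M[R]_n :=
  \matrix_(i, j) \int[lebesgue_measure]_(s in `[0, t])
    (expmx (s *: A) *m (b *m b^T) *m expmx (s *: A^T)) i j.

(* Forward evolution of dX = A X dt + b dW: the pushforward of the density rho0
   by exp(tA), convolved with the law of the Gaussian noise. *)
Definition fp_solution (rho0 : 'cV[R]_n -> R) (t : R) : 'cV[R]_n -> R :=
  convolution (fun x => expR (- t * \tr A) * rho0 (expmx (- t *: A) *m x))
    (gaussian (gramian t)).

Definition gramian_form (t : R) (v : 'cV[R]_n -> 'cV[R]_n) : R :=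
  \int[lebesgue_cV n]_x ((v x)^T *m gramian t *m v x) 0 0.

Definition energy (theta : R) (rho : R -> 'cV[R]_n -> R) (t : R) : R :=
  theta * L2norm (rho t) ^+ 2 + gramian_form t (gradient (rho t)).

End fokker_planck.

(* Main.v *)
Require Import Defs.
From HB Require Import structures.
From mathcomp Require Import all_boot all_order all_algebra.
From mathcomp Require Import all_classical all_reals all_analysis.
From mathcomp Require Import measurable_realfun ring lra.

(** Write E t for the exponential of t A and G t for the Gramian.  In the frame
    that moves with the drift only the noise is left: the solution is
      rho t x = exp (- t tr A) (P_t rho0) (E (- t) x),
    where P_t averages over a centered Gaussian vector of covariance
      H t = E (- t) (G t) (E (- t))^T.
    The Lyapunov equation A G + G A^T + b b^T = E b b^T E^T shows that H has
    the derivative c c^T, with c = E (- t) b (mx_is_derive_Lagrangian_gramian).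

    Every integral of the statement is quadratic in the solution.  With the
    correlation corr f g w, the integral of f x g (x + w) over x, it becomes
    linear: the averages of f and of g merge into a single average of corr f g
    (corr_gauss_avgs), and the change of variables along the flow gives a power
    of exp (tr A) (Rintegral_expmx).  If N_t psi is the value at 0 of the
    average of psi over a Gaussian of covariance 2 H t, then
      exp (t tr A) E_theta t =
        theta N_t (corr rho0 rho0) + sum_kl H_kl N_t (corr (d_k rho0) (d_l rho0)).
    By the heat equation, the derivative of N_t psi in t is the sum of the
    c_i c_j N_t (d_i d_j psi) (noise2_derivative), and an integration by parts
    in the correlation gives
      (N_t (corr f g))' = - sum_ij c_i c_j N_t (corr (d_i f) (d_j g)).
    So the first term loses theta times the squared norm of D_b rho, the growth
    of H in the second term gains this quantity once, and the rest is the form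
    in D_b grad rho (energy_derivative).  For theta >= 1 the derivative is
    nonpositive, because G is positive semidefinite.  At t = 0, where G = 0, the
    derivative is (1 - theta) |D_b rho0|^2, which is positive for theta < 1 and
    a Gaussian rho0 if b is not zero.

    As H t may be singular, there is neither a density nor a root of H t that
    is known to be smooth in t.  Gaussian averages are therefore iterated
    one-dimensional ones, indexed by a list of vectors.  Changing the variances
    along the vectors has an expansion to second order (gauss_avgs_taylor).  Along a path of constant
    covariance the expansion shows that the average does not move, so it depends
    on the covariance of the list only (gauss_avgs_cov).  The increment between
    two times s <= t is then computed with a fresh list of covariance
    2 (H t - H s), which exists since H increases (gauss_avgs_increment,
    psd_root).  This gives the heat equation from the differentiability of H
    alone. *)

Set Implicit Arguments.
Unset Strict Implicit.
Unset Printing Implicit Defensive.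
Import Order.TTheory GRing.Theory Num.Theory.
Import numFieldNormedType.Exports.
Local Open Scope classical_set_scope.
Local Open Scope ring_scope.

(** * Dominated differentiation and bounded integrands *)

Section integration.
Context {R : realType}.

(** The domination is only asked near a, because along the flow it is only
    locally uniform in time. *)
Lemma is_derive_Rintegral d (Y : measurableType d)
    (mu : {measure set Y -> \bar R}) (f f' : R -> Y -> R) (G : Y -> R) (a e : R) :
  0 < e ->
  (forall x, `|x - a| < e -> mu.-integrable setT (EFin \o f x)) ->
  (forall x y, `|x - a| < e -> is_derive x 1 (f^~ y) (f' x y)) ->
  mu.-integrable setT (EFin \o G) ->
  (forall x y, `|x - a| < e -> `|f' x y| <= G y) ->
  is_derive a 1 (fun x => \int[mu]_y f x y) (\int[mu]_y f' a y).
Proof.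
move=> e0 fi df Gi fG.
have Iv x : `](a - e), (a + e)[%classic x -> `|x - a| < e.
  by rewrite /= in_itv/= => /andP[? ?]; rewrite ltr_norml; lra.
have Ia : `](a - e), (a + e)[%classic a by rewrite /= in_itv/=; lra.
have G0 y : 0 <= G y by apply: le_trans (fG a y _); rewrite // subrr normr0.
have d1 x y : `|x - a| < e -> partial1of2 f x y = f' x y.
  by move=> xa; rewrite partial1of2E; have ? := df x y xa; exact: derive_val.
have /= H1 := @derivable_under_integral R _ Y mu f setT measurableT a _ _ Ia
  (fun x xI => fi x (Iv x xI))
  (fun x y xI _ => @ex_derive _ _ _ _ _ _ _ (df x y (Iv x xI))) G G0 Gi.
have /= H2 := @differentiation_under_integral R _ Y mu f setT measurableT a _ _ Ia
  (fun x xI => fi x (Iv x xI))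
  (fun x y xI _ => @ex_derive _ _ _ _ _ _ _ (df x y (Iv x xI))) G G0 Gi.
have fG' x y : `](a - e), (a + e)[%classic x -> [set: Y] y ->
    `|partial1of2 f x y| <= G y.
  by move=> xI _; rewrite d1 ?Iv// fG// Iv.
apply: DeriveDef; first exact: H1.
rewrite -derive1E H2//; apply: eq_Rintegral => y _; rewrite d1//.
by rewrite subrr normr0.
Qed.

Lemma Rintegral_Fubini d1 d2 (T1 : measurableType d1) (T2 : measurableType d2)
    (m1 : {sigma_finite_measure set T1 -> \bar R})
    (m2 : {sigma_finite_measure set T2 -> \bar R}) (f : T1 -> T2 -> R) :
  (m1 \x m2)%E.-integrable setT (fun z => (f z.1 z.2)%:E) ->
  (forall x, m2.-integrable setT (EFin \o f x)) ->
  (forall y, m1.-integrable setT (EFin \o f^~ y)) ->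
  \int[m1]_x \int[m2]_y f x y = \int[m2]_y \int[m1]_x f x y.
Proof.
move=> fi f1 f2; rewrite /Rintegral; congr fine.
have /= H := Fubini fi.
transitivity (\int[m1]_x \int[m2]_y (f x y)%:E)%E.
  by apply: eq_integral => x _; rewrite fineK// integrable_fin_num//; exact: f1.
rewrite H; apply: eq_integral => y _.
by rewrite fineK// integrable_fin_num//; exact: f2.
Qed.

Lemma Rintegral_Fubini_prod d1 d2 (T1 : measurableType d1) (T2 : measurableType d2)
    (m1 : {sigma_finite_measure set T1 -> \bar R})
    (m2 : {sigma_finite_measure set T2 -> \bar R}) (f : T1 * T2 -> R) :
  (m1 \x m2)%E.-integrable setT (EFin \o f) ->
  (forall x, m2.-integrable setT (fun y => (f (x, y))%:E)) ->
  \int[(m1 \x m2)%E]_z f z = \int[m1]_x \int[m2]_y f (x, y).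
Proof.
move=> fi f1; rewrite /Rintegral; congr fine.
rewrite -(@integral12_prod_meas1 _ _ _ _ _ m1 m2 _ fi).
by apply: eq_integral => x _; rewrite fineK// integrable_fin_num//; exact: f1.
Qed.

(** Stated for the coerced measure, the form that occurs under integrals. *)
Lemma measure_setT1 d (Y : measurableType d) (mu : probability Y R) :
  (mu : {measure set Y -> \bar R}) setT = 1%E.
Proof. exact: probability_setT. Qed.

Lemma bounded_integrable d (Y : measurableType d) (mu : probability Y R)
    (f : Y -> R) (C : R) : measurable_fun setT f -> (forall y, `|f y| <= C) ->
  mu.-integrable setT (EFin \o f).
Proof.
move=> mf fC; apply: measurable_bounded_integrable => //.
  by rewrite measure_setT1 ltry.
by exists C; split=> [|x Cx y _ /=]; [exact: num_real|]; rewrite (le_trans (fC y))// ltW.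
Qed.

Lemma Rintegral_probability_cst d (Y : measurableType d) (mu : probability Y R) (C : R) :
  \int[mu]_(_ in setT) C = C.
Proof. by rewrite Rintegral_cst// measure_setT1/= mulr1. Qed.

Lemma norm_Rintegral_le d (Y : measurableType d) (mu : probability Y R)
    (f : Y -> R) (C : R) : measurable_fun setT f -> (forall y, `|f y| <= C) ->
  `|\int[mu]_y f y| <= C.
Proof.
move=> mf fC; have fi := bounded_integrable mu mf fC.
apply: le_trans (le_normr_Rintegral _ _) _ => //.
rewrite -[leRHS](Rintegral_probability_cst mu); apply: (@le_Rintegral _ _ _ mu setT (fun y => `|f y|)) => //.
- by apply: (@bounded_integrable _ _ _ _ C) => [|y];
    [exact: measurableT_comp|rewrite normr_id].
- exact: (@bounded_integrable _ _ _ _ `|C|).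
Qed.

Lemma le_normr_integrable d (Y : measurableType d) (mu : {measure set Y -> \bar R})
    (f g : Y -> R) : measurable_fun setT f -> mu.-integrable setT (EFin \o g) ->
  (forall y, `|f y| <= g y) -> mu.-integrable setT (EFin \o f).
Proof.
move=> mf gi fg; apply: le_integrable gi => //; first exact/measurable_EFinP.
by move=> y _ /=; rewrite lee_fin (le_trans (fg y))// ler_norm.
Qed.

End integration.

(** * Lebesgue measure on the line *)

Section line.
Context {R : realType}.
Local Notation lam := (@lebesgue_measure R).

Lemma oneDsqr_gt0 (x : R) : 0 < oneDsqr x.
Proof. exact: lt_le_trans ltr01 (oneDsqr_ge1 x). Qed.

(** Both measures agree on half-open intervals, which determine Lebesgue
    measure. *)
Lemma lebesgue_measure_translate (a : R) (X : set (measurableTypeR R)) :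
  measurable X -> pushforward lam (fun x => x + a) X = lam X.
Proof.
move=> mX.
have ma : measurable_fun [set: measurableTypeR R]
    ((fun x : R => x + a) : measurableTypeR R -> measurableTypeR R).
  exact: measurable_funD.
pose mu : {measure set _ -> \bar R} := pushforward lam
  ((fun x : R => x + a) : measurableTypeR R -> measurableTypeR R).
apply/esym; apply: (@lebesgue_measure_unique R (mu ma)) mX.
move=> _ [[u v] _ <-] /=.
rewrite /mu/= /pushforward.
have -> : (fun x => x + a) @^-1` `]u, v]%classic = `](u - a), (v - a)]%classic.
  apply/seteqP; split => x /=; rewrite !in_itv/= => /andP[? ?]; lra.
rewrite !lebesgue_measure_itv/= !lte_fin ltrD2r.
by case: ifP => // _; rewrite -!EFinB; congr EFin; ring.
Qed.

Lemma ge0_integral_translate (a : R) (f : R -> \bar R) :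
  measurable_fun setT f -> (forall x, 0 <= f x)%E ->
  (\int[lam]_x f (x + a)%R = \int[lam]_x f x)%E.
Proof.
move=> mf f0.
have ma : measurable_fun [set: measurableTypeR R]
    ((fun x : R => x + a) : measurableTypeR R -> measurableTypeR R).
  exact: measurable_funD.
rewrite -[LHS](@ge0_integral_pushforward _ _ _ _ _ _ ma lam setT f)//.
apply: eq_measure_integral => A mA _; exact: lebesgue_measure_translate.
Qed.

Lemma Rintegral_translate (a : R) (f : R -> R) : measurable_fun setT f ->
  \int[lam]_x f (x + a) = \int[lam]_x f x.
Proof.
move=> mf; rewrite /Rintegral; congr fine; rewrite integralE [RHS]integralE.
have mf' : measurable_fun setT (EFin \o f) by exact/measurable_EFinP.
congr (_ - _)%E.
- rewrite -[RHS](ge0_integral_translate a (measurable_funepos mf') (funepos_ge0 _)).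
  by apply: eq_integral => x _; rewrite !funeposE.
- rewrite -[RHS](ge0_integral_translate a (measurable_funeneg mf') (funeneg_ge0 _)).
  by apply: eq_integral => x _; rewrite !funenegE.
Qed.

Lemma integrable_translate (a : R) (f : R -> R) :
  lam.-integrable setT (EFin \o f) -> lam.-integrable setT (fun x => (f (x + a))%:E).
Proof.
move=> /integrableP[mf fi]; apply/integrableP; split.
  by apply: (measurableT_comp mf); exact: measurable_funD.
by rewrite (ge0_integral_translate a (f := fun x => `|(f x)%:E|%E))//; exact: measurableT_comp.
Qed.

Lemma integral_oneDsqrV : (\int[lam]_x ((oneDsqr x)^-1)%:E = pi%:E)%E.
Proof.
rewrite ge0_symfun_integralT.
- rewrite -set_itvcy integral0y_oneDsqr -EFinM; congr EFin.
  by rewrite mulrC divfK.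
- by move=> x; rewrite invr_ge0 ltW// oneDsqr_gt0.
- exact: continuous_oneDsqrV.
- by move=> x; rewrite /= /oneDsqr sqrrN.
Qed.

Lemma integrable_oneDsqrV : lam.-integrable setT (fun x => ((oneDsqr x)^-1)%:E).
Proof.
apply/integrableP; split.
  apply/measurable_EFinP; apply: (@continuous_measurable_fun R) => x.
  exact: continuous_oneDsqrV.
under eq_integral do rewrite gee0_abs ?lee_fin ?invr_ge0 ?ltW ?oneDsqr_gt0//.
by rewrite integral_oneDsqrV ltry.
Qed.

(** One integrable function dominates all translates by at most 1: this is what
    allows differentiation with respect to a translation. *)
Lemma oneDsqrV_translate (x h : R) : `|h| <= 1 ->
  (oneDsqr (x + h))^-1 <= 3 * (oneDsqr x)^-1.
Proof.
move=> h1; rewrite ler_pdivlMr ?oneDsqr_gt0// ler_pdivrMl ?oneDsqr_gt0//.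
have : h ^+ 2 <= 1 by move: h1; rewrite ler_norml => /andP[? ?]; nra.
rewrite /oneDsqr; have := sqr_ge0 (x + 2 * h); nra.
Qed.

(** The integral of F (x + h) does not depend on h; differentiating it at h = 0
    under the integral sign gives the claim, without any limit at infinity. *)
Lemma Rintegral_derivative0 (F f : R -> R) (C : R) :
  (forall x : R, is_derive x 1 F (f x)) ->
  (forall x, `|F x| <= C * (oneDsqr x)^-1) ->
  (forall x, `|f x| <= C * (oneDsqr x)^-1) ->
  \int[lam]_x f x = 0.
Proof.
move=> dF FC fC.
have cF : continuous F.
  by move=> x; apply: differentiable_continuous; apply/derivable1_diffP; have [] := dF x.
have mF : measurable_fun setT F by exact: continuous_measurable_fun.
have wi k : lam.-integrable setT (EFin \o (fun x => k * (oneDsqr x)^-1)).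
  rewrite /comp; under eq_fun do rewrite EFinM.
  by apply: integrableZl => //; exact: integrable_oneDsqrV.
have Fi : lam.-integrable setT (EFin \o F).
  apply: (@le_normr_integrable _ _ _ lam _ _ _ (wi C) FC).
  exact: mF.
have C0 : 0 <= C.
  by have := le_trans (normr_ge0 _) (FC 0); rewrite pmulr_lge0// invr_gt0 oneDsqr_gt0.
have D : is_derive (0 : R) 1 (fun h => \int[lam]_x F (x + h)) (\int[lam]_x f (x + 0)).
  apply: (@is_derive_Rintegral _ _ _ lam (fun h x => F (x + h)) (fun h x => f (x + h))
    (fun x => (C * 3) * (oneDsqr x)^-1) 0 1) => //.
  - by move=> h _; exact: integrable_translate.
  - move=> h x _.
    have dg : is_derive (h : R) 1 (fun h => x + h) 1.
      rewrite (_ : (fun h => x + h) = shift x); first exact: is_derive_shift.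
      by apply/funext => k; rewrite addrC.
    by rewrite -[f _]mulr1; exact: (is_derive1_comp (dF (x + h)) dg).
  - move=> h x; rewrite subr0 => /ltW h1; apply: (le_trans (fC _)).
    by rewrite -mulrA ler_wpM2l// oneDsqrV_translate.
have := @derive_val _ _ _ _ _ _ _ D.
under eq_fun do rewrite Rintegral_translate//.
rewrite derive_cst; under eq_Rintegral do rewrite addr0.
by move=> <-.
Qed.

End line.

(** * The standard Gaussian on the line *)

Section gaussian_line.
Context {R : realType}.
Local Notation lam := (@lebesgue_measure R).
Local Notation gam := (normal_prob (0 : R) 1).
Local Notation phi := (normal_pdf (0 : R) 1).

(** The Radon-Nikodym derivative of the Gaussian law is almost everywhere its
    density. *)
Lemma ge0_integral_normal_prob (f : R -> \bar R) :
  measurable_fun setT f -> (forall x, 0 <= f x)%E ->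
  (\int[gam]_x f x = \int[lam]_x (f x * (phi x)%:E))%E.
Proof.
move=> mf f0.
have dom := normal_prob_dominates (0 : R) 1.
rewrite -(Radon_Nikodym_SigmaFinite.change_of_variables dom f0)//.
have mphi : measurable_fun setT (fun x => (phi x)%:E).
  by apply/measurable_EFinP; exact: measurable_normal_pdf.
have fi := Radon_Nikodym_SigmaFinite.f_integrable dom.
apply: ae_eq_integral => //.
- by apply: emeasurable_funM => //; exact: measurable_int fi.
- exact: emeasurable_funM.
- apply: ae_eqe_mul2l; apply: integral_ae_eq => //= E _ mE.
  by rewrite -Radon_Nikodym_SigmaFinite.f_integral.
Qed.

Lemma integrable_normal_prob (f : R -> R) : measurable_fun setT f ->
  lam.-integrable setT (fun x => (f x * phi x)%:E) ->
  gam.-integrable setT (EFin \o f).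
Proof.
move=> mf /integrableP[_ fi]; apply/integrableP; split; first exact/measurable_EFinP.
rewrite (ge0_integral_normal_prob (f := fun x => `|(f x)%:E|%E))//; last first.
  by apply: measurableT_comp => //; exact/measurable_EFinP.
under eq_integral do rewrite /= -EFinM -[X in _ * X]ger0_norm ?normal_pdf_ge0// -normrM.
exact: fi.
Qed.

Lemma ge0_Rintegral_normal_prob (f : R -> R) : measurable_fun setT f ->
  (forall x, 0 <= f x) -> \int[gam]_x f x = \int[lam]_x (f x * phi x).
Proof.
move=> mf f0; rewrite /Rintegral; congr fine.
by rewrite (ge0_integral_normal_prob (f := EFin \o f))//; exact/measurable_EFinP.
Qed.

(** Reduced to the nonnegative functions f + |f| and |f|. *)
Lemma Rintegral_normal_prob (f : R -> R) : measurable_fun setT f ->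
  lam.-integrable setT (fun x => (f x * phi x)%:E) ->
  \int[gam]_x f x = \int[lam]_x (f x * phi x).
Proof.
move=> mf fi.
have mn : measurable_fun setT (fun x => `|f x|) by exact: measurableT_comp.
have ni : lam.-integrable setT (fun x => (`|f x| * phi x)%:E).
  apply: eq_integrable (integrable_norm fi) => // x _ /=.
  by rewrite normrM [X in _ * X]ger0_norm ?normal_pdf_ge0.
have gfi := integrable_normal_prob mf fi.
have gni := integrable_normal_prob mn ni.
have E1 : \int[gam]_x (f x + `|f x|) = \int[gam]_x f x + \int[gam]_x `|f x|.
  exact: RintegralD.
have E2 : \int[lam]_x (f x * phi x + `|f x| * phi x) =
    \int[lam]_x (f x * phi x) + \int[lam]_x (`|f x| * phi x).
  exact: RintegralD.
have : \int[gam]_x (f x + `|f x|) = \int[lam]_x (f x * phi x + `|f x| * phi x).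
  rewrite ge0_Rintegral_normal_prob; first last.
  - by move=> x; have := ler_norm (- f x); rewrite normrN; lra.
  - exact: measurable_funD.
  by apply: eq_Rintegral => x _; rewrite mulrDl.
rewrite E1 E2 (ge0_Rintegral_normal_prob mn)//.
exact: addIr.
Qed.

Lemma normal_pdf01E (x : R) : phi x = normal_peak 1 * expR (- (x ^+ 2 / 2)).
Proof. by rewrite normal_pdfE ?oner_eq0// /normal_fun subr0 expr1n mulNr. Qed.

Lemma is_derive_normal_pdf01 (x : R) : is_derive x 1 phi (- x * phi x).
Proof.
rewrite (_ : normal_pdf 0 1 = fun x => normal_peak 1 * expR (- (x ^+ 2 / 2))); last first.
  by apply/funext => y; rewrite normal_pdf01E.
have d2 : is_derive x 1 (fun x : R => - (x ^+ 2 / 2)) (- x).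
  by apply: is_derive_eq; rewrite scaler0 scaler0 add0r !scaler1 /GRing.scale/=; lra.
have d3 := is_derive1_comp (is_derive_expR _) d2.
apply: is_derive_eq (is_deriveZ (normal_peak 1) d3) _.
by rewrite /GRing.scale/=; ring.
Qed.

(** With y = x^2 / 4, the inequality 1 + y <= exp y gives exp (- x^2 / 2) = exp
    (- y)^2 <= (1 + y)^-2, a decay of order 4, of which order 3 is used. *)
Lemma normal_pdf01_decay : exists C : R, forall x,
  phi x <= C / oneDsqr x /\ `|x| * phi x <= C / oneDsqr x.
Proof.
(* 16 = 4 ^ 2 compensates the denominator 4 in y = x ^ 2 / 4. *)
exists (16 * normal_peak 1) => x.
have p0 : 0 <= normal_peak (1 : R) by exact: normal_peak_ge0.
have e0 : 0 < expR (x ^+ 2 / 4) by exact: expR_gt0.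
have E1 : 1 + x ^+ 2 / 4 <= expR (x ^+ 2 / 4) by exact: expR_ge1Dx.
have EE : expR (- (x ^+ 2 / 2)) * (expR (x ^+ 2 / 4) ^+ 2) = 1.
  by rewrite -expRM_natl -expRD -[RHS]expR0; congr expR; lra.
have s0 := sqr_ge0 x.
have x2 : `|x| ^+ 2 = x ^+ 2 by rewrite real_normK// num_real.
have a0 := normr_ge0 x.
rewrite normal_pdf01E.
have H : (1 + x ^+ 2 / 4) ^+ 2 <= expR (x ^+ 2 / 4) ^+ 2.
  by rewrite ler_sqr ?nnegrE; lra.
set q := expR (- _) in EE *.
rewrite (mulrCA `|x|) [16 * _]mulrC -!mulrA.
have q0 : 0 < q by exact: expR_gt0.
have H2 : (1 + x ^+ 2 / 4) ^+ 2 * q <= 1 by rewrite -[leRHS]EE mulrC ler_wpM2l// ltW.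
rewrite /oneDsqr; have d0 : 0 < 1 + x ^+ 2 by lra.
split; rewrite ler_wpM2l// ler_pdivlMr//.
  apply: le_trans (_ : 16 * ((1 + x ^+ 2 / 4) ^+ 2 * q) <= _); last lra.
  by rewrite mulrA mulrC ler_wpM2r ?ltW//; nra.
apply: le_trans (_ : 16 * ((1 + x ^+ 2 / 4) ^+ 2 * q) <= _); last lra.
rewrite mulrAC !mulrA ler_wpM2r ?ltW//.
by rewrite -x2; move: (`|x|) a0 => y y0; have := sqr_ge0 (y - 1); nra.
Qed.

Lemma measurable_normal_pdf01 : measurable_fun setT phi.
Proof. exact: measurable_normal_pdf. Qed.

Lemma integrable_dominated_oneDsqrV (f : R -> R) (C : R) : measurable_fun setT f ->
  (forall x, `|f x| <= C / oneDsqr x) -> lam.-integrable setT (EFin \o f).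
Proof.
move=> mf fC; apply: (@le_normr_integrable _ _ _ lam _ _ mf _ fC).
rewrite /comp; under eq_fun do rewrite EFinM.
by apply: integrableZl => //; exact: integrable_oneDsqrV.
Qed.

Lemma integrable_normr_normal : gam.-integrable setT (fun x : R => `|x|%:E).
Proof.
have [C HC] := normal_pdf01_decay.
have mn : measurable_fun [set: R] (fun x : R => `|x|) by exact: normr_measurable.
apply: integrable_normal_prob => //.
apply: (@integrable_dominated_oneDsqrV _ C).
  by apply: measurable_funM => //; exact: measurable_normal_pdf01.
by move=> x; rewrite ger0_norm ?mulr_ge0 ?normal_pdf_ge0//; have [_] := HC x.
Qed.

(** The integral of the derivative of h phi vanishes, and the density satisfies
    phi' x = - x phi x. *)
Lemma Stein_identity (h h' : R -> R) (M : R) :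
  (forall x : R, is_derive x 1 h (h' x)) -> measurable_fun setT h' ->
  (forall x, `|h x| <= M) -> (forall x, `|h' x| <= M) ->
  \int[gam]_x (x * h x) = \int[gam]_x h' x.
Proof.
move=> dh mh' hM h'M; have [C HC] := normal_pdf01_decay.
have ch : continuous h.
  by move=> x; apply: differentiable_continuous; apply/derivable1_diffP; have [] := dh x.
have mh : measurable_fun setT h by exact: continuous_measurable_fun.
have mp := measurable_normal_pdf01.
have M0 : 0 <= M by exact: le_trans (normr_ge0 _) (hM 0).
have p0 x : 0 <= phi x by exact: normal_pdf_ge0.
have b0 x : `|h x * phi x| <= M * C / oneDsqr x.
  rewrite normrM [X in _ * X]ger0_norm// -mulrA ler_pM//.
  by have [] := HC x.
have b1 x : `|h' x * phi x| <= M * C / oneDsqr x.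
  rewrite normrM [X in _ * X]ger0_norm// -mulrA ler_pM//.
  by have [] := HC x.
have b2 x : `|x * h x * phi x| <= M * C / oneDsqr x.
  rewrite !normrM [X in _ * X]ger0_norm// (mulrC `|x|) -!mulrA ler_pM//.
    exact: mulr_ge0.
  by have [] := HC x.
have i1 : lam.-integrable setT (fun x => (h' x * phi x)%:E).
  by apply: integrable_dominated_oneDsqrV b1; exact: measurable_funM.
have m2 : measurable_fun setT (fun x : R => x * h x) by exact: measurable_funM.
have i2 : lam.-integrable setT (fun x => (x * h x * phi x)%:E).
  by apply: integrable_dominated_oneDsqrV b2; exact: measurable_funM.
rewrite !Rintegral_normal_prob//; apply/esym/eqP; rewrite -subr_eq0.
rewrite -RintegralB//; apply/eqP.
apply: (@Rintegral_derivative0 _ (fun x => h x * phi x) _ (M * C + M * C)).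
- move=> x; apply: is_derive_eq (is_deriveM (dh x) (is_derive_normal_pdf01 x)) _.
  by rewrite /GRing.scale/=; ring.
- move=> x; apply: le_trans (b0 x) _.
  rewrite ler_wpM2r//.
  by rewrite lerDr; have := le_trans (normr_ge0 _) (b0 0); rewrite /oneDsqr expr0n/= addr0 divr1.
- by move=> x; apply: le_trans (ler_normB _ _) _; rewrite mulrDl lerD.
Qed.

End gaussian_line.

(** * Integrals of linear combinations *)

Section sums.
Context d (Y : measurableType d) (R : realType).

Lemma integrable_EFin_sum (mu : {measure set Y -> \bar R}) (I : Type) (r : seq I)
    (f : I -> Y -> R) :
  (forall i, mu.-integrable setT (EFin \o f i)) ->
  mu.-integrable setT (fun y => (\sum_(i <- r) f i y)%:E).
Proof.
move=> fi; under eq_fun do rewrite -sumEFin.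
by apply: integrable_sum => // i _; exact: fi.
Qed.

Lemma Rintegral_sum (mu : {measure set Y -> \bar R}) (I : Type) (r : seq I)
    (f : I -> Y -> R) :
  (forall i, mu.-integrable setT (EFin \o f i)) ->
  \int[mu]_y (\sum_(i <- r) f i y) = \sum_(i <- r) \int[mu]_y f i y.
Proof.
move=> fi; elim: r => [|i r IH].
  under eq_Rintegral do rewrite big_nil.
  by rewrite big_nil Rintegral_cst// mul0r.
under eq_Rintegral do rewrite big_cons.
rewrite big_cons -IH RintegralD//.
exact: integrable_EFin_sum.
Qed.

Lemma Rintegral_lincomb (mu : {measure set Y -> \bar R}) (I : Type) (r : seq I)
    (c : I -> R) (f : I -> Y -> R) :
  (forall i, mu.-integrable setT (EFin \o f i)) ->
  \int[mu]_y (\sum_(i <- r) c i * f i y) = \sum_(i <- r) c i * \int[mu]_y f i y.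
Proof.
move=> fi; rewrite Rintegral_sum; last first.
  move=> i; rewrite /comp; under eq_fun do rewrite EFinM.
  by apply: integrableZl => //; exact: fi.
by apply: eq_bigr => i _; rewrite RintegralZl//; exact: fi.
Qed.

End sums.

(** * Functions with bounded derivatives of all orders *)

Section lines.
Context {R : realType} {n : nat}.
Implicit Types (f g : 'cV[R]_n -> R) (x v : 'cV[R]_n).

Lemma derive_line_quotient f x v (h : R) :
  (fun k => k^-1 *: (((fun h : R => f (x + h *: v)) \o shift h) (k *: (1 : R))
                     - f (x + h *: v))) =
  (fun k => k^-1 *: ((f \o shift (x + h *: v)) (k *: v) - f (x + h *: v))).
Proof.
apply/funext => k; congr (_ *: (f _ - _)) => /=.
by rewrite /shift/= [k *: 1]mulr1 scalerDl addrCA.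
Qed.

(** This reduces directional derivatives in R^n to one-variable calculus. *)
Lemma is_derive_line f x v (h df : R) :
  is_derive (x + h *: v) v f df <-> is_derive h 1 (fun h => f (x + h *: v)) df.
Proof.
have E := derive_line_quotient f x v h.
by split=> -[D1 D2]; split; move: D1 D2; rewrite /derivable /derive E.
Qed.

Lemma is_derive_line0 f x v (df : R) :
  is_derive x v f df <-> is_derive (0 : R) 1 (fun h => f (x + h *: v)) df.
Proof. by rewrite -is_derive_line scale0r addr0. Qed.

Lemma iter_partial_cat (s s' : seq 'I_n) f :
  iter_partial (s ++ s') f = iter_partial s (iter_partial s' f).
Proof. by elim: s => //= i s ->. Qed.

(** Differentiability is asked in its weak form, linearity of directional
    derivatives in the direction, because this form passes through an integral
    by one-variable arguments. *)
Definition smooth_bounded f :=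
  (forall s x v, is_derive x v (iter_partial s f)
    (\sum_i v i 0 * iter_partial (i :: s) f x)) /\
  (forall s, exists C, forall x, `|iter_partial s f x| <= C).

Lemma sum_delta (v : 'I_n -> R) (i : 'I_n) :
  \sum_k (delta_mx i 0 : 'cV[R]_n) k 0 * v k = v i.
Proof.
rewrite (bigD1 i)//= mxE !eqxx mul1r big1 ?addr0// => k ki.
by rewrite mxE (negbTE ki) mul0r.
Qed.

(** A family J of which J (i :: s) are the partial derivatives of J s
    identifies all iterated derivatives of J [::] at once. For a function
    defined by an integral, J is obtained by differentiating the integrand. *)
Lemma iter_partial_jet (J : seq 'I_n -> 'cV[R]_n -> R) :
  (forall s x v, is_derive x v (J s) (\sum_i v i 0 * J (i :: s) x)) ->
  forall s, iter_partial s (J [::]) = J s.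
Proof.
move=> dJ; elim=> [//|i s IH]; apply/funext => x /=; rewrite IH.
by have D := dJ s x (delta_mx i 0); rewrite derive_val sum_delta.
Qed.

Lemma smooth_bounded_jet (J : seq 'I_n -> 'cV[R]_n -> R) :
  (forall s x v, is_derive x v (J s) (\sum_i v i 0 * J (i :: s) x)) ->
  (forall s, exists C, forall x, `|J s x| <= C) ->
  smooth_bounded (J [::]).
Proof.
move=> dJ bJ; have E := iter_partial_jet dJ; split.
  by move=> s x v; rewrite E; under eq_bigr do rewrite E; exact: dJ.
by move=> s; rewrite E.
Qed.

Lemma smooth_bounded_partial f s : smooth_bounded f -> smooth_bounded (iter_partial s f).
Proof.
move=> [df bf]; split=> s'.
  move=> x v; rewrite -iter_partial_cat.
  by under eq_bigr do rewrite -iter_partial_cat cat_cons; exact: df.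
by rewrite -iter_partial_cat; exact: bf.
Qed.

Lemma smooth_bounded_lincomb_jet (I : eqType) (r : seq I) (c : I -> R)
    (f : I -> 'cV[R]_n -> R) : (forall i, smooth_bounded (f i)) ->
  let J s := fun x => \sum_(i <- r) c i * iter_partial s (f i) x in
  smooth_bounded (J [::]) /\ forall s, iter_partial s (J [::]) = J s.
Proof.
move=> sf J.
have dJ s x v : is_derive x v (J s) (\sum_i v i 0 * J (i :: s) x).
  rewrite /J; elim: r {J} => [|k r IH].
    under eq_fun do rewrite big_nil.
    by under eq_bigr do rewrite big_nil mulr0; rewrite sumr_const mul0rn; exact: is_derive_cst.
  under eq_fun do rewrite big_cons.
  under eq_bigr do rewrite big_cons mulrDr mulrCA.
  rewrite big_split/= -mulr_sumr; apply: is_deriveD => //.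
  have [D _] := sf k; exact: is_deriveZ.
split; last exact: iter_partial_jet.
apply: smooth_bounded_jet => // s; rewrite /J; elim: r {J dJ} => [|k r [C HC]].
  by exists 0 => x; rewrite big_nil normr0.
have [_ /(_ s)[K HK]] := sf k; exists (`|c k| * K + C) => x.
rewrite big_cons; apply: le_trans (ler_normD _ _) _.
by rewrite lerD// normrM ler_wpM2l.
Qed.

Lemma smooth_bounded_lincomb (I : eqType) (r : seq I) (c : I -> R)
    (f : I -> 'cV[R]_n -> R) : (forall i, smooth_bounded (f i)) ->
  smooth_bounded (fun x => \sum_(i <- r) c i * f i x).
Proof. by move=> /(smooth_bounded_lincomb_jet r c)[]. Qed.

Lemma iter_partial_lincomb (I : eqType) (r : seq I) (c : I -> R)
    (f : I -> 'cV[R]_n -> R) (s : seq 'I_n) : (forall i, smooth_bounded (f i)) ->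
  iter_partial s (fun x => \sum_(i <- r) c i * f i x) =
  (fun x => \sum_(i <- r) c i * iter_partial s (f i) x).
Proof. by move=> /(smooth_bounded_lincomb_jet r c)[_]; exact. Qed.

Lemma smooth_bounded_line f x v : smooth_bounded f ->
  forall h : R, is_derive h 1 (fun h => f (x + h *: v))
    (\sum_i v i 0 * iter_partial [:: i] f (x + h *: v)).
Proof. by move=> [df _] h; apply/is_derive_line; exact: (df [::]). Qed.

Lemma continuous_line f x v : smooth_bounded f -> continuous (fun h : R => f (x + h *: v)).
Proof.
move=> sf h; apply: differentiable_continuous; apply/derivable1_diffP.
by have [] := smooth_bounded_line x v sf h.
Qed.

Lemma measurable_line f x v : smooth_bounded f ->
  measurable_fun [set: R] (fun h : R => f (x + h *: v)).
Proof. by move=> sf; apply: continuous_measurable_fun; exact: continuous_line. Qed.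

End lines.

(** * Iterated one-dimensional Gaussian averages *)

Section gauss_avg.
Context {R : realType} {n : nat}.
Local Notation gam := (normal_prob (0 : R) 1).
Implicit Types (f g : 'cV[R]_n -> R) (x v s : 'cV[R]_n) (l : seq 'cV[R]_n).

(** The average of f over x + Z s, with Z a standard Gaussian variable. A list
    of vectors stands for the sum of the Z s with independent Z, a Gaussian
    vector of covariance the sum of the s s^T. Every covariance, degenerate or
    not, is reached in this way, and no density on R^n occurs. *)
Definition gauss_avg s f x : R := \int[gam]_z f (x + z *: s).
Definition gauss_avgs l f := foldr gauss_avg f l.

Lemma integrable_line f x s : smooth_bounded f ->
  gam.-integrable setT (fun z : R => (f (x + z *: s))%:E).
Proof.
move=> sf; have [_ /(_ [::])[C HC]] := sf.
by apply: (@bounded_integrable _ _ _ gam _ C) => //; exact: measurable_line.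
Qed.

Lemma gauss_avg_le s f (C : R) : smooth_bounded f -> (forall x, `|f x| <= C) ->
  forall x, `|gauss_avg s f x| <= C.
Proof.
move=> sf fC x; apply: (@norm_Rintegral_le _ _ _ gam) => //.
exact: measurable_line.
Qed.

Lemma gauss_avg_lincomb (I : eqType) (r : seq I) (c : I -> R)
    (f : I -> 'cV[R]_n -> R) s x : (forall i, smooth_bounded (f i)) ->
  gauss_avg s (fun x => \sum_(i <- r) c i * f i x) x =
  \sum_(i <- r) c i * gauss_avg s (f i) x.
Proof.
move=> sf; rewrite /gauss_avg (Rintegral_lincomb (mu := gam))// => i.
exact: integrable_line.
Qed.

Lemma smooth_bounded_gauss_avg_jet s f : smooth_bounded f ->
  smooth_bounded (gauss_avg s f) /\
  forall a, iter_partial a (gauss_avg s f) = gauss_avg s (iter_partial a f).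
Proof.
move=> sf; pose J a := gauss_avg s (iter_partial a f).
have sfa a : smooth_bounded (iter_partial a f) by exact: smooth_bounded_partial.
have dJ a x v : is_derive x v (J a) (\sum_i v i 0 * J (i :: a) x).
  apply/is_derive_line0; rewrite /J/=.
  pose g x := \sum_i v i 0 * iter_partial (i :: a) f x.
  have sg : smooth_bounded g.
    exact: (smooth_bounded_lincomb (index_enum _) (fun i => v i 0)
      (f := fun i => iter_partial (i :: a) f) (fun i => sfa (i :: a))).
  have [_ /(_ [::])/= [C HC]] := sg.
  have <- : gauss_avg s g (x + 0 *: v) = \sum_i v i 0 * J (i :: a) x.
    rewrite scale0r addr0.
    exact: (gauss_avg_lincomb (index_enum _) (fun i => v i 0)
      (f := fun i => iter_partial (i :: a) f) s x (fun i => sfa (i :: a))).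
  apply: (@is_derive_Rintegral _ _ _ gam (fun h z => iter_partial a f (x + h *: v + z *: s))
    (fun h z => g (x + h *: v + z *: s)) (fun=> C) 0 1) => //.
  - by move=> h _; exact: integrable_line.
  - move=> h z _.
    under eq_fun do rewrite addrAC.
    by rewrite addrAC; apply/is_derive_line; have [D _] := sf; exact: D.
  - exact: (@bounded_integrable _ _ _ gam _ `|C|).
have bJ a : exists C, forall x, `|J a x| <= C.
  by have [_ /(_ a)[C HC]] := sf; exists C => x; exact: gauss_avg_le.
split; first exact: smooth_bounded_jet dJ bJ.
exact: iter_partial_jet.
Qed.

Lemma smooth_bounded_gauss_avg s f : smooth_bounded f -> smooth_bounded (gauss_avg s f).
Proof. by move=> /(smooth_bounded_gauss_avg_jet s)[]. Qed.

Lemma iter_partial_gauss_avg s f a : smooth_bounded f ->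
  iter_partial a (gauss_avg s f) = gauss_avg s (iter_partial a f).
Proof. by move=> /(smooth_bounded_gauss_avg_jet s)[_]; exact. Qed.

Lemma smooth_bounded_gauss_avgs l f : smooth_bounded f -> smooth_bounded (gauss_avgs l f).
Proof. by move=> sf; elim: l => //= s l IH; exact: smooth_bounded_gauss_avg. Qed.

Lemma iter_partial_gauss_avgs l f a : smooth_bounded f ->
  iter_partial a (gauss_avgs l f) = gauss_avgs l (iter_partial a f).
Proof.
move=> sf; elim: l => //= s l IH.
by rewrite iter_partial_gauss_avg ?IH//; exact: smooth_bounded_gauss_avgs.
Qed.

Lemma gauss_avgs_le l f (C : R) : smooth_bounded f -> (forall x, `|f x| <= C) ->
  forall x, `|gauss_avgs l f x| <= C.
Proof.
move=> sf fC; elim: l => //= s l IH; apply: gauss_avg_le => //.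
exact: smooth_bounded_gauss_avgs.
Qed.

Lemma gauss_avgs_lincomb (I : eqType) (r : seq I) (c : I -> R)
    (f : I -> 'cV[R]_n -> R) l : (forall i, smooth_bounded (f i)) ->
  gauss_avgs l (fun x => \sum_(i <- r) c i * f i x) =
  fun x => \sum_(i <- r) c i * gauss_avgs l (f i) x.
Proof.
move=> sf; elim: l => //= s l ->; apply/funext => x.
by rewrite gauss_avg_lincomb// => i; exact: smooth_bounded_gauss_avgs.
Qed.

Lemma gauss_avg0 f : gauss_avg 0 f = f.
Proof.
apply/funext => x; rewrite /gauss_avg.
under eq_Rintegral do rewrite scaler0 addr0.
exact: (@Rintegral_probability_cst _ _ _ gam).
Qed.

Lemma gauss_avgs_cat l l' f : gauss_avgs (l ++ l') f = gauss_avgs l (gauss_avgs l' f).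
Proof. by rewrite /gauss_avgs foldr_cat. Qed.

(** The trace of D times the Hessian of f. For D = s s^T it is the second
    derivative of f along s. *)
Definition mxlap (D : 'M[R]_n) f x : R :=
  \sum_i \sum_j D i j * iter_partial [:: i; j] f x.

Lemma mxlapE D f : mxlap D f =
  fun x => \sum_(p : 'I_n * 'I_n) D p.1 p.2 * iter_partial [:: p.1; p.2] f x.
Proof. by apply/funext => x; rewrite /mxlap pair_bigA. Qed.

Lemma smooth_bounded_mxlap D f : smooth_bounded f -> smooth_bounded (mxlap D f).
Proof.
move=> sf; rewrite mxlapE.
apply: (smooth_bounded_lincomb (index_enum _) (fun p => D p.1 p.2)
  (f := fun p => iter_partial [:: p.1; p.2] f)) => p.
exact: smooth_bounded_partial.
Qed.

Lemma mxlap_gauss_avgs D l f : smooth_bounded f ->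
  mxlap D (gauss_avgs l f) = gauss_avgs l (mxlap D f).
Proof.
move=> sf; rewrite !mxlapE.
rewrite (gauss_avgs_lincomb (index_enum _) (fun p => D p.1 p.2)
  (f := fun p => iter_partial [:: p.1; p.2] f)); last first.
  by move=> p; exact: smooth_bounded_partial.
by apply/funext => x; apply: eq_bigr => p _; rewrite iter_partial_gauss_avgs.
Qed.

Lemma mxlap_le (D : 'M[R]_n) f (M K : R) : (forall i j x, `|iter_partial [:: i; j] f x| <= M) ->
  0 <= M -> \sum_i \sum_j `|D i j| <= K -> forall x, `|mxlap D f x| <= K * M.
Proof.
move=> fM M0 DK x; apply: le_trans (ler_wpM2r M0 DK).
rewrite mulr_suml; apply: le_trans (ler_norm_sum _ _ _) _; apply: ler_sum => i _.
rewrite mulr_suml; apply: le_trans (ler_norm_sum _ _ _) _; apply: ler_sum => j _.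
by rewrite normrM ler_wpM2l.
Qed.

Lemma iter_partial_mxlap D f a : smooth_bounded f ->
  iter_partial a (mxlap D f) =
    fun x => \sum_(p : 'I_n * 'I_n) D p.1 p.2 * iter_partial (a ++ [:: p.1; p.2]) f x.
Proof.
move=> sf; rewrite mxlapE.
rewrite (iter_partial_lincomb (index_enum _) (fun p => D p.1 p.2)
  (f := fun p => iter_partial [:: p.1; p.2] f)); last first.
  by move=> p; exact: smooth_bounded_partial.
by apply/funext => x; apply: eq_bigr => p _; rewrite iter_partial_cat.
Qed.

End gauss_avg.

(** * Heat expansion in one direction *)

Section heat.
Context {R : realType} {n : nat}.
Local Notation gam := (normal_prob (0 : R) 1).
Implicit Types (f g : 'cV[R]_n -> R) (x v s : 'cV[R]_n) (l : seq 'cV[R]_n).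

Definition dirder s f x : R := \sum_i s i 0 * iter_partial [:: i] f x.

Lemma smooth_bounded_dirder s f : smooth_bounded f -> smooth_bounded (dirder s f).
Proof.
move=> sf; apply: (smooth_bounded_lincomb (index_enum _) (fun i => s i 0)
  (f := fun i => iter_partial [:: i] f)) => i.
exact: smooth_bounded_partial.
Qed.

Lemma dirder_dirder s f x : smooth_bounded f ->
  dirder s (dirder s f) x = mxlap (s *m s^T) f x.
Proof.
move=> sf; rewrite /mxlap /dirder; apply: eq_bigr => i _.
rewrite (iter_partial_lincomb (index_enum _) (fun i => s i 0)
  (f := fun i => iter_partial [:: i] f) [:: i]); last first.
  by move=> j; exact: smooth_bounded_partial.
rewrite mulr_sumr; apply: eq_bigr => j _.
by rewrite -iter_partial_cat mulrA; congr (_ * _); rewrite !mxE big_ord1 !mxE.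
Qed.

(** Differentiation brings out a factor z, which the Stein identity trades for
    a second derivative along s. *)
Lemma is_derive_gauss_avg_scale s f x (r : R) : smooth_bounded f ->
  is_derive r 1 (fun r => gauss_avg (r *: s) f x)
    (r * gauss_avg (r *: s) (mxlap (s *m s^T) f) x).
Proof.
move=> sf; have sd := smooth_bounded_dirder s sf.
have [_ /(_ [::])/= [C HC]] := sd.
have sL : smooth_bounded (mxlap (s *m s^T) f) by exact: smooth_bounded_mxlap.
have [_ /(_ [::])/= [C' HC']] := sL.
have -> : r * gauss_avg (r *: s) (mxlap (s *m s^T) f) x =
    \int[gam]_z (z * dirder s f (x + z *: (r *: s))).
  rewrite -(@RintegralZl _ _ _ gam)//; last exact: integrable_line.
  apply/esym; apply: (@Stein_identity R (fun z => dirder s f (x + z *: (r *: s)))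
    (fun z => r * mxlap (s *m s^T) f (x + z *: (r *: s))) (C + `|r| * C')).
  - move=> z; apply: is_derive_eq (smooth_bounded_line x (r *: s) sd z) _.
    rewrite -dirder_dirder// [in RHS]/dirder mulr_sumr; apply: eq_bigr => i _.
    by rewrite mxE mulrA.
  - by apply: measurable_funM => //; exact: measurable_line.
  - move=> z; apply: le_trans (HC _) _; rewrite lerDl mulr_ge0//.
    exact: le_trans (normr_ge0 _) (HC' x).
  - move=> z; rewrite normrM; apply: le_trans (ler_wpM2l _ (HC' _)) _ => //.
    by rewrite lerDr; exact: le_trans (normr_ge0 _) (HC x).
apply: (@is_derive_Rintegral _ _ _ gam (fun r z => f (x + z *: (r *: s)))
    (fun r z => z * dirder s f (x + z *: (r *: s))) (fun z => `|z| * C) _ 1) => //.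
- by move=> t _; exact: integrable_line.
- move=> t z _.
  have E (k : R) : z *: (k *: s) = k *: (z *: s) by rewrite !scalerA mulrC.
  under eq_fun do rewrite E.
  rewrite E.
  apply: is_derive_eq (smooth_bounded_line x (z *: s) sf t) _.
  rewrite /dirder mulr_sumr; apply: eq_bigr => i _.
  by rewrite mxE mulrA.
- rewrite /comp; under eq_fun do rewrite mulrC EFinM.
  by apply: integrableZl => //; exact: integrable_normr_normal.
- by move=> t z _; rewrite normrM ler_wpM2l.
Qed.

(** The natural parameter is the variance t: the derivative 1 / (2 sqrt t) of
    the square root cancels the factor r = sqrt t of the previous lemma. Differentiability is
    used at positive variances only, and continuity at 0.
    *)
Lemma gauss_avg_MVT s f x (a b : R) : smooth_bounded f -> 0 <= a -> a < b ->
  exists2 c, a < c < b &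
    gauss_avg (Num.sqrt b *: s) f x - gauss_avg (Num.sqrt a *: s) f x =
    (b - a) / 2 * gauss_avg (Num.sqrt c *: s) (mxlap (s *m s^T) f) x.
Proof.
move=> sf a0 ab.
have dq (t : R) : t \in `]a, b[ ->
    is_derive t 1 (fun t => gauss_avg (Num.sqrt t *: s) f x)
    (2^-1 * gauss_avg (Num.sqrt t *: s) (mxlap (s *m s^T) f) x).
  rewrite in_itv/= => /andP[at_ _]; have t0 : 0 < t by exact: le_lt_trans at_.
  apply: is_derive_eq (is_derive1_comp
    (is_derive_gauss_avg_scale s x (Num.sqrt t) sf) (is_derive1_sqrt t0)) _.
  have r0 : Num.sqrt t != 0 by rewrite sqrtr_eq0 -ltNge.
  by field.
have cq : {within `[a, b], continuous (fun t => gauss_avg (Num.sqrt t *: s) f x)}.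
  apply: continuous_subspaceT => t.
  apply: (@continuous_comp _ _ _ Num.sqrt (fun r => gauss_avg (r *: s) f x)).
    exact: sqrt_continuous.
  apply: differentiable_continuous; apply/derivable1_diffP.
  by have [] := is_derive_gauss_avg_scale s x (Num.sqrt t) sf.
have [c cab ->] := MVT ab dq cq.
exists c; first by move: cab; rewrite in_itv.
by field.
Qed.

Lemma gauss_avg_lip s f x (a b M : R) : smooth_bounded f -> 0 <= a -> 0 <= b ->
  (forall y, `|mxlap (s *m s^T) f y| <= M) ->
  `|gauss_avg (Num.sqrt b *: s) f x - gauss_avg (Num.sqrt a *: s) f x|
     <= `|b - a| * M / 2.
Proof.
move=> sf; wlog ab : a b / a <= b.
  move=> H; have [ab|/ltW ba] := leP a b; first exact: H.
  by move=> a0 b0 fM; rewrite distrC (distrC b); exact: H.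
move=> a0 b0 fM; move: ab; rewrite le_eqVlt => /predU1P[->|ab].
  by rewrite !subrr normr0 !mul0r.
have [c _ ->] := gauss_avg_MVT s x sf a0 ab.
rewrite !normrM (ger0_norm (_ : 0 <= 2^-1)) ?invr_ge0//.
rewrite -!mulrA ler_wpM2l// [leRHS]mulrC ler_wpM2l ?invr_ge0//.
by apply: gauss_avg_le => //; exact: smooth_bounded_mxlap.
Qed.

(** In the mean value theorem the intermediate variance c lies between a and b;
    replacing it by a costs one more Lipschitz estimate, hence an error of
    second order. *)
Lemma gauss_avg_taylor s f x (a b M : R) : smooth_bounded f -> 0 <= a -> 0 <= b ->
  (forall y, `|mxlap (s *m s^T) (mxlap (s *m s^T) f) y| <= M) ->
  `|gauss_avg (Num.sqrt b *: s) f x - gauss_avg (Num.sqrt a *: s) f x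
     - (b - a) / 2 * gauss_avg (Num.sqrt a *: s) (mxlap (s *m s^T) f) x|
     <= `|b - a| ^+ 2 * M / 4.
Proof.
move=> sf a0 b0 fM.
have sL := smooth_bounded_mxlap (s *m s^T) sf.
have M0 : 0 <= M by exact: le_trans (normr_ge0 _) (fM x).
have key c : 0 <= c -> `|c - a| <= `|b - a| ->
  `|(b - a) / 2 * gauss_avg (Num.sqrt c *: s) (mxlap (s *m s^T) f) x
    - (b - a) / 2 * gauss_avg (Num.sqrt a *: s) (mxlap (s *m s^T) f) x|
    <= `|b - a| ^+ 2 * M / 4.
  move=> c0 cab; rewrite -mulrBr normrM.
  have H := gauss_avg_lip x sL a0 c0 fM.
  rewrite normrM (ger0_norm (_ : 0 <= 2^-1)) ?invr_ge0//.
  apply: le_trans (ler_wpM2l _ H) _; first by rewrite mulr_ge0 ?invr_ge0.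
  have -> : `|b - a| ^+ 2 * M / 4 = `|b - a| / 2 * (`|b - a| * M / 2) by field.
  rewrite ler_wpM2l ?mulr_ge0 ?invr_ge0// ler_wpM2r ?invr_ge0//.
  by rewrite ler_wpM2r.
have [ab|ba|->] := ltgtP a b.
- have [c /andP[ac cb] ->] := gauss_avg_MVT s x sf a0 ab.
  by apply: key; [lra|rewrite !gtr0_norm; lra].
- have [c /andP[ac cb] E] := gauss_avg_MVT s x sf b0 ba.
  have -> : gauss_avg (Num.sqrt b *: s) f x - gauss_avg (Num.sqrt a *: s) f x
      = (b - a) / 2 * gauss_avg (Num.sqrt c *: s) (mxlap (s *m s^T) f) x.
    by apply: oppr_inj; rewrite opprB E -mulNr -mulNr opprB.
  by apply: key; [lra|rewrite !ltr0_norm; lra].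
- by rewrite !subrr !mul0r subr0 normr0 expr0n/= !mul0r.
Qed.

End heat.

(** * Heat expansion along a list of directions *)

Section heat_lists.
Context {R : realType} {n : nat}.
Implicit Types (f g : 'cV[R]_n -> R) (x v s : 'cV[R]_n) (l : seq 'cV[R]_n)
  (D : 'M[R]_n) (W : seq ('cV[R]_n * R * R)).

Lemma axpyE (c : R) f g : (fun x => c * f x + g x) =
  fun x => \sum_(k <- [:: true; false]) (if k then c else 1) * (if k then f else g) x.
Proof. by apply/funext => x; rewrite !big_cons big_nil mul1r addr0. Qed.

Lemma smooth_bounded_axpy (c : R) f g : smooth_bounded f -> smooth_bounded g ->
  smooth_bounded (fun x => c * f x + g x).
Proof.
move=> sf sg; rewrite axpyE; apply: (smooth_bounded_lincomb _ _
  (f := fun k : bool => if k then f else g)).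
by case.
Qed.

Lemma gauss_avgs_axpy (c : R) f g l : smooth_bounded f -> smooth_bounded g ->
  gauss_avgs l (fun x => c * f x + g x) =
  fun x => c * gauss_avgs l f x + gauss_avgs l g x.
Proof.
move=> sf sg; rewrite axpyE (gauss_avgs_lincomb _ _
  (f := fun k : bool => if k then f else g)); last by case.
by apply/funext => x; rewrite !big_cons big_nil mul1r addr0.
Qed.

Lemma mxlap_axpy (c : R) D D' f x :
  mxlap (c *: D + D') f x = c * mxlap D f x + mxlap D' f x.
Proof.
rewrite /mxlap mulr_sumr -big_split/=; apply: eq_bigr => i _.
rewrite mulr_sumr -big_split/=; apply: eq_bigr => j _.
by rewrite !mxE mulrDl mulrA.
Qed.

Definition entry_sum D : R := \sum_i \sum_j `|D i j|.

Lemma entry_sum_ge0 D : 0 <= entry_sum D.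
Proof. by rewrite sumr_ge0// => i _; rewrite sumr_ge0. Qed.

Lemma entry_sum_axpy (c : R) D D' :
  entry_sum (c *: D + D') <= `|c| * entry_sum D + entry_sum D'.
Proof.
rewrite /entry_sum mulr_sumr -big_split/=; apply: ler_sum => i _.
rewrite mulr_sumr -big_split/=; apply: ler_sum => j _.
by rewrite !mxE -normrM ler_normD.
Qed.

(** A bound of the sum of the entries of s s^T, chosen for its sum over a list
    to be a multiple of the trace of the covariance. *)
Definition sqweight s : R := n%:R * \sum_i s i 0 ^+ 2.

Lemma entry_sum_rank1 s : entry_sum (s *m s^T) <= sqweight s.
Proof.
have -> : sqweight s = \sum_i \sum_(j < n) (s i 0 ^+ 2 + s j 0 ^+ 2) / 2.
  under eq_bigr do under eq_bigr do rewrite mulrDl.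
  under eq_bigr do rewrite big_split/= sumr_const card_ord -mulr_suml.
  rewrite big_split/= sumr_const card_ord sumrMnl -mulr_suml.
  by rewrite /sqweight mulr_natl -mulr2n -mulrnA mulnC mulrnA -mulr_natr; field.
apply: ler_sum => i _; apply: ler_sum => j _; rewrite !mxE big_ord1 !mxE normrM.
have := sqr_ge0 (`|s i 0| - `|s j 0|).
rewrite -(real_normK (num_real (s i 0))) -(real_normK (num_real (s j 0))); nra.
Qed.

(** An entry (s, a, b) of W is a direction s whose variance moves from a to b.
    The lists lo W and hi W are the initial and final ones; dif W is the change
    of covariance and wt W bounds its size. *)
Definition lo W := [seq Num.sqrt w.1.2 *: w.1.1 | w <- W].
Definition hi W := [seq Num.sqrt w.2 *: w.1.1 | w <- W].
Definition dif W : 'M[R]_n := \sum_(w <- W) (w.2 - w.1.2) *: (w.1.1 *m w.1.1^T).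
Definition wt W : R := \sum_(w <- W) `|w.2 - w.1.2| * sqweight w.1.1.

Lemma sqweight_ge0 s : 0 <= sqweight s.
Proof. by rewrite mulr_ge0// sumr_ge0// => i _; exact: sqr_ge0. Qed.

Lemma wt_ge0 W : 0 <= wt W.
Proof. by rewrite sumr_ge0// => w _; rewrite mulr_ge0// sqweight_ge0. Qed.

Lemma entry_sum_dif W : entry_sum (dif W) <= wt W.
Proof.
rewrite /dif /wt; elim: W => [|w W IH].
  rewrite !big_nil /entry_sum big1// => i _; rewrite big1// => j _.
  by rewrite mxE normr0.
rewrite !big_cons; apply: le_trans (entry_sum_axpy _ _ _) _.
by rewrite lerD// ler_wpM2l// entry_sum_rank1.
Qed.

Definition bound4 f (M : R) := forall i j k m x, `|iter_partial [:: i; j; k; m] f x| <= M.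

Lemma mxlap2_le D D' f (M K K' : R) : smooth_bounded f -> bound4 f M -> 0 <= M ->
  entry_sum D <= K -> entry_sum D' <= K' ->
  forall x, `|mxlap D (mxlap D' f) x| <= K * (K' * M).
Proof.
move=> sf fM M0 DK DK'; have K'0 := le_trans (entry_sum_ge0 _) DK'.
apply: mxlap_le => //; last exact: mulr_ge0.
move=> i j x; rewrite iter_partial_mxlap//.
have -> : \sum_(p : 'I_n * 'I_n) D' p.1 p.2 *
    iter_partial ([:: i; j] ++ [:: p.1; p.2]) f x =
  \sum_a \sum_b D' a b * iter_partial [:: i; j; a; b] f x.
  by rewrite pair_bigA.
apply: le_trans (ler_wpM2r M0 DK').
rewrite mulr_suml; apply: le_trans (ler_norm_sum _ _ _) _; apply: ler_sum => a _.
rewrite mulr_suml; apply: le_trans (ler_norm_sum _ _ _) _; apply: ler_sum => b _.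
by rewrite normrM ler_wpM2l.
Qed.

(** Induction on the list: the first vector is handled by the one-dimensional
    estimates and the others by the induction hypothesis. The three errors p^2,
    2 p q and q^2 add up to the square of p + q, where p is the weight of the
    first vector and q that of the others. *)
Lemma gauss_avgs_taylor W f (M : R) x : smooth_bounded f -> bound4 f M -> 0 <= M ->
  (forall w, w \in W -> 0 <= w.1.2 /\ 0 <= w.2) ->
  `|gauss_avgs (hi W) f x - gauss_avgs (lo W) f x
     - gauss_avgs (lo W) (mxlap (dif W) f) x / 2| <= wt W ^+ 2 * M / 4.
Proof.
move=> sf fM M0; elim: W x => [|[[s a] b] W IH] x W0.
  rewrite /dif /wt !big_nil/= subrr sub0r.
  rewrite /mxlap big1 ?mul0r ?oppr0 ?normr0 ?expr0n/= ?mul0r// => i _.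
  by rewrite big1// => j _; rewrite mxE mul0r.
have [/= a0 b0] := W0 (s, a, b) (mem_head _ _).
have {}IH y : `|gauss_avgs (hi W) f y - gauss_avgs (lo W) f y
     - gauss_avgs (lo W) (mxlap (dif W) f) y / 2| <= wt W ^+ 2 * M / 4.
  by apply: IH => w wW; apply: W0; rewrite inE wW orbT.
have -> : dif ((s, a, b) :: W) = (b - a) *: (s *m s^T) + dif W.
  by rewrite /dif big_cons.
have -> : wt ((s, a, b) :: W) = `|b - a| * sqweight s + wt W.
  by rewrite /wt big_cons.
rewrite /= -/(lo W) -/(hi W).
set u := sqweight s; set w := wt W.
have u0 : 0 <= u by exact: sqweight_ge0.
have w0 : 0 <= w by exact: wt_ge0.
pose L := mxlap (s *m s^T) f.
pose g := mxlap (dif W) f.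
have sL : smooth_bounded L by exact: smooth_bounded_mxlap.
have sg : smooth_bounded g by exact: smooth_bounded_mxlap.
have -> : mxlap ((b - a) *: (s *m s^T) + dif W) f = fun x => (b - a) * L x + g x.
  by apply/funext => y; exact: mxlap_axpy.
rewrite gauss_avgs_axpy//.
pose F := gauss_avgs (lo W) f; pose F' := gauss_avgs (hi W) f.
have sF : smooth_bounded F by exact: smooth_bounded_gauss_avgs.
have sF' : smooth_bounded F' by exact: smooth_bounded_gauss_avgs.
pose PL := gauss_avgs (lo W) L; pose Pg := gauss_avgs (lo W) g.
have sPL : smooth_bounded PL by exact: smooth_bounded_gauss_avgs.
have sPg : smooth_bounded Pg by exact: smooth_bounded_gauss_avgs.
rewrite -/F -/F' -/PL -/Pg.
have := @gauss_avgs_axpy (b - a) PL Pg [:: Num.sqrt a *: s] sPL sPg.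
move=> /(congr1 (fun h => h x)) /= ->.
(* T1: error of the tail. T2: change of its second-order term when the first
   vector is rescaled. T3: error of the first vector. *)
have T1 : `|gauss_avg (Num.sqrt b *: s) F' x - gauss_avg (Num.sqrt b *: s) F x
    - gauss_avg (Num.sqrt b *: s) Pg x / 2| <= w ^+ 2 * M / 4.
  have s1 := smooth_bounded_axpy (- 1) sF sF'.
  have s2 := smooth_bounded_axpy (- 2^-1) sPg s1.
  have := gauss_avg_le (Num.sqrt b *: s) s2 (C := w ^+ 2 * M / 4) _ x.
  have := @gauss_avgs_axpy (- 2^-1) Pg _ [:: Num.sqrt b *: s] sPg s1.
  move=> /(congr1 (fun h => h x)) /= ->.
  have := @gauss_avgs_axpy (- 1) F F' [:: Num.sqrt b *: s] sF sF'.
  move=> /(congr1 (fun h => h x)) /= -> H.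
  have -> : gauss_avg (Num.sqrt b *: s) F' x - gauss_avg (Num.sqrt b *: s) F x
    - gauss_avg (Num.sqrt b *: s) Pg x / 2 =
    - 2^-1 * gauss_avg (Num.sqrt b *: s) Pg x +
    (-1 * gauss_avg (Num.sqrt b *: s) F x + gauss_avg (Num.sqrt b *: s) F' x) by ring.
  apply: H => y; apply: le_trans (IH y); rewrite le_eqVlt; apply/orP; left.
  by apply/eqP; congr `|_|; rewrite -/F -/F' -/Pg; ring.
have T2 : `|gauss_avg (Num.sqrt b *: s) Pg x - gauss_avg (Num.sqrt a *: s) Pg x|
    <= `|b - a| * (u * (w * M)) / 2.
  apply: gauss_avg_lip => // y; rewrite mxlap_gauss_avgs//.
  apply: gauss_avgs_le => [|z]; first exact: smooth_bounded_mxlap.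
  by apply: mxlap2_le => //; [exact: entry_sum_rank1|exact: entry_sum_dif].
have T3 : `|gauss_avg (Num.sqrt b *: s) F x - gauss_avg (Num.sqrt a *: s) F x
    - (b - a) / 2 * gauss_avg (Num.sqrt a *: s) PL x| <= `|b - a| ^+ 2 * (u * (u * M)) / 4.
  rewrite /PL -mxlap_gauss_avgs//; apply: gauss_avg_taylor => // y.
  rewrite mxlap_gauss_avgs// mxlap_gauss_avgs; last exact: smooth_bounded_mxlap.
  apply: gauss_avgs_le => [|z]; first by do 2 apply: smooth_bounded_mxlap.
  by apply: mxlap2_le => //; exact: entry_sum_rank1.
move: T1 T2 T3.
set B1 := gauss_avg _ F' x; set B2 := gauss_avg _ F x; set B3 := gauss_avg _ Pg x.
set A1 := gauss_avg _ Pg x; set A2 := gauss_avg _ F x; set A3 := gauss_avg _ PL x.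
move=> T1 T2 T3.
have -> : B1 - A2 - ((b - a) * A3 + A1) / 2 =
  (B1 - B2 - B3 / 2) + ((B3 - A1) / 2 + (B2 - A2 - (b - a) / 2 * A3)) by field.
apply: le_trans (ler_normD _ _) _; apply: le_trans (lerD T1 (ler_normD _ _)) _.
rewrite [`|(_ - _) / 2|]normrM (ger0_norm (_ : 0 <= 2^-1)) ?invr_ge0//.
have p0 : 0 <= `|b - a| * u * w * M by do 3 apply: mulr_ge0 => //.
move: (`|b - a|) (`|B3 - A1|) (`|B2 - A2 - _|) T2 T3 p0 => c y1 y2 T2 T3 p0; nra.
Qed.

End heat_lists.

(** * Dependence on the covariance alone *)

Section gauss_cov.
Context {R : realType} {n : nat}.
Implicit Types (f g : 'cV[R]_n -> R) (x v s : 'cV[R]_n) (l : seq 'cV[R]_n)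
  (D : 'M[R]_n) (W : seq ('cV[R]_n * R * R)).

Definition cov l : 'M[R]_n := \sum_(s <- l) s *m s^T.

Lemma cov_cat l l' : cov (l ++ l') = cov l + cov l'.
Proof. exact: big_cat. Qed.

Lemma bound4_exists f : smooth_bounded f -> exists2 M, 0 <= M & bound4 f M.
Proof.
move=> [_ bf]; have [C HC] := choice bf.
exists (\sum_(p : 'I_n * 'I_n * 'I_n * 'I_n)
  `|C [:: p.1.1.1; p.1.1.2; p.1.2; p.2]|); first by rewrite sumr_ge0.
move=> i j k m x; apply: le_trans (HC _ x) _; apply: le_trans (ler_norm _) _.
by rewrite (bigD1 (i, j, k, m))//= lerDl sumr_ge0.
Qed.

(** N increments of size 1 / N add up to at most K / N, for every N. *)
Lemma quadratic_increment_cst (g : R -> R) (K : R) :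
  (forall a b, 0 <= a <= 1 -> 0 <= b <= 1 -> `|g b - g a| <= K * `|b - a| ^+ 2) ->
  g 1 = g 0.
Proof.
move=> gK.
have step (N : nat) : (0 < N)%N -> `|g 1 - g 0| <= K / N%:R.
  move=> N0; have N0' : 0 < N%:R :> R by rewrite ltr0n.
  have H k : (k <= N)%N -> `|g (k%:R / N%:R) - g 0| <= k%:R * (K / N%:R ^+ 2).
    elim: k => [_|k IH kN]; first by rewrite mul0r subrr normr0 mul0r.
    have -> : g (k.+1%:R / N%:R) - g 0 =
      (g (k.+1%:R / N%:R) - g (k%:R / N%:R)) + (g (k%:R / N%:R) - g 0) by ring.
    apply: le_trans (ler_normD _ _) _.
    rewrite -[X in _ <= X * _]natr1 [leRHS]mulrDl mul1r addrC lerD//; first exact/IH/ltnW.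
    apply: le_trans (gK _ _ _ _) _.
    - by rewrite divr_ge0//= ler_pdivrMr// mul1r ler_nat ltnW.
    - by rewrite divr_ge0//= ler_pdivrMr// mul1r ler_nat.
    rewrite -mulrBl -natrB// subSnn mul1r ger0_norm ?invr_ge0//.
    by rewrite exprVn.
  have := H N (leqnn N); rewrite divff ?gt_eqF//.
  by congr (_ <= _); field; rewrite gt_eqF.
apply/eqP; rewrite -subr_eq0 -normr_le0 leNgt; apply/negP => d0.
have K0 : 0 < K.
  by have := lt_le_trans d0 (step 1%N isT); rewrite divr1.
pose N := (Num.bound (K / `|g 1 - g 0|)).+1.
have := step N isT; rewrite leNgt => /negP; apply.
rewrite ltr_pdivrMr ?ltr0n// mulrC -ltr_pdivrMr//.
have : K / `|g 1 - g 0| < (Num.bound (K / `|g 1 - g 0|))%:R.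
  by apply: archi_boundP; rewrite divr_ge0// ltW.
by move/lt_le_trans; apply; rewrite ler_nat leqnSn.
Qed.

Lemma gauss_avgs_scale0 l f : gauss_avgs [seq (0 : R) *: s | s <- l] f = f.
Proof. by elim: l => //= s l ->; rewrite scale0r gauss_avg0. Qed.

Lemma dif_cat W W' : dif (W ++ W') = dif W + dif W'.
Proof. exact: big_cat. Qed.

Lemma wt_cat W W' : wt (W ++ W') = wt W + wt W'.
Proof. exact: big_cat. Qed.

Lemma dif_const l (a b : R) : dif [seq (s, a, b) | s <- l] = (b - a) *: cov l.
Proof. by rewrite /dif big_map/= scaler_sumr. Qed.

Lemma wt_const l (a b : R) :
  wt [seq (s, a, b) | s <- l] = `|b - a| * \sum_(s <- l) sqweight s.
Proof. by rewrite /wt big_map/= mulr_sumr. Qed.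

Lemma lo_const l (a b : R) : lo [seq (s, a, b) | s <- l] = [seq Num.sqrt a *: s | s <- l].
Proof. by rewrite /lo -map_comp. Qed.

Lemma hi_const l (a b : R) : hi [seq (s, a, b) | s <- l] = [seq Num.sqrt b *: s | s <- l].
Proof. by rewrite /hi -map_comp. Qed.

(** The variances are moved from l to l' along the path sqrt (1 - a) l ++ sqrt
    a l'. The covariance is constant along it, so the first-order term of each
    increment is zero, the increments are quadratic, and the average is
    constant. This is the uniqueness of the Gaussian law with a given
    covariance, tested on smooth functions. *)
Lemma gauss_avgs_cov l l' f : smooth_bounded f -> cov l = cov l' ->
  gauss_avgs l f = gauss_avgs l' f.
Proof.
move=> sf ll'; apply/funext => x; have [M M0 fM] := bound4_exists sf.
pose p (a : R) := [seq Num.sqrt (1 - a) *: s | s <- l] ++ [seq Num.sqrt a *: s | s <- l'].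
pose K := \sum_(s <- l) sqweight s + \sum_(s <- l') sqweight s.
have := @quadratic_increment_cst (fun a => gauss_avgs (p a) f x) (K ^+ 2 * M / 4).
rewrite /p subrr subr0 sqrtr1 sqrtr0 !gauss_avgs_cat !gauss_avgs_scale0.
have E k : [seq (1 : R) *: s | s <- k] = k :> seq 'cV[R]_n.
  by rewrite (eq_map (@scale1r _ _)) map_id.
rewrite !E => H; apply/esym; apply: H => a b /andP[a0 a1] /andP[b0 b1].
(* One step of the path, from parameter a to parameter b. *)
pose W := [seq (s, 1 - a, 1 - b) | s <- l] ++ [seq (s, a, b) | s <- l'].
have W0 w : w \in W -> 0 <= w.1.2 /\ 0 <= w.2.
  by rewrite mem_cat => /orP[] /mapP[s _ ->]/=; rewrite ?subr_ge0.
have := gauss_avgs_taylor x sf fM M0 W0.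
have -> : dif W = 0.
  rewrite dif_cat !dif_const ll' -scalerDl.
  by rewrite (_ : _ + _ = 0) ?scale0r//; ring.
have -> : wt W = `|b - a| * K.
  rewrite wt_cat !wt_const /K mulrDr; congr (_ * _ + _).
  by rewrite -normrN; congr `|_|; ring.
have -> : mxlap 0 f = fun x => 0 * f x + 0 * f x.
  apply/funext => y; rewrite /mxlap big1 ?mul0r ?addr0// => i _.
  by rewrite big1// => j _; rewrite mxE mul0r.
rewrite (_ : hi W = p b); last by rewrite /hi map_cat -/(hi _) -/(hi _) !hi_const.
rewrite (_ : lo W = p a); last by rewrite /lo map_cat -/(lo _) -/(lo _) !lo_const.
rewrite (_ : (fun x => 0 * f x + 0 * f x) = fun x => \sum_(i <- [::] : seq 'I_0) 0 * f x).
  rewrite gauss_avgs_lincomb// big_nil mul0r subr0.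
  by rewrite exprMn -/(p a) -/(p b) => /le_trans; apply; rewrite le_eqVlt; apply/orP; left; apply/eqP; ring.
by apply/funext => y; rewrite big_nil !mul0r addr0.
Qed.

Lemma sum_sqweight_cov l : \sum_(s <- l) sqweight s = n%:R * \tr (cov l).
Proof.
rewrite /cov raddf_sum/= mulr_sumr; apply: eq_bigr => s _; congr (_ * _).
by apply: eq_bigr => i _; rewrite !mxE big_ord1 !mxE expr2.
Qed.

(** By gauss_avgs_cov the list l' may be replaced with l ++ d, and then only
    the vectors of d change their variance, from 0 to 1. This is the heat
    equation in terms of covariances: square roots of a singular covariance
    need not depend smoothly on it, but the list d can be chosen anew for each
    increment. *)
Lemma gauss_avgs_increment l l' d f (M : R) x : smooth_bounded f -> bound4 f M ->
  0 <= M -> cov l' = cov l + cov d ->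
  `|gauss_avgs l' f x - gauss_avgs l f x - gauss_avgs l (mxlap (cov d) f) x / 2|
    <= (n%:R * \tr (cov d)) ^+ 2 * M / 4.
Proof.
move=> sf fM M0 E.
have -> : gauss_avgs l' f = gauss_avgs (l ++ d) f.
  by apply: gauss_avgs_cov => //; rewrite cov_cat.
(* The vectors of l keep their variance 1. *)
pose W := [seq (s, 1 : R, 1 : R) | s <- l] ++ [seq (s, 0 : R, 1 : R) | s <- d].
have W0 w : w \in W -> 0 <= w.1.2 /\ 0 <= w.2.
  by rewrite mem_cat => /orP[] /mapP[s _ ->]/=.
have := gauss_avgs_taylor x sf fM M0 W0.
have scale1 k : [seq (1 : R) *: s | s <- k] = k :> seq 'cV[R]_n.
  by rewrite (eq_map (@scale1r _ _)) map_id.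
have -> : hi W = l ++ d.
  by rewrite /hi map_cat -/(hi _) -/(hi _) !hi_const sqrtr1 !scale1.
have -> : lo W = l ++ [seq (0 : R) *: s | s <- d].
  by rewrite /lo map_cat -/(lo _) -/(lo _) !lo_const sqrtr1 sqrtr0 scale1.
rewrite dif_cat !dif_const subrr scale0r add0r subr0 scale1r.
rewrite wt_cat !wt_const subrr normr0 mul0r add0r subr0 normr1 mul1r sum_sqweight_cov.
by rewrite !gauss_avgs_cat !gauss_avgs_scale0.
Qed.

End gauss_cov.

(** * Square roots of positive semidefinite matrices *)

Section psd.
Context {R : rcfType}.

Definition mxform n (D : 'M[R]_n) (v : 'cV[R]_n) : R := (v^T *m D *m v) 0 0.

Lemma mxform_col (n : nat) (D : 'M[R]_(1 + n)) (a : 'M[R]_1) (w : 'cV[R]_n) :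
  D^T = D ->
  mxform D (col_mx a w) = ulsubmx D 0 0 * a 0 0 ^+ 2
    + (a 0 0 * (w^T *m dlsubmx D) 0 0) *+ 2 + mxform (drsubmx D) w.
Proof.
move=> sD; rewrite /mxform -{1}(submxK D) tr_col_mx mul_row_block mul_row_col.
have -> : ursubmx D = (dlsubmx D)^T by rewrite trmx_dlsub sD.
rewrite [a]mx11_scalar [ulsubmx D]mx11_scalar !tr_scalar_mx.
rewrite !mul_scalar_mx !mul_mx_scalar scalerDr.
rewrite mulmxDl -!scalemxAl.
have -> : (dlsubmx D)^T *m w = (w^T *m dlsubmx D)^T by rewrite trmx_mul trmxK.
rewrite !mxE eqxx !mulr1n; ring.
Qed.

(** Induction on the size by Schur complement. If the corner entry is zero then
    so is its column; otherwise each value of the Schur complement is a value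
    of the form. The convention 0^-1 = 0 lets one block matrix serve in both
    cases. *)
Lemma psd_root (n : nat) (D : 'M[R]_n) : D^T = D -> (forall v, 0 <= mxform D v) ->
  exists S : 'M[R]_n, S *m S^T = D.
Proof.
elim: n D => [|n IH] D sD pD; first by exists 0; apply/matrixP => -[].
pose D1 : 'M[R]_(1 + n) := D.
have sD1 : D1^T = D1 by [].
have pD1 (a : 'M[R]_1) (w : 'cV[R]_n) : 0 <= ulsubmx D1 0 0 * a 0 0 ^+ 2
    + (a 0 0 * (w^T *m dlsubmx D1) 0 0) *+ 2 + mxform (drsubmx D1) w.
  by rewrite -(mxform_col a w sD1); exact: pD.
set u := dlsubmx D1 in pD1; set al : R := ulsubmx D1 0 0 in pD1.
have al0 : 0 <= al.
  have := pD1 1%:M 0; rewrite trmx0 mul0mx /mxform trmx0 !mul0mx !mxE eqxx.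
  by rewrite mulr0 mul0rn !addr0 expr1n mulr1.
have alu : al = 0 -> u = 0.
  move=> a0; apply/colP => i; rewrite [RHS]mxE; apply/eqP/negPn/negP => ui.
  have u2 : u i 0 *+ 2 != 0 by rewrite mulrn_eq0.
  (* At the chosen vector the form takes the value -1. *)
  pose q := mxform (drsubmx D1) (delta_mx i 0).
  have := pD1 (- (q + 1) / (u i 0 *+ 2))%:M (delta_mx i 0).
  have -> : ((delta_mx i 0 : 'cV[R]_n)^T *m u) 0 0 = u i 0.
    rewrite mxE (bigD1 i)//= !mxE !eqxx mul1r big1 ?addr0// => k ki.
    by rewrite !mxE (negbTE ki) mul0r.
  move: u2; rewrite -/q a0 mul0r add0r !mxE eqxx mulr1n -mulrnAr => u2; rewrite divfK//.
  by rewrite opprD addrAC addNr add0r lerNr oppr0 lt_geF.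
pose D2 := drsubmx D1 - al^-1 *: (u *m u^T).
have sdr : (drsubmx D1)^T = drsubmx D1 by rewrite trmx_drsub sD1.
have [||S' S'E] := IH D2.
- by rewrite /D2 linearB/= linearZ/= trmx_mul trmxK sdr.
- move=> w.
  set y := (w^T *m u) 0 0.
  (* The minimizer of the form with respect to its first coordinate. *)
  pose a1 : 'M[R]_1 := (- al^-1 * y)%:M.
  have a1E : a1 0 0 = - al^-1 * y by rewrite mxE eqxx mulr1n.
  have := pD1 a1 w; rewrite a1E -/y.
  have -> : mxform D2 w = mxform (drsubmx D1) w - al^-1 * y ^+ 2.
    rewrite /mxform /D2 mulmxBr mulmxBl mxE; congr (_ + _).
    rewrite -scalemxAr -scalemxAl [LHS]mxE [X in - X]mxE; congr (- (_ * _)).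
    rewrite mulmxA -(mulmxA (w^T *m u)); have -> : u^T *m w = (w^T *m u)^T by rewrite trmx_mul trmxK.
    by rewrite mxE big_ord1 [X in _ * X]mxE expr2.
  have [a0|a0] := eqVneq al 0.
    by rewrite a0 invr0 oppr0 !mul0r mul0rn !add0r subr0.
  move=> H; apply: le_trans H _; rewrite le_eqVlt; apply/orP; left; apply/eqP.
  by field.
pose S : 'M[R]_(1 + n) := block_mx (Num.sqrt al)%:M 0 ((Num.sqrt al)^-1 *: u) S'.
suff SE : S *m S^T = D1 by exists S.
rewrite /S tr_block_mx mulmx_block !trmx0 !mul0mx !mulmx0 !addr0.
rewrite tr_scalar_mx linearZ/= S'E -scalar_mxM -expr2 sqr_sqrtr//.
rewrite mul_scalar_mx mul_mx_scalar !scalerA -scalemxAl -scalemxAr scalerA.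
rewrite -invfM -expr2 sqr_sqrtr// /D2 addrC subrK.
have E1 : (Num.sqrt al / Num.sqrt al) *: u = u.
  have [a0|a0] := eqVneq al 0; first by rewrite alu// scaler0.
  by rewrite divff ?scale1r// sqrtr_eq0 -ltNge lt_neqAle eq_sym a0.
have E2 : (Num.sqrt al / Num.sqrt al) *: u^T = u^T.
  by rewrite -linearZ/= E1.
rewrite E1 E2 -mx11_scalar -[RHS](submxK D1); congr block_mx.
by rewrite /u trmx_dlsub sD1.
Qed.

End psd.

(** * Entrywise calculus of matrices *)

Section entrywise.
Context {R : realType}.

Lemma cvg_mx_entries (m n : nat) (u : nat -> 'M[R]_(m, n)) (M : 'M[R]_(m, n)) :
  (forall i j, u k i j @[k --> \oo] --> M i j) -> u k @[k --> \oo] --> M.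
Proof.
move=> uM; apply/cvgrPdist_le => /= e e0; near=> x.
rewrite /Num.Def.normr/= mx_normrE (bigmax_le _ (ltW e0))//= => i _.
rewrite !mxE/=; move: i; near: x; apply: filter_forall => /= i.
exact: ((cvgrPdist_le _ _).1 (uM i.1 i.2)).
Unshelve. all: by end_near. Qed.

Lemma cvg_lsum (T : Type) (F : set_system T) {FF : Filter F} (I : Type) (r : seq I)
    (f : I -> T -> R) (l : I -> R) : (forall i, f i x @[x --> F] --> l i) ->
  \sum_(i <- r) f i x @[x --> F] --> \sum_(i <- r) l i.
Proof.
move=> H; elim: r => [|i r IH].
  by under eq_fun do rewrite big_nil; rewrite big_nil; exact: cvg_cst.
under eq_fun do rewrite big_cons.
by rewrite big_cons; exact: cvgD.
Qed.

(** Entrywise, so that one-variable lemmas apply directly. *)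
Definition mx_is_derive (m n : nat) (M : R -> 'M[R]_(m, n)) (dM : 'M[R]_(m, n)) (t : R) :=
  forall i j, is_derive t 1 (fun s => M s i j) (dM i j).

Lemma mx_is_derive_cst m n (M : 'M[R]_(m, n)) t : mx_is_derive (fun=> M) 0 t.
Proof. by move=> i j; rewrite mxE; exact: is_derive_cst. Qed.

Lemma mx_is_deriveD m n (M N : R -> 'M[R]_(m, n)) dM dN t :
  mx_is_derive M dM t -> mx_is_derive N dN t ->
  mx_is_derive (fun s => M s + N s) (dM + dN) t.
Proof.
move=> HM HN i j; rewrite mxE; under eq_fun do rewrite mxE.
exact: is_deriveD.
Qed.

Lemma mx_is_deriveN m n (M : R -> 'M[R]_(m, n)) dM t :
  mx_is_derive M dM t -> mx_is_derive (fun s => - M s) (- dM) t.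
Proof. by move=> HM i j; rewrite mxE; under eq_fun do rewrite mxE; exact: is_deriveN. Qed.

Lemma mx_is_derive_tr m n (M : R -> 'M[R]_(m, n)) dM t :
  mx_is_derive M dM t -> mx_is_derive (fun s => (M s)^T) dM^T t.
Proof. by move=> HM i j; rewrite mxE; under eq_fun do rewrite mxE; exact: HM. Qed.

Lemma is_derive_lsum (I : Type) (r : seq I) (f : I -> R -> R) (df : I -> R) (t : R) :
  (forall i, is_derive t 1 (f i) (df i)) ->
  is_derive t 1 (fun s => \sum_(i <- r) f i s) (\sum_(i <- r) df i).
Proof.
move=> H; elim: r => [|i r IH].
  by under eq_fun do rewrite big_nil; rewrite big_nil; exact: is_derive_cst.
under eq_fun do rewrite big_cons.
by rewrite big_cons; exact: is_deriveD.
Qed.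

Lemma mx_is_deriveM m n p (M : R -> 'M[R]_(m, n)) (N : R -> 'M[R]_(n, p)) dM dN t :
  mx_is_derive M dM t -> mx_is_derive N dN t ->
  mx_is_derive (fun s => M s *m N s) (dM *m N t + M t *m dN) t.
Proof.
move=> HM HN i j; rewrite !mxE -big_split/=.
under eq_fun do rewrite mxE.
apply: is_derive_lsum => k.
apply: is_derive_eq (is_deriveM (HM i k) (HN k j)) _.
by rewrite /GRing.scale/=; ring.
Qed.

Lemma mx_is_derive_opp m n (M : R -> 'M[R]_(m, n)) dM (t : R) :
  mx_is_derive M dM (- t) -> mx_is_derive (fun s => M (- s)) (- dM) t.
Proof.
move=> HM i j.
apply: is_derive_eq (is_derive1_comp (HM i j) (is_deriveNid t 1)) _.
by rewrite mxE mulrN1.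
Qed.

Lemma mx_derive0_cst m n (M : R -> 'M[R]_(m, n)) (s t : R) :
  (forall r, mx_is_derive M 0 r) -> M s = M t.
Proof.
move=> H; apply/matrixP => i j; apply: (is_derive_0_is_cst (f := fun s => M s i j)) => r.
by have := H r i j; rewrite mxE.
Qed.

End entrywise.

(** * The matrix exponential *)

Section expmx_calculus.
Context {R : realType} {n : nat}.
Variable A : 'M[R]_n.

Lemma exprZmx (t : R) k : (t *: A) ^+ k = t ^+ k *: A ^+ k.
Proof.
elim: k => [|k IH]; first by rewrite !expr0 scale1r.
rewrite !exprS IH; transitivity ((t *: A) *m (t ^+ k *: A ^+ k)) => //.
by rewrite -scalemxAl -scalemxAr scalerA.
Qed.

Let a := 1 + \sum_i \sum_j `|A i j|.

Lemma entry_expmx_le k i j : `|(A ^+ k) i j| <= a ^+ k.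
Proof.
have a1 : 1 <= a by rewrite /a lerDl sumr_ge0// => ? _; rewrite sumr_ge0.
have a0 : 0 <= a by apply: le_trans a1.
elim: k i j => [|k IH] i j.
  by rewrite !expr0 mxE; case: (i == j); rewrite ?normr1 ?normr0.
rewrite exprS mxE exprS; apply: le_trans (ler_norm_sum _ _ _) _.
apply: le_trans (_ : \sum_l `|A i l| * a ^+ k <= _).
  by apply: ler_sum => l _; rewrite normrM ler_wpM2l.
rewrite -mulr_suml ler_wpM2r ?exprn_ge0//.
by rewrite /a [X in 1 + X](bigD1 i)//= addrCA lerDl addr_ge0// sumr_ge0// => ? _; rewrite sumr_ge0.
Qed.

(** The coefficients of an entry of the m-th derivative of the exponential. *)
Let c m i j (k : nat) : R := k`!%:R^-1 * (A ^+ (k + m)) i j.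

Lemma is_cvg_expmx_pseries m i j t : cvgn (pseries (c m i j) t).
Proof.
have a1 : 1 <= a by rewrite /a lerDl sumr_ge0// => ? _; rewrite sumr_ge0.
have a0 : 0 <= a by apply: le_trans a1.
apply: normed_cvg.
apply: (@series_le_cvg _ _ (fun k => a ^+ m * exp_coeff (a * `|t|) k)) => //.
- by move=> k; exact: normr_ge0.
- move=> k; apply: mulr_ge0; first exact: exprn_ge0.
  by apply: exp_coeff_ge0; exact: mulr_ge0.
- move=> k; rewrite /= /c !normrM normrX (ger0_norm (_ : 0 <= _^-1)) ?invr_ge0//.
  rewrite /exp_coeff/= exprMn.
  have -> : a ^+ m * (a ^+ k * `|t| ^+ k / k`!%:R) = k`!%:R^-1 * a ^+ (k + m) * `|t| ^+ k.
    by rewrite exprD; ring.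
  rewrite ler_wpM2r ?exprn_ge0// ler_wpM2l ?invr_ge0//.
  exact: entry_expmx_le.
exact: (@is_cvg_seriesZ _ _ (a ^+ m) (is_cvg_series_exp_coeff (a * `|t|))).
Qed.

Lemma expmx_pseriesE t i j : expmx (t *: A) i j = limn (pseries (c 0 i j) t).
Proof.
pose M := \matrix_(i, j) limn (pseries (c 0 i j) t).
have : series (fun k => k`!%:R^-1 *: (t *: A) ^+ k) N @[N --> \oo] --> M.
  apply: cvg_mx_entries => {}i {}j; rewrite mxE.
  have := @is_cvg_expmx_pseries 0 i j t.
  rewrite (_ : (fun N => _) = pseries (c 0 i j) t)//.
  apply/funext => N; rewrite /pseries /series/= summxE; apply: eq_bigr => k _.
  by rewrite exprZmx !mxE /c addn0; ring.
by move=> /cvg_lim E; rewrite /expmx E// mxE.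
Qed.

Lemma pseries_diffs_c m i j : pseries_diffs (c m i j) = c m.+1 i j.
Proof.
apply/funext => k; rewrite /pseries_diffs /c factS natrM invfM addSnnS mulrA.
by rewrite mulrA divff ?mul1r// pnatr_eq0.
Qed.

(** The termwise derivative of the exponential series factors through A on the
    left as well as on the right. *)
Lemma pseries_c1 i j t : limn (pseries (c 1 i j) t) = (A *m expmx (t *: A)) i j
  /\ limn (pseries (c 1 i j) t) = (expmx (t *: A) *m A) i j.
Proof.
split; rewrite mxE; apply/cvg_lim => //.
  have -> : pseries (c 1 i j) t = fun N => \sum_l A i l * pseries (c 0 l j) t N.
    apply/funext => N; rewrite /pseries /series/=.
    under [RHS]eq_bigr do rewrite mulr_sumr.
    rewrite exchange_big/=; apply: eq_bigr => k _.
    rewrite /c addn1 addn0 exprS mxE mulr_sumr mulr_suml.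
    by apply: eq_bigr => l _; ring.
  apply: cvg_lsum => l; apply: cvgMl_tmp.
  by rewrite expmx_pseriesE; exact: is_cvg_expmx_pseries.
have -> : pseries (c 1 i j) t = fun N => \sum_l pseries (c 0 i l) t N * A l j.
  apply/funext => N; rewrite /pseries /series/=.
  under [RHS]eq_bigr do rewrite mulr_suml.
  rewrite exchange_big/=; apply: eq_bigr => k _.
  rewrite /c addn1 addn0 exprSr mxE mulr_sumr mulr_suml.
  by apply: eq_bigr => l _; ring.
apply: cvg_lsum => l; apply: cvgMr_tmp.
by rewrite expmx_pseriesE; exact: is_cvg_expmx_pseries.
Qed.

Lemma expmx_comm t : A *m expmx (t *: A) = expmx (t *: A) *m A.
Proof. by apply/matrixP => i j; have [<- <-] := pseries_c1 i j t. Qed.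

Lemma mx_is_derive_expmx (t : R) :
  mx_is_derive (fun t => expmx (t *: A)) (A *m expmx (t *: A)) t.
Proof.
move=> i j; have [<- _] := pseries_c1 i j t.
under eq_fun do rewrite expmx_pseriesE.
rewrite -pseries_diffs_c.
apply: (@pseries_snd_diffs _ _ (`|t| + 1)); rewrite ?pseries_diffs_c;
  [exact: is_cvg_expmx_pseries..|].
by rewrite [ltRHS]ger0_norm ?addr_ge0// ltrDl.
Qed.

Lemma expmx0 : expmx (0 *: A) = 1%:M.
Proof.
apply/matrixP => i j; rewrite expmx_pseriesE.
apply/cvg_lim => //; rewrite -cvg_shiftS.
rewrite (_ : (fun N => _) = fun=> 1%:M i j); first exact: cvg_cst.
apply/funext => N; rewrite /pseries /series/= big_nat_recl//= expr0 mulr1.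
rewrite big1 ?addr0; last by move=> k _; rewrite expr0n/= mulr0.
by rewrite /c fact0 invr1 mul1r expr0.
Qed.

(** The product has derivative zero and is the identity at 0. *)
Lemma expmxNK t : expmx (- t *: A) *m expmx (t *: A) = 1%:M.
Proof.
pose M s := expmx (- s *: A) *m expmx (s *: A).
have -> : 1%:M = M 0 by rewrite /M oppr0 expmx0 mulmx1.
apply: (@mx_derive0_cst _ _ _ M) => s.
have := mx_is_deriveM (mx_is_derive_opp (@mx_is_derive_expmx (- s))) (mx_is_derive_expmx s).
congr mx_is_derive.
by rewrite expmx_comm mulNmx mulmxA addNr.
Qed.

Lemma expmxKN t : expmx (t *: A) *m expmx (- t *: A) = 1%:M.
Proof. exact/mulmx1C/expmxNK. Qed.

End expmx_calculus.

Lemma expmx_tr {R : realType} {n : nat} (A : 'M[R]_n) (t : R) :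
  expmx (t *: A^T) = (expmx (t *: A))^T.
Proof.
have trX k : (A^T) ^+ k = (A ^+ k)^T.
  by elim: k => [|k IH]; [rewrite !expr0 trmx1|rewrite exprS exprSr IH trmx_mul].
apply/matrixP => i j; rewrite mxE !expmx_pseriesE.
congr (limn _); rewrite /pseries; congr series; apply/funext => k.
by rewrite /= trX mxE.
Qed.

(** * The Gramian carried back to time 0 *)

Section gramian.
Context {R : realType} {n : nat}.
Variables (A : 'M[R]_n) (b : 'cV[R]_n).
Local Notation lam := (@lebesgue_measure R).
Local Notation E t := (expmx (t *: A)).

Let K (s : R) := expmx (s *: A) *m (b *m b^T) *m expmx (s *: A^T).

Let dK (s : R) := A *m K s + K s *m A^T.

Lemma mx_is_derive_rank1 (s : R) : mx_is_derive K (dK s) s.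
Proof.
have H1 := mx_is_derive_expmx A s.
have H2 := mx_is_derive_cst (b *m b^T) s.
have H3 := mx_is_derive_tr (mx_is_derive_expmx A s).
have := mx_is_deriveM (mx_is_deriveM H1 H2) H3.
rewrite /dK /K; under [X in mx_is_derive X]eq_fun do rewrite -expmx_tr.
congr mx_is_derive.
by rewrite mulmx0 addr0 trmx_mul -expmx_tr !mulmxA.
Qed.

Lemma continuous_rank1 i j : continuous (fun s => K s i j).
Proof.
move=> s; apply: differentiable_continuous; apply/derivable1_diffP.
by have [] := mx_is_derive_rank1 s i j.
Qed.

Lemma integrable_rank1 i j (u v : R) : lam.-integrable `[u, v] (EFin \o (fun s => K s i j)).
Proof.
apply: continuous_compact_integrable; first exact: segment_compact.
by apply: continuous_subspaceT; exact: continuous_rank1.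
Qed.

(** The Gramian is zero for t < 0, hence in general not differentiable at 0.
    Starting the integral at -1 gives an extension which is. *)
Definition gramian_ext (t : R) : 'M[R]_n := \matrix_(i, j)
  (\int[lam]_(s in `[-1, t]) K s i j - \int[lam]_(s in `[-1, 0]) K s i j).

Lemma gramianE t : 0 <= t -> gramian A b t = gramian_ext t.
Proof.
move=> t0; apply/matrixP => i j; rewrite !mxE.
have := @Rintegral_itvB R (fun s => K s i j) (BLeft (-1)) (BRight t) 0 (integrable_rank1 i j _ _).
rewrite !bnd_simp => /(_ _ _)-> //.
rewrite Rintegral_itv_obnd_cbnd//.
by apply: integrableS (integrable_rank1 i j 0 t) => //; exact: subset_itv_oc_cc.
Qed.

Lemma mx_is_derive_gramian_ext t : 0 <= t -> mx_is_derive gramian_ext (K t) t.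
Proof.
move=> t0 i j; rewrite /gramian_ext; under eq_fun do rewrite mxE.
have t1 : -1 < t by lra.
have t2 : t < t + 1 by lra.
have [D1 D2] := @continuous_FTC1_closed R (fun s => K s i j) (-1) t (t + 1) t2
  (integrable_rank1 i j _ _) t1 (@continuous_rank1 i j t).
have D := is_deriveB (DeriveDef D1 (etrans (esym (derive1E _ _)) D2))
  (is_derive_cst (\int[lam]_(s in `[-1, 0]) K s i j) t 1).
by apply: is_derive_eq D _; rewrite subr0.
Qed.

(** The covariance of the noise up to time t, carried back to time 0 by the
    drift. *)
Definition Lagrangian_gramian (t : R) : 'M[R]_n :=
  E (- t) *m gramian A b t *m (E (- t))^T.

Definition Lagrangian_gramian_ext (t : R) : 'M[R]_n :=
  E (- t) *m gramian_ext t *m (E (- t))^T.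

Lemma Lagrangian_gramianE t : 0 <= t -> Lagrangian_gramian t = Lagrangian_gramian_ext t.
Proof. by move=> t0; rewrite /Lagrangian_gramian gramianE. Qed.

Lemma gramian0 : gramian A b 0 = 0.
Proof. by apply/matrixP => i j; rewrite !mxE set_itv1 Rintegral_set1. Qed.

(** Both sides agree at t = 0 and have the same derivative. *)
Lemma gramian_Lyapunov t : 0 <= t ->
  A *m gramian_ext t + gramian_ext t *m A^T + b *m b^T = K t.
Proof.
move=> t0.
pose X s := A *m gramian_ext s + gramian_ext s *m A^T + b *m b^T - K s.
suff : X t = 0 by move=> /eqP; rewrite subr_eq0 => /eqP.
have dX s : 0 <= s -> mx_is_derive X 0 s.
  move=> s0; have G := mx_is_derive_gramian_ext s0.
  have := mx_is_deriveD (mx_is_deriveD (mx_is_deriveD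
    (mx_is_deriveM (mx_is_derive_cst A s) G) (mx_is_deriveM G (mx_is_derive_cst A^T s)))
    (mx_is_derive_cst (b *m b^T) s)) (mx_is_deriveN (mx_is_derive_rank1 s)).
  congr mx_is_derive.
  by rewrite mul0mx mulmx0 !addr0 add0r subrr.
have X0 : X 0 = 0.
  rewrite /X -gramianE// gramian0 mulmx0 mul0mx !add0r /K.
  by rewrite !expmx0 mul1mx mulmx1 subrr.
rewrite -X0; apply/matrixP => i j.
move: t0; rewrite le_eqVlt => /predU1P[<-//|t0].
have [||c _] := @MVT R (fun s => X s i j) (fun=> 0) 0 t t0.
- move=> s; rewrite in_itv/= => /andP[/ltW s0 _].
  by have := dX s s0 i j; rewrite mxE.
- apply: derivable_within_continuous => s; rewrite in_itv/= => /andP[s0 _].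
  by have [] := dX s s0 i j.
by rewrite mul0r => /eqP; rewrite subr_eq0 => /eqP.
Qed.

(** By the Lyapunov equation the terms coming from the drift cancel, and the
    noise alone remains. In particular the derivative is positive semidefinite,
    whether or not the pair (A, b) is controllable. *)
Lemma mx_is_derive_Lagrangian_gramian t : 0 <= t ->
  mx_is_derive Lagrangian_gramian_ext ((E (- t) *m b) *m (E (- t) *m b)^T) t.
Proof.
move=> t0; have G := mx_is_derive_gramian_ext t0.
have D := mx_is_derive_opp (@mx_is_derive_expmx _ _ A (- t)).
have := mx_is_deriveM (mx_is_deriveM D G) (mx_is_derive_tr D).
congr mx_is_derive.
rewrite linearN/= mulmxN mulNmx -[K t]gramian_Lyapunov// !mulmxDr.
rewrite expmx_comm !trmx_mul; set e := E (- t); set H := gramian_ext t.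
rewrite !mulmxDl !mulNmx !mulmxA.
by rewrite -!addrA addKr addrC -addrA addNr addr0.
Qed.

Lemma Lagrangian_gramian0 : Lagrangian_gramian 0 = 0.
Proof. by rewrite /Lagrangian_gramian gramian0 mulmx0 mul0mx. Qed.

Lemma gramian_conj t :
  gramian A b t = E t *m Lagrangian_gramian t *m (E t)^T.
Proof.
rewrite /Lagrangian_gramian !mulmxA expmxKN mul1mx -mulmxA -trmx_mul expmxKN.
by rewrite trmx1 mulmx1.
Qed.

Lemma gramian_sym t : (gramian A b t)^T = gramian A b t.
Proof.
apply/matrixP => i j; rewrite !mxE; apply: eq_Rintegral => s _.
have KT : (K s)^T = K s by rewrite /K !trmx_mul trmxK !expmx_tr trmxK !mulmxA.
by rewrite -/(K s) -[in LHS]KT mxE.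
Qed.

Lemma Lagrangian_gramian_sym t : (Lagrangian_gramian t)^T = Lagrangian_gramian t.
Proof. by rewrite /Lagrangian_gramian !trmx_mul trmxK gramian_sym mulmxA. Qed.

Lemma mxform_conj (M D : 'M[R]_n) v : mxform (M *m D *m M^T) v = mxform D (M^T *m v).
Proof. by rewrite /mxform trmx_mul trmxK !mulmxA. Qed.

Lemma mxform_rank1_ge0 (c v : 'cV[R]_n) : 0 <= mxform (c *m c^T) v.
Proof.
rewrite /mxform mulmxA -mulmxA; have -> : c^T *m v = (v^T *m c)^T by rewrite trmx_mul trmxK.
by rewrite mxE big_ord1 [X in _ * X]mxE -expr2 sqr_ge0.
Qed.

Lemma Lagrangian_gramian_nondecreasing s t v : 0 <= s -> s <= t ->
  0 <= mxform (Lagrangian_gramian t - Lagrangian_gramian s) v.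
Proof.
move=> s0 st; have t0 := le_trans s0 st.
rewrite /mxform mulmxBr mulmxBl mxE [X in _ + X]mxE subr_ge0.
rewrite (Lagrangian_gramianE s0) (Lagrangian_gramianE t0).
move: st; rewrite le_eqVlt => /predU1P[->//|st].
have D (r : R) : 0 <= r -> is_derive r 1 (fun r => (v^T *m Lagrangian_gramian_ext r *m v) 0 0)
    (mxform ((E (- r) *m b) *m (E (- r) *m b)^T) v).
  move=> r0; have H := mx_is_deriveM (mx_is_deriveM (mx_is_derive_cst v^T r)
    (mx_is_derive_Lagrangian_gramian r0)) (mx_is_derive_cst v r).
  apply: is_derive_eq (H 0 0) _.
  by rewrite mul0mx add0r mulmx0 addr0 /mxform.
have [||c _] := @MVT R (fun r => (v^T *m Lagrangian_gramian_ext r *m v) 0 0)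
  (fun r => mxform ((E (- r) *m b) *m (E (- r) *m b)^T) v) s t st.
- by move=> r; rewrite in_itv/= => /andP[sr _]; apply: D; lra.
- apply: derivable_within_continuous => r; rewrite in_itv/= => /andP[sr _].
  by have [] := D r (le_trans s0 sr).
move=> H; rewrite -subr_ge0 H mulr_ge0 ?subr_ge0 ?(ltW st)//.
exact: mxform_rank1_ge0.
Qed.

Lemma gramian_psd t v : 0 <= t -> 0 <= mxform (gramian A b t) v.
Proof.
move=> t0; rewrite gramian_conj mxform_conj -[Lagrangian_gramian t]subr0.
by rewrite -Lagrangian_gramian0 Lagrangian_gramian_nondecreasing.
Qed.

End gramian.

(** * Borel sets of R^n *)

Section borel_cV.
Context {R : realType} {n : nat}.

Lemma normr_entry_le (x : 'cV[R]_n) i : `|x i 0| <= `|x|.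
Proof. by rewrite [leRHS]/Num.Def.normr/= mx_normrE; exact: (le_bigmax _ _ (i, 0)). Qed.

(** The half-open cubes of side 1 / (k + 1), indexed by k and a corner. *)
Let cell (p : nat * 'cV[int]_n) : set 'cV[R]_n :=
  [set y | forall i, Num.floor (p.1.+1%:R * y i 0) = p.2 i 0].

Let measurable_cell p : measurable (cell p).
Proof.
have -> : cell p = \bigcap_(i in [set: 'I_n])
    ((fun y => Num.floor (p.1.+1%:R * cV_coord i y)) @^-1` [set p.2 i 0]).
  by apply/seteqP; split => y /=; [move=> H i _; exact: H|move=> H i; exact: H].
apply: fin_bigcap_measurable => // i _.
rewrite (_ : _ @^-1` _ = [set: 'cV[R]_n] `&`
   (fun y => p.1.+1%:R * cV_coord i y) @^-1` `[(p.2 i 0)%:~R, (p.2 i 0 + 1)%:~R[%classic); last first.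
  rewrite setTI; apply/seteqP; split => y /=; rewrite in_itv/=.
    by move=> <-; rewrite floor_le_tmp floorD1_gt.
  by move=> H; apply/floor_def.
have : measurable_fun [set: 'cV[R]_n] (fun y => p.1.+1%:R * cV_coord i y).
  by apply: measurable_funM => //; exact: measurable_cV_coord.
by apply => //; exact: measurable_itv.
Qed.

(** The sigma-algebra is generated by the coordinates. An open set is the union
    of the cubes that it contains among those of a countable family. *)
Lemma open_measurable_cV (U : set 'cV[R]_n) : open U -> measurable U.
Proof.
move=> oU.
have -> : U = \bigcup_(p in [set p | cell p `<=` U]) cell p.
  apply/seteqP; split => [x Ux|x [p /= pU px]]; last exact: pU.
  have /nbhs_ballP[e /= e0 eU] : nbhs x U by exact: open_nbhs_nbhs.
  pose k := Num.bound e^-1.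
  have ke : k.+1%:R^-1 < e.
    rewrite invf_plt ?posrE// (lt_le_trans (archi_boundP _)) ?invr_ge0 ?(ltW e0)//.
    by rewrite ler_nat /k leqnSn.
  exists (k, \col_i Num.floor (k.+1%:R * x i 0)).
    move=> y /= xy; apply: eU; split => // i j; rewrite ord1.
    have := xy i; rewrite mxE => {}xy.
    have k0 : 0 < k.+1%:R :> R by rewrite ltr0n.
    have := floor_le_tmp (k.+1%:R * x i 0); have := floorD1_gt (k.+1%:R * x i 0).
    have := floor_le_tmp (k.+1%:R * y i 0); have := floorD1_gt (k.+1%:R * y i 0).
    rewrite xy !intrD; set z := (Num.floor _)%:~R => y1 y2 x1 x2.
    rewrite /ball/=; apply: lt_trans ke.
    rewrite -(ltr_pM2l k0) divff ?gt_eqF// -[X in X * _]gtr0_norm// -normrM mulrBr.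
    by rewrite ltr_norml; lra.
  by move=> i; rewrite mxE.
rewrite bigcup_mkcond; apply: countable_bigcupT_measurable => [|p].
  exact: countableP.
by case: ifP => _ //; exact: measurable_cell.
Qed.

Lemma continuous_measurable_cV (f : 'cV[R]_n -> R) :
  continuous f -> measurable_fun setT f.
Proof.
move=> /continuousP cf; apply: (measurability _ (RGenOpens.measurableE R)).
move=> _ [_ [a [b ->] <-]]; rewrite setTI; apply: open_measurable_cV.
exact/cf/interval_open.
Qed.

End borel_cV.

(** * Integrals against product measures *)

Section power_measure_integral.
Context {R : realType}.
Variable mu : {sigma_finite_measure set (measurableTypeR R) -> \bar R}.

Lemma ge0_integral_power_measureS (n : nat) (f : 'cV[R]_n.+1 -> \bar R) :
  measurable_fun setT f -> (forall x, 0 <= f x)%E ->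
  (\int[power_measure mu n.+1]_x f x =
   \int[mu]_a \int[power_measure mu n]_x f (cV_cons (a, x)))%E.
Proof.
move=> mf f0.
have mc := @measurable_cV_cons R n.
transitivity (\int[(mu \x power_measure mu n)%E]_z f (cV_cons z))%E.
  exact: (@ge0_integral_pushforward _ _ _ _ _ _ mc (mu \x power_measure mu n)%E setT f).
rewrite (fubini_tonelli1 (fun z => f (cV_cons z)))//.
exact: measurableT_comp.
Qed.

Lemma measurable_translate_cV n (v : 'cV[R]_n) :
  measurable_fun [set: 'cV[R]_n] (fun x => x + v).
Proof.
apply: measurable_fun_cVP => i.
rewrite (_ : _ \o _ = fun x => cV_coord i x + v i 0).
  by apply: measurable_funD => //; exact: measurable_cV_coord.
by apply/funext => x; rewrite /= /cV_coord mxE.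
Qed.

End power_measure_integral.

(** * Lebesgue measure and rapid decay on R^n *)

Section lebesgue_cV.
Context {R : realType}.
Local Notation lam := (@lebesgue_measure R).

Lemma cV0_eq (x y : 'cV[R]_0) : x = y.
Proof. by apply/matrixP => -[]. Qed.

Lemma cV_consD n (a c : R) (x v : 'cV[R]_n) :
  cV_cons (a, x) + cV_cons (c, v) = cV_cons (a + c, x + v).
Proof.
apply/colP => i; rewrite !mxE; case: (unliftP ord0 i) => [j _|_]//=.
by rewrite mxE.
Qed.

Lemma cV_unconsK n : cancel (@cV_uncons R n) cV_cons.
Proof.
move=> x; apply/colP => i; rewrite /cV_cons mxE.
by case: (unliftP ord0 i) => [j ->|->]//=; rewrite mxE.
Qed.

(** Induction on the dimension, by the Tonelli theorem. *)
Lemma ge0_integral_cV_translate n (v : 'cV[R]_n) (f : 'cV[R]_n -> \bar R) :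
  measurable_fun setT f -> (forall x, 0 <= f x)%E ->
  (\int[lebesgue_cV n]_x f (x + v)%R = \int[lebesgue_cV n]_x f x)%E.
Proof.
elim: n v f => [|n IH] v f mf f0.
  by apply: eq_integral => x _; rewrite (cV0_eq (x + v)%R x).
have mfv : measurable_fun setT (fun x : 'cV[R]_n.+1 => f (x + v)%R).
  by apply: (measurableT_comp mf); exact: measurable_translate_cV.
rewrite /lebesgue_cV !ge0_integral_power_measureS// -[v](@cV_unconsK n).
case: (cV_uncons v) => c w.
have mfc : measurable_fun setT (fun p => f (cV_cons p)).
  by apply: measurableT_comp => //; exact: measurable_cV_cons.
transitivity (\int[lam]_a \int[lebesgue_cV n]_x f (cV_cons ((a + c)%R, x)))%E.
  apply: eq_integral => a _; rewrite -(IH w (fun x => f (cV_cons ((a + c)%R, x))))//.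
    by apply: eq_integral => x _; rewrite cV_consD.
  exact: (measurableT_comp mfc (measurable_pair1 _)).
rewrite (ge0_integral_translate c
  (f := fun a => (\int[lebesgue_cV n]_x f (cV_cons (a, x)))%E))//.
  exact: (measurable_fun_fubini_tonelli_F (m2 := lebesgue_cV n) _ mfc (fun z => f0 _)).
by move=> a; apply: integral_ge0.
Qed.

Lemma Rintegral_cV_translate n (v : 'cV[R]_n) (f : 'cV[R]_n -> R) :
  measurable_fun setT f ->
  \int[lebesgue_cV n]_x f (x + v) = \int[lebesgue_cV n]_x f x.
Proof.
move=> mf; rewrite /Rintegral; congr fine; rewrite integralE [RHS]integralE.
have mf' : measurable_fun setT (EFin \o f) by exact/measurable_EFinP.
congr (_ - _)%E.
- rewrite -[RHS](ge0_integral_cV_translate v (measurable_funepos mf') (funepos_ge0 _)).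
  by apply: eq_integral => x _; rewrite !funeposE.
- rewrite -[RHS](ge0_integral_cV_translate v (measurable_funeneg mf') (funeneg_ge0 _)).
  by apply: eq_integral => x _; rewrite !funenegE.
Qed.

Lemma integrable_cV_translate n (v : 'cV[R]_n) (f : 'cV[R]_n -> R) :
  (lebesgue_cV n).-integrable setT (EFin \o f) ->
  (lebesgue_cV n).-integrable setT (fun x => (f (x + v))%:E).
Proof.
move=> /integrableP[mf fi]; apply/integrableP; split.
  by apply: (measurableT_comp mf); exact: measurable_translate_cV.
rewrite (ge0_integral_cV_translate v (f := fun x => `|(f x)%:E|%E))//.
exact: measurableT_comp.
Qed.

(** Integrable, this product dominates every rapidly decaying function up to a
    constant. *)
Definition weight n (x : 'cV[R]_n) : R := \prod_i (oneDsqr (x i 0))^-1.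

Lemma weight_ge0 n (x : 'cV[R]_n) : 0 <= weight x.
Proof. by apply: prodr_ge0 => i _; rewrite invr_ge0 ltW// oneDsqr_gt0. Qed.

Lemma measurable_weight n : measurable_fun setT (@weight n).
Proof.
apply: measurable_prod => i _.
apply: (@measurableT_comp _ _ _ _ _ _ (fun y : R => (oneDsqr y)^-1)).
  by apply: continuous_measurable_fun => y; exact: continuous_oneDsqrV.
exact: measurable_cV_coord.
Qed.

Lemma weight_cons n (a : R) (x : 'cV[R]_n) :
  weight (cV_cons (a, x)) = (oneDsqr a)^-1 * weight x.
Proof.
rewrite /weight big_ord_recl mxE unlift_none/=; congr (_ * _).
by apply: eq_bigr => i _; rewrite mxE liftK.
Qed.

Lemma integral_weight_lty n : (\int[lebesgue_cV n]_x (weight x)%:E < +oo)%E.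
Proof.
elim: n => [|n IH].
  under eq_integral do rewrite /weight big_ord0.
  rewrite integral_cst//= mul1e /dirac indicE.
  by case: (_ \in _); rewrite ?ltry.
have mw : measurable_fun setT (fun x => (@weight n x)%:E).
  by apply/measurable_EFinP; exact: measurable_weight.
have iw0 a : (0 <= (oneDsqr a : R)^-1%:E)%E.
  by rewrite lee_fin invr_ge0 ltW// oneDsqr_gt0.
rewrite /lebesgue_cV ge0_integral_power_measureS//; first last.
- by move=> x; exact: weight_ge0.
- by apply/measurable_EFinP; exact: measurable_weight.
rewrite [ltLHS](_ : _ =
    \int[lam]_a ((oneDsqr a)^-1%:E * \int[lebesgue_cV n]_x (weight x)%:E))%E; last first.
  apply: eq_integral => a _; under eq_integral do rewrite weight_cons EFinM.
  by apply: ge0_integralZl => // x _; exact: weight_ge0.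
rewrite ge0_integralZr//; first last.
- by apply: integral_ge0 => x _; exact: weight_ge0.
- by have /measurable_int := @integrable_oneDsqrV R.
rewrite integral_oneDsqrV lte_mul_pinfty//.
by rewrite lee_fin ltW// pi_gt0.
Qed.

Lemma integrable_weight n : (lebesgue_cV n).-integrable setT (fun x => (@weight n x)%:E).
Proof.
apply/integrableP; split; first by apply/measurable_EFinP; exact: measurable_weight.
under eq_integral do rewrite gee0_abs ?lee_fin ?weight_ge0//.
exact: integral_weight_lty.
Qed.

Definition rapid_decay n (F : 'cV[R]_n -> R) :=
  forall N : nat, exists C : R, forall x, `|F x| * (1 + `|x|) ^+ N <= C.

(** Here x is the variable of integration and y its image by a translation or
    by the flow, which changes 1 + |x| by a bounded factor only. *)
Lemma rapid_decay_dominated n (F : 'cV[R]_n -> R) (K : R) : rapid_decay F -> 0 < K ->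
  exists2 C, 0 <= C & forall x y : 'cV[R]_n, 1 + `|x| <= K * (1 + `|y|) -> `|F y| <= C * weight x.
Proof.
move=> /(_ (2 * n)%N)[C HC] K0; exists (C * K ^+ (2 * n)) => [|x y xy].
  rewrite mulr_ge0 ?exprn_ge0 ?(ltW K0)//.
  by apply: le_trans (HC 0); rewrite mulr_ge0// exprn_ge0// addr_ge0.
have p0 (z : 'cV[R]_n) : 0 < 1 + `|z| by rewrite ltr_pwDl.
rewrite -ler_pdivrMr; last by apply: prodr_gt0 => i _; rewrite invr_gt0 oneDsqr_gt0.
rewrite /weight -prodfV; under eq_bigr do rewrite invrK.
apply: le_trans (_ : `|F y| * (1 + `|x|) ^+ (2 * n) <= _).
  rewrite ler_wpM2l//.
  have -> : (1 + `|x|) ^+ (2 * n) = \prod_(i < n) (1 + `|x|) ^+ 2.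
    by rewrite prodr_const card_ord exprM.
  apply: ler_prod => i _; rewrite ltW ?oneDsqr_gt0//= /oneDsqr.
  have := normr_entry_le x i; have := normr_ge0 (x i 0).
  rewrite -(real_normK (num_real (x i 0))); nra.
apply: le_trans (_ : `|F y| * (K * (1 + `|y|)) ^+ (2 * n) <= _).
  by rewrite ler_wpM2l// lerXn2r ?nnegrE ?mulr_ge0// ?(ltW K0)// ltW.
by rewrite exprMn mulrCA mulrC ler_wpM2r// exprn_ge0// ltW.
Qed.

Lemma rapid_decay_weight n (F : 'cV[R]_n -> R) : rapid_decay F ->
  exists2 C, 0 <= C & forall x, `|F x| <= C * weight x.
Proof.
move=> /rapid_decay_dominated/(_ ltr01)[C C0 H]; exists C => // x.
by apply: H; rewrite mul1r.
Qed.

Lemma rapid_decay_integrable n (F : 'cV[R]_n -> R) : measurable_fun setT F ->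
  rapid_decay F -> (lebesgue_cV n).-integrable setT (EFin \o F).
Proof.
move=> mF /rapid_decay_weight[C C0 FC].
apply: (@le_normr_integrable _ _ _ (lebesgue_cV n) _ _ mF _ FC).
rewrite /comp; under eq_fun do rewrite EFinM.
by apply: integrableZl => //; exact: integrable_weight.
Qed.

End lebesgue_cV.

(** * Stability of rapid decay *)

Section rapid_decay.
Context {R : realType} {n : nat}.
Implicit Types (F G : 'cV[R]_n -> R) (x y v : 'cV[R]_n).

Lemma norm_mulmx_le (M : 'M[R]_n) x : `|M *m x| <= (\sum_i \sum_j `|M i j|) * `|x|.
Proof.
rewrite [leLHS]/Num.Def.normr/= mx_normrE; apply: bigmax_le.
  by rewrite mulr_ge0// sumr_ge0// => i _; rewrite sumr_ge0.
move=> [i j] _; rewrite ord1 mxE/=; apply: le_trans (ler_norm_sum _ _ _) _.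
apply: le_trans (_ : \sum_j `|M i j| * `|x| <= _).
  by apply: ler_sum => k _; rewrite normrM ler_wpM2l// normr_entry_le.
rewrite -mulr_suml ler_wpM2r// [leRHS](bigD1 i)//= lerDl sumr_ge0// => k _.
by rewrite sumr_ge0.
Qed.

Lemma rapid_decay_scale (c : R) F : rapid_decay F -> rapid_decay (fun x => c * F x).
Proof.
move=> dF N; have [C HC] := dF N; exists (`|c| * C) => x.
by rewrite normrM -mulrA ler_wpM2l.
Qed.

Lemma rapid_decayD F G : rapid_decay F -> rapid_decay G -> rapid_decay (fun x => F x + G x).
Proof.
move=> dF dG N; have [C HC] := dF N; have [C' HC'] := dG N; exists (C + C') => x.
apply: le_trans (lerD (HC x) (HC' x)); rewrite -mulrDl ler_wpM2r ?ler_normD//.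
Qed.

Lemma rapid_decay0 : rapid_decay (fun _ : 'cV[R]_n => 0 : R).
Proof. by move=> N; exists 0 => x; rewrite normr0 mul0r. Qed.

Lemma rapid_decay_sum (I : Type) (r : seq I) (F : I -> 'cV[R]_n -> R) :
  (forall i, rapid_decay (F i)) -> rapid_decay (fun x => \sum_(i <- r) F i x).
Proof.
move=> dF; elim: r => [|i r IH].
  by under eq_fun do rewrite big_nil; exact: rapid_decay0.
by under eq_fun do rewrite big_cons; exact: rapid_decayD.
Qed.

Lemma rapid_decay_bounded F : rapid_decay F -> exists C, forall x, `|F x| <= C.
Proof. by move=> /(_ 0%N)[C HC]; exists C => x; have := HC x; rewrite expr0 mulr1. Qed.

Lemma rapid_decayM F G (C : R) : rapid_decay F -> (forall x, `|G x| <= C) ->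
  rapid_decay (fun x => F x * G x).
Proof.
move=> dF GC N; have [K HK] := dF N; exists (K * C) => x.
rewrite normrM mulrAC ler_pM// mulr_ge0// exprn_ge0// addr_ge0//.
Qed.

Lemma rapid_decay_linear (w : 'cV[R]_n) F : rapid_decay F ->
  rapid_decay (fun x => (w^T *m x) 0 0 * F x).
Proof.
move=> dF N; have [C HC] := dF N.+1; exists ((\sum_i `|w i 0|) * C) => x.
have p0 : 0 <= 1 + `|x| by rewrite addr_ge0.
apply: le_trans (_ : (\sum_i `|w i 0|) * (1 + `|x|) * (`|F x| * (1 + `|x|) ^+ N) <= _).
  rewrite normrM -[leLHS]mulrA ler_wpM2r ?mulr_ge0 ?exprn_ge0//.
  rewrite mxE; apply: le_trans (ler_norm_sum _ _ _) _.
  rewrite mulr_suml; apply: ler_sum => i _; rewrite mxE normrM ler_wpM2l//.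
  by apply: le_trans (normr_entry_le x i) _; rewrite lerDr.
rewrite -mulrA ler_wpM2l ?sumr_ge0//.
by apply: le_trans (HC x); rewrite exprS mulrCA.
Qed.

(** Having a left inverse, M does not shrink norms by more than a constant
    factor. *)
Lemma rapid_decay_comp (M M' : 'M[R]_n) F : M' *m M = 1%:M -> rapid_decay F ->
  rapid_decay (fun x => F (M *m x)).
Proof.
move=> MM dF N; have [C HC] := dF N.
pose K := 1 + \sum_i \sum_j `|M' i j|.
have K1 : 1 <= K by rewrite lerDl sumr_ge0// => i _; rewrite sumr_ge0.
have K0 : 0 <= K by exact: le_trans K1.
exists (K ^+ N * C) => x.
apply: le_trans (ler_wpM2l _ (HC (M *m x))); last by rewrite exprn_ge0.
have key : 1 + `|x| <= K * (1 + `|M *m x|).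
  have := norm_mulmx_le M' (M *m x); rewrite mulmxA MM mul1mx /K.
  by have := normr_ge0 (M *m x); rewrite /K in K1; nra.
rewrite mulrCA ler_wpM2l// -exprMn; apply: lerXn2r => //; rewrite nnegrE.
  exact: addr_ge0.
by apply: mulr_ge0 => //; exact: addr_ge0.
Qed.

(** As on the line, the integral of F (x + h v) does not depend on h. *)
Lemma Rintegral_dirder0 v F F' : (forall x, is_derive x v F (F' x)) ->
  measurable_fun setT F -> rapid_decay F -> rapid_decay F' ->
  \int[lebesgue_cV n]_x F' x = 0.
Proof.
move=> dF mF rF rF'.
have [C C0 HC] := rapid_decay_dominated rF' (ltr_pwDl ltr01 (normr_ge0 v)).
have D : is_derive (0 : R) 1 (fun h => \int[lebesgue_cV n]_x F (x + h *: v))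
    (\int[lebesgue_cV n]_x F' (x + 0 *: v)).
  apply: (@is_derive_Rintegral _ _ _ (lebesgue_cV n) (fun h x => F (x + h *: v))
    (fun h x => F' (x + h *: v)) (fun x => C * weight x) 0 1) => //.
  - by move=> h _; apply: integrable_cV_translate; exact: rapid_decay_integrable.
  - by move=> h x _; exact/is_derive_line.
  - rewrite /comp; under eq_fun do rewrite EFinM.
    by apply: integrableZl => //; exact: integrable_weight.
  - move=> h x; rewrite subr0 => /ltW h1; apply: HC.
    have : `|x| <= `|x + h *: v| + `|h *: v| by rewrite -{1}(addrK (h *: v) x) ler_normB.
    have : `|h *: v| <= `|v| by rewrite normrZ ler_piMl.
    have := normr_ge0 (x + h *: v); have := normr_ge0 v; nra.
have := @derive_val _ _ _ _ _ _ _ D.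
under eq_fun do rewrite Rintegral_cV_translate//.
rewrite derive_cst; under eq_Rintegral do rewrite scale0r addr0.
by move=> <-.
Qed.

End rapid_decay.

(** * Change of variables along a linear flow *)

Section flow.
Context {R : realType} {n : nat}.
Implicit Types (f : 'cV[R]_n -> R) (x y v : 'cV[R]_n).

Lemma mx_is_deriveP (y : R -> 'cV[R]_n) dy t :
  mx_is_derive y dy t -> is_derive t 1 y dy.
Proof.
move=> H; have D : derivable y t 1 by apply/derivable_mxP => i j; have [] := H i j.
apply: DeriveDef => //; rewrite derive_mx//; apply/matrixP => i j; rewrite mxE.
by have := H i j => ?; exact: derive_val.
Qed.

Lemma is_derive_curve f (y : R -> 'cV[R]_n) dy t : differentiable f (y t) ->
  mx_is_derive y dy t -> is_derive t 1 (fun s => f (y s)) ('D_dy f (y t)).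
Proof.
move=> df /mx_is_deriveP[y1 y2].
have dy1 : differentiable y t by exact/derivable1_diffP.
have dc : differentiable (f \o y) t by exact: differentiable_comp.
apply: DeriveDef; first exact/diff_derivable.
rewrite (deriveE _ dc) diff_comp//= (deriveE _ df); congr ('d f (y t) _).
by rewrite -(deriveE _ dy1).
Qed.

Lemma differentiable_is_derive f x v : differentiable f x ->
  is_derive x v f (\sum_i v i 0 * 'D_(delta_mx i 0) f x).
Proof.
move=> df; apply: DeriveDef; first exact: diff_derivable.
rewrite deriveE// [in LHS](_ : v = \sum_i v i 0 *: delta_mx i 0); last first.
  by rewrite {1}(matrix_sum_delta v); apply: eq_bigr => i _; rewrite big_ord1.
by rewrite linear_sum; apply: eq_bigr => i _; rewrite linearZ/= deriveE.
Qed.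

Lemma differentiable_continuous_cV f : (forall x, differentiable f x) -> continuous f.
Proof. by move=> df x; exact: differentiable_continuous. Qed.

(** The properties used to differentiate the integral of f along a flow. They
    are stable under f x * g (x + v), so that the change of variables applies
    to correlations. *)
Definition tame f := [/\ (forall x, differentiable f x), rapid_decay f,
  forall i, rapid_decay (fun x => 'D_(delta_mx i 0) f x) &
  forall i, continuous (fun x => 'D_(delta_mx i 0) f x)].

Lemma measurable_tame f : tame f -> measurable_fun setT f.
Proof. by case=> df _ _ _; apply: continuous_measurable_cV; exact: differentiable_continuous_cV. Qed.

Variable A : 'M[R]_n.
Local Notation E t := (expmx (t *: A)).

Lemma measurable_mulmx_cV_comp (M : 'M[R]_n) f : measurable_fun setT f ->
  measurable_fun setT (fun x => f (M *m x)).
Proof. by move=> mf; apply: measurableT_comp mf _; exact: measurable_mulmx_cV. Qed.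

Let radial f y : R := \sum_i (A *m y) i 0 * 'D_(delta_mx i 0) f y.

Let rapid_decay_radial f : tame f -> rapid_decay (radial f).
Proof.
case=> _ _ rd _; apply: rapid_decay_sum => i.
rewrite (_ : (fun x => _) = fun x => (((row i A)^T)^T *m x) 0 0 * 'D_(delta_mx i 0) f x).
  exact: rapid_decay_linear.
apply/funext => x.
by congr (_ * _); rewrite trmxK -row_mul [RHS]mxE.
Qed.

Lemma entry_continuous (i j : 'I_n) : continuous (fun s : R => `|(E (- s)) i j|).
Proof.
move=> s; apply: cvg_norm.
apply: differentiable_continuous; apply/derivable1_diffP.
by have [] := mx_is_derive_opp (@mx_is_derive_expmx _ _ A (- s)) i j.
Qed.

(** The inverse of E s is E (- s), and its entries are continuous in s. *)
Lemma locally_bounded_flow t : exists K e : R, [/\ 0 < K, 0 < e &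
  forall s x, `|s - t| < e -> 1 + `|x| <= K * (1 + `|E s *m x|)].
Proof.
pose k (s : R) := \sum_i \sum_j `|E (- s) i j|.
have ck : {for t, continuous k}.
  by apply: (@cvg_lsum R) => i; apply: (@cvg_lsum R) => j; exact: entry_continuous.
have k0 s : 0 <= k s by rewrite sumr_ge0// => i _; rewrite sumr_ge0.
move/cvgrPdist_lt : ck => /(_ 1 ltr01)[e /= e0 He].
exists (k t + 2), e; split => //; first by have := k0 t; lra.
move=> s x st; have := He s; rewrite /ball_/= distrC => /(_ st).
rewrite ltr_norml => /andP[h1 h2].
have := norm_mulmx_le (E (- s)) (E s *m x); rewrite mulmxA expmxNK mul1mx -/(k s).
have := normr_ge0 (E s *m x); have := k0 s; have := k0 t; nra.
Qed.

Lemma is_derive_flow f (t : R) x : (forall x, differentiable f x) ->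
  is_derive t 1 (fun s => f (E s *m x)) (radial f (E t *m x)).
Proof.
move=> df.
have := mx_is_deriveM (mx_is_derive_expmx A t) (mx_is_derive_cst x t).
rewrite mulmx0 addr0 -mulmxA => H.
apply: is_derive_eq (is_derive_curve (df _) H) _.
by have D := differentiable_is_derive (A *m (E t *m x)) (df (E t *m x)); rewrite derive_val.
Qed.

Lemma is_derive_linear f (M : 'M[R]_n) x v : (forall x, differentiable f x) ->
  is_derive x v (fun x => f (M *m x)) (\sum_i (M *m v) i 0 * 'D_(delta_mx i 0) f (M *m x)).
Proof.
move=> df; apply/is_derive_line0.
under eq_fun do rewrite mulmxDr -scalemxAr.
by apply/is_derive_line0; exact: differentiable_is_derive.
Qed.

(** With F x = f (E t x), the integrand is the sum over j of x_j times the
    derivative of F along the j-th column of A. Integration by parts along this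
    column replaces the j-th term with - A_jj F. *)
Lemma Rintegral_radial f t : tame f ->
  \int[lebesgue_cV n]_x radial f (E t *m x) =
  - \tr A * \int[lebesgue_cV n]_x f (E t *m x).
Proof.
move=> tf; have [df rf rd cd] := tf.
pose ft x := f (E t *m x).
pose gt (j : 'I_n) x := \sum_i (E t *m col j A) i 0 * 'D_(delta_mx i 0) f (E t *m x).
have rft : rapid_decay ft by apply: rapid_decay_comp rf; exact: expmxNK.
have rgt j : rapid_decay (gt j).
  apply: rapid_decay_sum => i; apply: rapid_decay_scale.
  by apply: (rapid_decay_comp (F := fun x => 'D_(delta_mx i 0) f x)) (rd i); exact: expmxNK.
have mft : measurable_fun setT ft by apply: measurable_mulmx_cV_comp; exact: measurable_tame.
have mgt j : measurable_fun setT (gt j).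
  apply: measurable_sum => i; apply: measurable_funM => //.
  apply: (measurable_mulmx_cV_comp _ (f := fun x => 'D_(delta_mx i 0) f x)).
  exact: continuous_measurable_cV.
have mco (j : 'I_n) : measurable_fun setT (fun x : 'cV[R]_n => x j 0).
  exact: measurable_cV_coord.
have rco (j : 'I_n) F : rapid_decay F -> rapid_decay (fun x : 'cV[R]_n => x j 0 * F x).
  move=> rF; rewrite (_ : (fun x => _) = fun x => ((delta_mx j 0 : 'cV[R]_n)^T *m x) 0 0 * F x).
    exact: rapid_decay_linear.
  apply/funext => x; congr (_ * _); rewrite mxE (bigD1 j)//= !mxE !eqxx mul1r big1 ?addr0//.
  by move=> k kj; rewrite !mxE (negbTE kj) mul0r.
have E1 x : radial f (E t *m x) = \sum_j x j 0 * gt j x.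
  rewrite /radial /gt; under [RHS]eq_bigr do rewrite mulr_sumr.
  rewrite exchange_big/=; apply: eq_bigr => i _.
  under eq_bigr do rewrite mulrA; rewrite -mulr_suml; congr (_ * _).
  have Ax : A *m x = \sum_j x j 0 *: col j A.
    by apply/colP => k; rewrite mxE summxE; apply: eq_bigr => j _; rewrite !mxE mulrC.
  rewrite mulmxA expmx_comm -mulmxA Ax mulmx_sumr summxE.
  by apply: eq_bigr => j _; rewrite -scalemxAr mxE.
under eq_Rintegral do rewrite E1.
have ig j : (lebesgue_cV n).-integrable setT (EFin \o (fun x => x j 0 * gt j x)).
  by apply: rapid_decay_integrable; [exact: measurable_funM|exact: rco].
rewrite Rintegral_sum//.
have ift : (lebesgue_cV n).-integrable setT (EFin \o ft) by exact: rapid_decay_integrable.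
have E2 j : \int[lebesgue_cV n]_x (x j 0 * gt j x) = - A j j * \int[lebesgue_cV n]_x ft x.
  have D x : is_derive x (col j A) (fun x => x j 0 * ft x) (A j j * ft x + x j 0 * gt j x).
    have D1 : is_derive x (col j A) (fun x : 'cV[R]_n => x j 0) (A j j).
      apply/is_derive_line0; rewrite (_ : (fun h => _) = fun h : R => x j 0 + h * A j j).
        by apply: is_derive_eq; rewrite add0r mul1r scaler0 add0r [_%:A]mulr1.
      by apply/funext => h; rewrite !mxE.
    apply: is_derive_eq (is_deriveM D1 (is_derive_linear (E t) x (col j A) df)) _.
    by rewrite /GRing.scale/= -/(ft x) -/(gt j x); ring.
  have i1 : (lebesgue_cV n).-integrable setT (EFin \o (fun x => A j j * ft x)).
    by rewrite /comp; under eq_fun do rewrite EFinM; exact: integrableZl.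
  have := @Rintegral_dirder0 _ _ _ _ _ D.
  rewrite RintegralD// RintegralZl// => H.
  apply/eqP; rewrite mulNr -addr_eq0 addrC H//.
  - exact: measurable_funM.
  - exact: rco.
  - by apply: rapid_decayD; [exact: rapid_decay_scale|exact: rco].
under eq_bigr do rewrite E2.
by rewrite -mulr_suml sumrN.
Qed.

(** Liouville's formula without determinants: the left-hand side I satisfies I'
    = - tr A I. *)
Lemma Rintegral_expmx f t : tame f ->
  \int[lebesgue_cV n]_x f (E t *m x) = expR (- t * \tr A) * \int[lebesgue_cV n]_x f x.
Proof.
move=> tf; have [df rf rd cd] := tf.
pose I (s : R) := \int[lebesgue_cV n]_x f (E s *m x).
have dI (s : R) : is_derive s 1 I (- \tr A * I s).
  rewrite -Rintegral_radial//.
  have [K [e [K0 e0 HK]]] := locally_bounded_flow s.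
  have [C C0 HC] := rapid_decay_dominated (rapid_decay_radial tf) K0.
  apply: (@is_derive_Rintegral _ _ _ (lebesgue_cV n) (fun r x => f (E r *m x))
    (fun r x => radial f (E r *m x)) (fun x => C * weight x) s e) => //.
  - move=> r _; apply: rapid_decay_integrable.
      by apply: measurable_mulmx_cV_comp; exact: measurable_tame.
    by apply: rapid_decay_comp rf; exact: expmxNK.
  - by move=> r x _; exact: is_derive_flow.
  - rewrite /comp; under eq_fun do rewrite EFinM.
    by apply: integrableZl => //; exact: integrable_weight.
  - by move=> r x rs; apply: HC; exact: HK.
have dJ (s : R) : is_derive s 1 (fun s => expR (s * \tr A) * I s) 0.
  have d1 : is_derive s 1 (fun s : R => s * \tr A) (\tr A).
    by apply: is_derive_eq; rewrite /GRing.scale/= mulr0 add0r mulr1.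
  apply: is_derive_eq (is_deriveM (is_derive1_comp (is_derive_expR _) d1) (dI s)) _.
  by rewrite /GRing.scale/=; ring.
have := is_derive_0_is_cst (f := fun s => expR (s * \tr A) * I s) t 0 dJ.
rewrite mul0r expR0 mul1r /I expmx0; under [in RHS]eq_Rintegral do rewrite mul1mx.
by move=> <-; rewrite mulrA -expRD mulNr addNr expR0 mul1r.
Qed.

End flow.

(** * Schwartz functions *)

Section schwartz.
Context {R : realType} {n : nat}.
Implicit Types (f g : 'cV[R]_n -> R) (x y v w s : 'cV[R]_n).

Lemma schwartz_partial f (a : seq 'I_n) : schwartz f -> schwartz (iter_partial a f).
Proof.
by move=> [df bf]; split=> [a'|k a'] *; rewrite -iter_partial_cat.
Qed.

(** For the sup norm, |x|^N is one of the monomials |x_i|^N. *)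
Lemma schwartz_rapid_decay f : schwartz f -> rapid_decay f.
Proof.
move=> [_ bf] N.
have [C0 H0] := bf (fun=> 0%N) [::].
have H i : exists C, forall x, `|x i 0 ^+ N * f x| <= C.
  have [C HC] := bf (fun k => if k == i then N else 0%N) [::]; exists C => x.
  apply: le_trans (HC x); rewrite (bigD1 i)//= eqxx big1 ?mulr1// => k /negbTE ->.
  by rewrite expr0.
have [C HC] := choice H.
exists (2 ^+ N * (C0 + \sum_i `|C i|)) => x.
have f0 : `|f x| <= C0.
  by have := H0 x; rewrite /= big1 ?mul1r// => i _; rewrite expr0.
have fN : `|f x| * `|x| ^+ N <= C0 + \sum_i `|C i|.
  have [x0|/mx_norm_neq0[[i j]]] := eqVneq (mx_norm x) 0.
    have -> : `|x| = 0 := x0.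
    apply: le_trans (_ : C0 <= _); last by rewrite lerDl sumr_ge0.
    by case: (N) => [|N']; rewrite ?expr0 ?mulr1// expr0n/= mulr0; exact: le_trans f0.
  rewrite ord1/= => xi; have -> : `|x| = `|x i 0| := xi.
  rewrite mulrC -normrX -normrM; apply: le_trans (HC i x) _.
  apply: le_trans (ler_norm _) _; rewrite (bigD1 i)//= addrCA lerDl addr_ge0 ?sumr_ge0//.
  exact: le_trans f0.
have sumC : 0 <= \sum_i `|C i| by rewrite sumr_ge0.
have [x1|x1] := leP `|x| 1.
  rewrite mulrC; apply: ler_pM => //.
    by rewrite lerXn2r ?nnegrE ?addr_ge0//; lra.
  by apply: le_trans f0 _; rewrite lerDl.
apply: le_trans (_ : `|f x| * (2 * `|x|) ^+ N <= _).
  by rewrite ler_wpM2l// lerXn2r ?nnegrE ?mulr_ge0 ?addr_ge0//; lra.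
by rewrite exprMn mulrCA ler_wpM2l// exprn_ge0.
Qed.

Lemma schwartz_rapid_decay_partial f a : schwartz f -> rapid_decay (iter_partial a f).
Proof. by move=> /(schwartz_partial a); exact: schwartz_rapid_decay. Qed.

Lemma schwartz_continuous f a : schwartz f -> continuous (iter_partial a f).
Proof. by move=> [df _] x; apply: differentiable_continuous; exact: df. Qed.

Lemma schwartz_tame f : schwartz f -> tame f.
Proof.
move=> sf; split.
- by move=> x; have [df _] := sf; exact: (df [::]).
- exact: schwartz_rapid_decay.
- by move=> i; exact: (schwartz_rapid_decay_partial [:: i] sf).
- by move=> i; exact: (schwartz_continuous (a := [:: i]) sf).
Qed.

Lemma schwartz_smooth_bounded f : schwartz f -> smooth_bounded f.
Proof.
move=> sf; split=> a.
  by move=> x v; apply: differentiable_is_derive; have [df _] := sf; exact: df.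
exact/rapid_decay_bounded/schwartz_rapid_decay_partial.
Qed.

Lemma schwartz_measurable f a : schwartz f -> measurable_fun setT (iter_partial a f).
Proof. by move=> sf; apply: continuous_measurable_cV; exact: schwartz_continuous. Qed.

Lemma schwartz_integrable f : schwartz f -> (lebesgue_cV n).-integrable setT (EFin \o f).
Proof.
move=> sf; apply: rapid_decay_integrable; last exact: schwartz_rapid_decay.
exact: (schwartz_measurable [::] sf).
Qed.

Lemma is_derive_translate f x v w df :
  is_derive (x + w) v f df -> is_derive x v (fun y => f (y + w)) df.
Proof.
move=> /is_derive_line0 H; apply/is_derive_line0.
by under eq_fun do rewrite addrAC.
Qed.

Lemma tame_mul_translate f g v : tame f -> tame g -> tame (fun x => f x * g (x + v)).
Proof.
move=> [df rf rdf cdf] [dg rg rdg cdg].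
have [Cg HCg] := rapid_decay_bounded rg.
have E i : (fun x => 'D_(delta_mx i 0) (fun x => f x * g (x + v)) x) =
    fun x => 'D_(delta_mx i 0) f x * g (x + v) + f x * 'D_(delta_mx i 0) g (x + v).
  apply/funext => x.
  have D1 := derivableP (@diff_derivable _ _ _ f x (delta_mx i 0) (df x)).
  have D2 := is_derive_translate (derivableP (@diff_derivable _ _ _ g (x + v) (delta_mx i 0) (dg (x + v)))).
  have D := is_deriveM D1 D2; rewrite derive_val.
  by rewrite /GRing.scale/=; ring.
have ds x : differentiable (fun y : 'cV[R]_n => y + v) x.
  by apply: differentiableD => //; exact: differentiable_cst.
have cs (h : 'cV[R]_n -> R) : continuous h -> continuous (fun x => h (x + v)).
  move=> ch x.
  exact: (cvg_comp (fun y => y + v) h (differentiable_continuous (ds x)) (ch (x + v))).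
have cf := differentiable_continuous_cV df.
have cg := differentiable_continuous_cV dg.
split.
- move=> x; apply: differentiableM => //.
  apply: (@differentiable_comp _ _ _ _ (fun x => x + v) g) => //.
- exact: rapid_decayM rf (fun x => HCg _).
- move=> i; rewrite E; have [C HC] := rapid_decay_bounded (rdg i).
  by apply: rapid_decayD; [exact: rapid_decayM (rdf i) (fun x => HCg _)|exact: rapid_decayM rf (fun x => HC _)].
- move=> i; rewrite E => x.
  exact: (cvgD (cvgM (cdf i x) (cs _ cg x)) (cvgM (cf x) (cs _ (cdg i) x))).
Qed.

End schwartz.

(** * Correlations *)

Section corr.
Context {R : realType} {n : nat}.
Local Notation leb := (@lebesgue_cV R n).
Local Notation gam := (normal_prob (0 : R) 1).
Implicit Types (f g : 'cV[R]_n -> R) (x y v w s : 'cV[R]_n).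

(** The correlation turns an integral that is quadratic in the solution into a
    function on which Gaussian averages and partial derivatives act linearly.
    *)
Definition corr f g w : R := \int[leb]_x (f x * g (x + w)).

Definition bounded_measurable f := measurable_fun setT f /\ exists C, forall x, `|f x| <= C.

Lemma integrableM_bounded f g : leb.-integrable setT (EFin \o f) ->
  bounded_measurable g -> leb.-integrable setT (fun x => (f x * g x)%:E).
Proof.
move=> fi [mg [C HC]]; have mf : measurable_fun setT f.
  by apply/measurable_EFinP; exact: measurable_int fi.
apply: (@le_normr_integrable _ _ _ leb _ (fun x => C * `|f x|)).
- exact: measurable_funM.
- rewrite /comp; under eq_fun do rewrite EFinM.
  by apply: integrableZl => //; exact: integrable_norm.
- by move=> x; rewrite normrM mulrC ler_wpM2r.
Qed.

Lemma bounded_measurable_translate g w : bounded_measurable g ->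
  bounded_measurable (fun x => g (x + w)).
Proof.
move=> [mg [C HC]]; split; last by exists C => x.
by apply: (measurableT_comp mg); exact: measurable_translate_cV.
Qed.

Lemma integrable_corr f g w : leb.-integrable setT (EFin \o f) ->
  bounded_measurable g -> leb.-integrable setT (fun x => (f x * g (x + w))%:E).
Proof. by move=> fi bg; apply: integrableM_bounded => //; exact: bounded_measurable_translate. Qed.

Lemma corr_lincomb f (I : Type) (r : seq I) (c : I -> R) (g : I -> 'cV[R]_n -> R) w :
  leb.-integrable setT (EFin \o f) -> (forall i, bounded_measurable (g i)) ->
  corr f (fun x => \sum_(i <- r) c i * g i x) w = \sum_(i <- r) c i * corr f (g i) w.
Proof.
move=> fi bg; rewrite /corr -(Rintegral_lincomb r c); last first.
  by move=> i; exact: integrable_corr.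
apply: eq_Rintegral => x _; rewrite mulr_sumr.
by apply: eq_bigr => i _; rewrite mulrCA.
Qed.

Lemma schwartz_bounded_measurable g a : schwartz g -> bounded_measurable (iter_partial a g).
Proof.
move=> sg; split; first exact: schwartz_measurable.
exact/rapid_decay_bounded/schwartz_rapid_decay_partial.
Qed.

Lemma corr_jet f g : leb.-integrable setT (EFin \o f) -> schwartz g ->
  smooth_bounded (corr f g) /\ forall a, iter_partial a (corr f g) = corr f (iter_partial a g).
Proof.
move=> fi sg; pose J a := corr f (iter_partial a g).
have sgb := schwartz_smooth_bounded sg.
have bg a : bounded_measurable (iter_partial a g) by exact: schwartz_bounded_measurable.
have dJ a w v : is_derive w v (J a) (\sum_i v i 0 * J (i :: a) w).
  apply/is_derive_line0; rewrite /J/=.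
  pose dg x := \sum_i v i 0 * iter_partial (i :: a) g x.
  have sdg : smooth_bounded dg.
    exact: (smooth_bounded_lincomb (index_enum _) (fun i => v i 0)
      (f := fun i => iter_partial (i :: a) g) (fun i => smooth_bounded_partial (i :: a) sgb)).
  have [_ /(_ [::])/= [C HC]] := sdg.
  have <- : corr f dg (w + 0 *: v) = \sum_i v i 0 * J (i :: a) w.
    rewrite scale0r addr0.
    exact: (corr_lincomb (index_enum _) (fun i => v i 0)
      (g := fun i => iter_partial (i :: a) g) w fi (fun i => bg (i :: a))).
  apply: (@is_derive_Rintegral _ _ _ leb
    (fun h x => f x * iter_partial a g (x + (w + h *: v)))
    (fun h x => f x * dg (x + (w + h *: v))) (fun x => C * `|f x|) 0 1) => //.
  - by move=> h _; exact: integrable_corr.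
  - move=> h x _.
    have D : is_derive h 1 (fun h => iter_partial a g (x + w + h *: v)) (dg (x + w + h *: v)).
      by apply/is_derive_line; have [D _] := sgb; exact: D.
    rewrite addrA; under eq_fun do rewrite addrA.
    exact: is_deriveZ.
  - rewrite /comp; under eq_fun do rewrite EFinM.
    by apply: integrableZl => //; exact: integrable_norm.
  - by move=> h x _; rewrite normrM mulrC ler_wpM2r.
have bJ a : exists C, forall x, `|J a x| <= C.
  have [_ [C HC]] := bg a; exists (\int[leb]_x (C * `|f x|)) => w.
  apply: le_trans (le_normr_Rintegral _ (integrable_corr w fi (bg a))) _ => //.
  apply: le_Rintegral => //.
  - have := integrable_norm (integrable_corr w fi (bg a)).
    by [].
  - rewrite /comp; under eq_fun do rewrite EFinM.
    by apply: integrableZl => //; exact: integrable_norm.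
  - by move=> x _; rewrite normrM mulrC ler_wpM2r.
split; first exact: smooth_bounded_jet dJ bJ.
exact: iter_partial_jet.
Qed.

Lemma smooth_bounded_corr f g : schwartz f -> schwartz g -> smooth_bounded (corr f g).
Proof. by move=> sf sg; have [] := corr_jet (schwartz_integrable sf) sg. Qed.

Lemma iter_partial_corr f g a : schwartz f -> schwartz g ->
  iter_partial a (corr f g) = corr f (iter_partial a g).
Proof. by move=> sf sg; have [_] := corr_jet (schwartz_integrable sf) sg; exact. Qed.

(** Integration by parts; translating commutes with differentiating. *)
Lemma corr_partial f g i w : schwartz f -> schwartz g ->
  corr (iter_partial [:: i] f) g w = - corr f (iter_partial [:: i] g) w.
Proof.
move=> sf sg; have sfi := schwartz_partial [:: i] sf.
have i1 := integrable_corr w (schwartz_integrable sfi) (schwartz_bounded_measurable [::] sg).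
have i2 := integrable_corr w (schwartz_integrable sf) (schwartz_bounded_measurable [:: i] sg).
apply/eqP; rewrite -addr_eq0 /corr -RintegralD//; apply/eqP.
have [df _] := sf; have [dg _] := sg.
have tfg := tame_mul_translate w (schwartz_tame sf) (schwartz_tame sg).
have D x : is_derive x (delta_mx i 0) (fun x => f x * g (x + w))
    (iter_partial [:: i] f x * g (x + w) + f x * iter_partial [:: i] g (x + w)).
  have D1 := derivableP (@diff_derivable _ _ _ f x (delta_mx i 0) (df [::] x)).
  have D2 := is_derive_translate
    (derivableP (@diff_derivable _ _ _ g (x + w) (delta_mx i 0) (dg [::] (x + w)))).
  apply: is_derive_eq (is_deriveM D1 D2) _.
  by rewrite /GRing.scale/=; ring.
apply: (Rintegral_dirder0 D); first exact: measurable_tame.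
  by have [] := tfg.
have [C HC] := rapid_decay_bounded (schwartz_rapid_decay sg).
have [C' HC'] := rapid_decay_bounded (schwartz_rapid_decay_partial [:: i] sg).
apply: rapid_decayD.
  exact: (rapid_decayM (schwartz_rapid_decay sfi) (fun x => HC (x + w))).
exact: (rapid_decayM (schwartz_rapid_decay sf) (fun x => HC' (x + w))).
Qed.

Lemma measurable_ray s : measurable_fun setT
  (fun p : 'cV[R]_n * measurableTypeR R => p.1 + (p.2 : R) *: s).
Proof.
apply: measurable_fun_cVP => i.
rewrite (_ : _ \o _ = fun p : 'cV[R]_n * measurableTypeR R => cV_coord i p.1 + p.2 * s i 0).
  apply: measurable_funD; first exact: measurableT_comp (measurable_cV_coord i) measurable_fst.
  by apply: measurable_funM => //; exact: measurable_snd.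
by apply/funext => p; rewrite /= /cV_coord !mxE.
Qed.

(** By the Tonelli theorem, since for each z the translation by z s does not
    change the integral of k. *)
Lemma integrable_ray (h : 'cV[R]_n -> R -> R) (k : 'cV[R]_n -> R) s :
  measurable_fun setT (fun p : 'cV[R]_n * measurableTypeR R => h p.1 p.2) ->
  leb.-integrable setT (EFin \o k) ->
  (forall x z, `|h x z| <= k (x + z *: s)) ->
  (leb \x gam)%E.-integrable setT (fun p => (h p.1 p.2)%:E).
Proof.
move=> mh ki hk; have mk : measurable_fun setT k.
  by apply/measurable_EFinP; exact: measurable_int ki.
have k0 x : 0 <= k x.
  by have := le_trans (normr_ge0 _) (hk x 0); rewrite scale0r addr0.
have mh' : measurable_fun setT (fun p : 'cV[R]_n * measurableTypeR R => (h p.1 p.2)%:E).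
  exact/measurable_EFinP.
apply/(integrable21ltyP leb gam mh').
pose K := (\int[leb]_x (k x)%:E)%E.
have Kfin : (K < +oo)%E.
  move/integrableP : ki => [_]; under eq_integral do rewrite gee0_abs ?lee_fin//.
  by [].
have K0 : (0 <= K)%E by apply: integral_ge0 => x _; rewrite lee_fin.
apply: (@le_lt_trans _ _ (\int[gam]_z K)%E); last first.
  by rewrite integral_cst// (measure_setT1 gam) mule1.
apply: ge0_le_integral => //.
- by move=> z _; apply: integral_ge0 => x _; exact: abse_ge0.
- apply: (measurable_fun_fubini_tonelli_G (m1 := leb)
    (fun p : 'cV[R]_n * measurableTypeR R => `|(h p.1 p.2)%:E|%E)).
    exact: measurableT_comp.
  by move=> p; exact: abse_ge0.
- move=> z _.
  have <- : (\int[leb]_x (k (x + z *: s))%:E = K)%E.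
    by rewrite (ge0_integral_cV_translate (z *: s) (f := EFin \o k))//; exact/measurable_EFinP.
  apply: ge0_le_integral => //.
  + apply: measurableT_comp => //; apply: (measurableT_comp mh').
    exact: measurable_pair2.
  + apply/measurable_EFinP; apply: (measurableT_comp mk); exact: measurable_translate_cV.
  + by move=> x _; rewrite lee_fin.
Qed.

Lemma measurable_fun_ray f s : measurable_fun setT f ->
  measurable_fun setT (fun p : 'cV[R]_n * measurableTypeR R => f (p.1 + (p.2 : R) *: s)).
Proof. by move=> mf; apply: measurableT_comp mf (measurable_ray s). Qed.

Lemma bounded_measurable_ray f s x : bounded_measurable f ->
  gam.-integrable setT (fun z : R => (f (x + z *: s))%:E).
Proof.
move=> [mf [C HC]]; apply: (@bounded_integrable _ _ _ gam _ C) => //.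
exact: (measurableT_comp (measurable_fun_ray s mf) (measurable_pair1 x)).
Qed.

Lemma bounded_measurable_gauss_avg s f : bounded_measurable f ->
  bounded_measurable (gauss_avg s f).
Proof.
move=> bf; have [mf [C HC]] := bf; split; last first.
  exists C => x; apply: (@norm_Rintegral_le _ _ _ gam) => //.
  exact: (measurableT_comp (measurable_fun_ray s mf) (measurable_pair1 x)).
have C0 : 0 <= C by exact: le_trans (normr_ge0 _) (HC 0).
(* Adding C makes the integrand nonnegative, so that its partial integral is
   measurable by the Tonelli theorem. *)
pose h (p : 'cV[R]_n * measurableTypeR R) : \bar R := (f (p.1 + (p.2 : R) *: s) + C)%:E.
have mh : measurable_fun setT h.
  by apply/measurable_EFinP; apply: measurable_funD => //; exact: measurable_fun_ray.
have h0 p : (0 <= h p)%E.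
  by rewrite lee_fin; have := HC (p.1 + (p.2 : R) *: s); rewrite ler_norml => /andP[]; lra.
have := measurable_fun_fubini_tonelli_F (m2 := gam) _ mh h0.
have -> : fubini_F gam h = fun x => (gauss_avg s f x + C)%:E.
  apply/funext => x; rewrite /fubini_F /h/=.
  rewrite /gauss_avg -[in RHS](@Rintegral_probability_cst _ _ _ gam C) -(@RintegralD _ _ _ gam)//.
  - rewrite /Rintegral fineK//; apply: integrable_fin_num => //.
    apply: (@bounded_integrable _ _ _ gam _ (C + C)).
      by apply: measurable_funD => //; exact: (measurableT_comp (measurable_fun_ray s mf) (measurable_pair1 x)).
    by move=> z; apply: le_trans (ler_normD _ _) _; rewrite lerD// ger0_norm.
  - exact: bounded_measurable_ray.
  - exact: (@bounded_integrable _ _ _ gam _ `|C|).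
move=> /measurable_EFinP H.
have -> : gauss_avg s f = fun x => (gauss_avg s f x + C) - C by apply/funext => x; rewrite addrK.
exact: measurable_funB.
Qed.

Lemma integrable_gauss_avg s f : bounded_measurable f -> leb.-integrable setT (EFin \o f) ->
  leb.-integrable setT (EFin \o gauss_avg s f).
Proof.
move=> bf fi; have [mf _] := bf.
have H := @integrable_ray (fun x z => f (x + z *: s)) (fun x => `|f x|) s
  (measurable_fun_ray s mf) (integrable_norm fi) (fun x z => lexx _).
have := integrable_fubini_F H.
apply: eq_integrable => // x _; rewrite /fubini_F/= /gauss_avg /Rintegral fineK//.
by apply: integrable_fin_num => //; exact: bounded_measurable_ray.
Qed.

Lemma corr_gauss_avgr f g s w : leb.-integrable setT (EFin \o f) ->
  bounded_measurable g -> corr f (gauss_avg s g) w = gauss_avg s (corr f g) w.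
Proof.
move=> fi bg; have [mg [C HC]] := bg; have mf : measurable_fun setT f.
  by apply/measurable_EFinP; exact: measurable_int fi.
have bgw x := bounded_measurable_ray s (x + w) bg.
transitivity (\int[leb]_x \int[gam]_z (f x * g (x + w + z *: s))).
  apply: eq_Rintegral => x _; rewrite /gauss_avg (@RintegralZl _ _ _ gam)//.
  exact: bgw.
rewrite (@Rintegral_Fubini _ _ _ _ _ leb gam (fun x z => f x * g (x + w + z *: s))).
- by apply: eq_Rintegral => z _; apply: eq_Rintegral => x _; rewrite addrA.
- apply: (@integrable_ray (fun x z => f x * g (x + w + z *: s)) (fun x => C * `|f x|) 0).
  + apply: measurable_funM; first exact: measurableT_comp mf measurable_fst.
    apply: (measurableT_comp mg).
    rewrite (_ : (fun p => _) = (fun x => x + w) \o (fun p : 'cV[R]_n * measurableTypeR R => p.1 + (p.2 : R) *: s)).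
      by apply: measurableT_comp; [exact: measurable_translate_cV|exact: measurable_ray].
    by apply/funext => p /=; rewrite addrAC.
  + rewrite /comp; under eq_fun do rewrite EFinM.
    by apply: integrableZl => //; exact: integrable_norm.
  + by move=> x z; rewrite scaler0 addr0 normrM mulrC ler_wpM2r.
- move=> x; rewrite /comp; under eq_fun do rewrite EFinM.
  by apply: integrableZl => //; exact: bgw.
- move=> z; under [X in _.-integrable _ (EFin \o X)]eq_fun do rewrite -addrA.
  exact: integrable_corr.
Qed.

(** The substitution of x - z s for x moves the average from f to the
    correlation and reverses the direction s. *)
Lemma corr_gauss_avgl f g s w : bounded_measurable f -> leb.-integrable setT (EFin \o f) ->
  bounded_measurable g -> corr (gauss_avg s f) g w = gauss_avg (- s) (corr f g) w.
Proof.
move=> bf fi bg; have [mg [C HC]] := bg; have [mf _] := bf.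
have bgw := bounded_measurable_translate w bg.
transitivity (\int[leb]_x \int[gam]_z (g (x + w) * f (x + z *: s))).
  apply: eq_Rintegral => x _; rewrite mulrC /gauss_avg (@RintegralZl _ _ _ gam)//.
  exact: bounded_measurable_ray.
rewrite (@Rintegral_Fubini _ _ _ _ _ leb gam (fun x z => g (x + w) * f (x + z *: s))).
- apply: eq_Rintegral => z _; rewrite /corr.
  rewrite -[RHS](Rintegral_cV_translate (z *: s)).
    apply: eq_Rintegral => x _; rewrite mulrC; congr (_ * g _).
    by rewrite scalerN addrACA subrr addr0.
  by apply: measurable_funM => //; apply: (measurableT_comp mg); exact: measurable_translate_cV.
- apply: (@integrable_ray (fun x z => g (x + w) * f (x + z *: s)) (fun x => C * `|f x|) s).
  + apply: measurable_funM; last exact: measurable_fun_ray.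
    apply: (measurableT_comp mg).
    exact: (measurableT_comp (measurable_translate_cV w) measurable_fst).
  + rewrite /comp; under eq_fun do rewrite EFinM.
    by apply: integrableZl => //; exact: integrable_norm.
  + by move=> x z; rewrite normrM ler_wpM2r.
- move=> x; rewrite /comp; under eq_fun do rewrite EFinM.
  by apply: integrableZl => //; exact: bounded_measurable_ray.
- move=> z; rewrite /comp; under eq_fun do rewrite mulrC.
  exact: (integrableM_bounded (integrable_cV_translate (z *: s) fi) bgw).
Qed.

Lemma gauss_avgs_bounded_measurable l f : bounded_measurable f ->
  bounded_measurable (gauss_avgs l f).
Proof. by move=> bf; elim: l => //= s l; exact: bounded_measurable_gauss_avg. Qed.

Lemma gauss_avgs_integrable l f : bounded_measurable f -> leb.-integrable setT (EFin \o f) ->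
  leb.-integrable setT (EFin \o gauss_avgs l f).
Proof.
move=> bf fi; elim: l => //= s l; apply: integrable_gauss_avg.
exact: gauss_avgs_bounded_measurable.
Qed.

Lemma corr_gauss_avgs l l' f g : bounded_measurable f -> leb.-integrable setT (EFin \o f) ->
  bounded_measurable g ->
  corr (gauss_avgs l f) (gauss_avgs l' g) = gauss_avgs (map -%R l ++ l') (corr f g).
Proof.
move=> bf fi bg; have bg' := gauss_avgs_bounded_measurable l' bg.
elim: l => [|s l IH] /=; last first.
  rewrite -IH; apply/funext => w; rewrite corr_gauss_avgl//.
    exact: gauss_avgs_bounded_measurable.
  exact: gauss_avgs_integrable.
elim: l' {bg'} => //= s l' IH; rewrite -IH; apply/funext => w.
by rewrite corr_gauss_avgr//; exact: gauss_avgs_bounded_measurable.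
Qed.

End corr.

(** * Gaussian measures as iterated averages *)

Section gaussian_columns.
Context {R : realType}.
Local Notation gam := (normal_prob (0 : R) 1).

Lemma power_measure_setT1 m : power_measure gam m [set: 'cV[R]_m] = 1%E.
Proof.
elim: m => [|m IH]; first by rewrite /= diracT.
rewrite /= /cons_measure /pushforward preimage_setT -setXTT product_measure1E//.
by rewrite [X in (_ * X)%E]IH mule1; exact: probability_setT.
Qed.

Lemma integrable_power_measure m (f : 'cV[R]_m -> R) (C : R) : measurable_fun setT f ->
  (forall x, `|f x| <= C) -> (power_measure gam m).-integrable setT (EFin \o f).
Proof.
move=> mf fC; apply: measurable_bounded_integrable => //.
  by rewrite [ltLHS]power_measure_setT1 ltry.
by exists C; split=> [|x Cx y _ /=]; [exact: num_real|rewrite (le_trans (fC y))// ltW].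
Qed.

Lemma mulmx_cV_cons n m (S : 'M[R]_(n, m.+1)) (a : R) (z : 'cV[R]_m) :
  S *m cV_cons (a, z) = a *: col ord0 S + col' ord0 S *m z.
Proof.
apply/colP => i; rewrite !mxE big_ord_recl !mxE unlift_none/= mulrC; congr (_ + _).
by apply: eq_bigr => j _; rewrite !mxE liftK.
Qed.

Lemma measurable_mulmx_rect n m (S : 'M[R]_(n, m)) :
  measurable_fun [set: 'cV[R]_m] (mulmx S : 'cV[R]_m -> 'cV[R]_n).
Proof.
apply: measurable_fun_cVP => i.
rewrite (_ : _ \o _ = fun x : 'cV[R]_m => \sum_j S i j * cV_coord j x).
  apply: measurable_sum => j; apply: measurable_funM => //.
  exact: measurable_cV_coord.
by apply/funext => x; rewrite /= /cV_coord mxE.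
Qed.

Lemma measurable_affine n m (x : 'cV[R]_n) (S : 'M[R]_(n, m)) :
  measurable_fun [set: 'cV[R]_m] (fun z => x + S *m z).
Proof.
rewrite (_ : (fun z => _) = (fun y => y + x) \o mulmx S).
  by apply: measurableT_comp; [exact: measurable_translate_cV|exact: measurable_mulmx_rect].
by apply/funext => z; rewrite /= addrC.
Qed.

Definition columns n m (S : 'M[R]_(n, m)) : seq 'cV[R]_n := [seq col j S | j <- enum 'I_m].

Lemma cov_columns n m (S : 'M[R]_(n, m)) : cov (columns S) = S *m S^T.
Proof.
rewrite /cov /columns big_map big_enum/=; apply/matrixP => i j.
by rewrite summxE mxE; apply: eq_bigr => k _; rewrite !mxE big_ord1 !mxE.
Qed.

Lemma columnsS n m (S : 'M[R]_(n, m.+1)) :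
  columns S = col ord0 S :: columns (col' ord0 S).
Proof.
rewrite /columns enum_ordSl/= -map_comp; congr (_ :: _); apply: eq_map => j /=.
by apply/colP => i; rewrite !mxE.
Qed.

(** The coordinates of the product measure are the independent standard
    variables of the list, one for each column of S. *)
Lemma Rintegral_power_gaussian n m (S : 'M[R]_(n, m)) f (x : 'cV[R]_n) :
  bounded_measurable f ->
  \int[power_measure gam m]_z f (x + S *m z) = gauss_avgs (columns S) f x.
Proof.
move=> [mf [C HC]]; elim: m S x => [|m IH] S x.
  rewrite /columns (_ : enum 'I_0 = [::]) /=; last by apply: size0nil; rewrite size_enum_ord.
  rewrite /Rintegral integral_dirac//; last first.
    by apply/measurable_EFinP; apply: (measurableT_comp mf); exact: measurable_affine.
  by rewrite diracT mul1e/= mulmx0 addr0.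
pose h (p : measurableTypeR R * 'cV[R]_m) := f (x + S *m cV_cons p).
have mfS : measurable_fun setT (fun z => f (x + S *m z)).
  by apply: (measurableT_comp mf); exact: measurable_affine.
have mh : measurable_fun setT h by apply: measurableT_comp mfS _; exact: measurable_cV_cons.
have hi : (gam \x power_measure gam m)%E.-integrable setT (EFin \o h).
  apply: (measurable_bounded_integrable (mu := (gam \x power_measure gam m)%E)) => //.
    rewrite -setXTT [ltLHS]product_measure1E// [X in (_ * X)%E]power_measure_setT1 mule1.
    by rewrite (measure_setT1 gam) ltry.
  by exists C; split=> [|u Cu y _ /=]; [exact: num_real|rewrite (le_trans (HC _))// ltW].
have -> : \int[power_measure gam m.+1]_z f (x + S *m z) =
    \int[(gam \x power_measure gam m)%E]_p h p.
  rewrite /Rintegral; congr fine.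
  by apply: (@integral_pushforward _ _ _ _ _ _ (@measurable_cV_cons R m)
    (gam \x power_measure gam m)%E setT (fun z => (f (x + S *m z))%:E)) => //; exact/measurable_EFinP.
rewrite (@Rintegral_Fubini_prod _ _ _ _ _ gam (power_measure gam m) h)//; last first.
  move=> a; apply: (@integrable_power_measure _ _ C) => [|z]; last exact: HC.
  exact: (measurableT_comp mh (measurable_pair1 a)).
rewrite columnsS/= /gauss_avg; apply: eq_Rintegral => a _.
rewrite -IH; apply: eq_Rintegral => z _.
by rewrite /h mulmx_cV_cons addrA.
Qed.

(** The sign of z in f (x - z) is carried by the root. *)
Lemma convolution_gaussian n (V : 'M[R]_n) f (x : 'cV[R]_n) : bounded_measurable f ->
  convolution f (gaussian V) x = gauss_avgs (columns (- gaussian_root V)) f x.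
Proof.
move=> bf; have [mf [C HC]] := bf.
rewrite -Rintegral_power_gaussian//.
have mfx : measurable_fun setT (fun z : 'cV[R]_n => f (x - z)).
  apply: (measurableT_comp mf).
  rewrite (_ : (fun z => _) = fun z => x + (- 1%:M : 'M[R]_n) *m z); first exact: measurable_affine.
  by apply/funext => z; rewrite mulNmx mul1mx.
have E z : f (x - gaussian_root V *m z) = f (x + - gaussian_root V *m z) by rewrite mulNmx.
rewrite /convolution /Rintegral; congr fine.
under [RHS]eq_integral do rewrite -E.
apply: (@integral_pushforward _ _ _ _ _ _ (@measurable_mulmx_cV R n (gaussian_root V))
    (@std_gaussian R n) setT (fun z => (f (x - z))%:E)) => //; first exact/measurable_EFinP.
apply: (@integrable_power_measure _ _ C) => //.
by apply: measurableT_comp mfx _; exact: measurable_mulmx_cV.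
Qed.

Lemma gaussian_rootP n (V : 'M[R]_n) : V^T = V -> (forall v, 0 <= mxform V v) ->
  gaussian_root V *m (gaussian_root V)^T = V.
Proof.
move=> sV pV; have [S SE] := psd_root sV pV.
by have := getPex (ex_intro [set S : 'M[R]_n | S *m S^T = V] S SE).
Qed.

Lemma L2norm_sqr n (f : 'cV[R]_n -> R) : L2norm f ^+ 2 = \int[lebesgue_cV n]_x (f x ^+ 2).
Proof.
rewrite /L2norm /Rintegral.
have := @powR_Lnorm _ _ _ (lebesgue_cV n) (EFin \o f) 2.
rewrite pnatr_eq0 => /(_ isT).
have := @Lnorm_ge0 _ _ _ (lebesgue_cV n) 2%:E (EFin \o f).
set N := Lnorm _ _ _ => N0 NE.
have <- : (\int[lebesgue_cV n]_x `|(EFin \o f) x| `^ 2 = \int[lebesgue_cV n]_x (f x ^+ 2)%:E)%E.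
  apply: eq_integral => x _ /=.
  by rewrite -[2%R]/(2%:R) powR_mulrn ?normr_ge0// real_normK// num_real.
rewrite -NE; move: N0; case: (N) => [r| |]//=.
  rewrite lee_fin => r0; rewrite powR_mulrn//.
by move=> _; rewrite expr0n pnatr_eq0.
Qed.

End gaussian_columns.

(** * The energies as averages of correlations *)

Section energy_formula.
Context {R : realType} {n : nat}.
Implicit Types (f g : 'cV[R]_n -> R) (x v w : 'cV[R]_n) (l : seq 'cV[R]_n).
Local Notation leb := (@lebesgue_cV R n).

Lemma gauss_avgs_mulmx (M : 'M[R]_n) l f :
  gauss_avgs l (fun x => f (M *m x)) = fun x => gauss_avgs (map (mulmx M) l) f (M *m x).
Proof.
elim: l => //= s l ->; apply/funext => x; rewrite /gauss_avg.
by apply: eq_Rintegral => z _; rewrite mulmxDr -scalemxAr.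
Qed.

Lemma is_derive_mulmx (M : 'M[R]_n) f x v df :
  is_derive (M *m x) (M *m v) f df -> is_derive x v (fun x => f (M *m x)) df.
Proof.
move/is_derive_line0 => H; apply/is_derive_line0.
rewrite (_ : (fun h => _) = fun h : R => f (M *m x + h *: (M *m v)))//.
by apply/funext => h; rewrite mulmxDr -scalemxAr.
Qed.

(** Liouville's formula for the product of f with a translate of g. *)
Lemma corr_expmx (A : 'M[R]_n) (t : R) f g w : schwartz f -> schwartz g ->
  corr (fun x => f (expmx (t *: A) *m x)) (fun x => g (expmx (t *: A) *m x)) w =
  expR (- t * \tr A) * corr f g (expmx (t *: A) *m w).
Proof.
move=> sf sg; rewrite /corr -Rintegral_expmx; last first.
  by apply: tame_mul_translate; exact: schwartz_tame.
by apply: eq_Rintegral => x _; rewrite mulmxDr.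
Qed.

Lemma cov_map_mulmx (M : 'M[R]_n) l : cov (map (mulmx M) l) = M *m cov l *m M^T.
Proof.
rewrite /cov big_map mulmx_sumr mulmx_suml; apply: eq_bigr => s _.
by rewrite trmx_mul !mulmxA.
Qed.

Lemma cov_map_opp l : cov (map -%R l) = cov l.
Proof.
by rewrite /cov big_map; apply: eq_bigr => s _; rewrite linearN/= mulmxN mulNmx opprK.
Qed.

Variables (A : 'M[R]_n) (b : 'cV[R]_n) (t : R).
Hypothesis t0 : 0 <= t.
Let e := expmx (- t *: A).
Let c := expR (- t * \tr A).

Let l0 := columns (- gaussian_root (gramian A b t)).

Let cov_l0 : cov l0 = gramian A b t.
Proof.
rewrite cov_columns linearN/= mulmxN mulNmx opprK gaussian_rootP//.
  exact: gramian_sym.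
by move=> v; exact: gramian_psd.
Qed.

(** The columns of minus a root of the Gramian, carried back to time 0
    by the drift. *)
Definition noise : seq 'cV[R]_n :=
  map (mulmx (expmx (- t *: A))) (columns (- gaussian_root (gramian A b t))).

(** The difference of two independent copies of the noise, as produced by the
    correlation of two averages. *)
Definition noise2 : seq 'cV[R]_n := map -%R noise ++ noise.

Lemma cov_noise : cov noise = Lagrangian_gramian A b t.
Proof. by rewrite /noise cov_map_mulmx cov_l0. Qed.

Lemma cov_noise2 : cov noise2 = Lagrangian_gramian A b t + Lagrangian_gramian A b t.
Proof. by rewrite cov_cat cov_map_opp cov_noise. Qed.

Let bm f : schwartz f -> bounded_measurable (fun x => f (e *m x)).
Proof.
move=> sf; have [mf [C HC]] := schwartz_bounded_measurable [::] sf.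
by split; [exact: measurable_mulmx_cV_comp|exists C].
Qed.

Let ie f : schwartz f -> leb.-integrable setT (EFin \o (fun x => f (e *m x))).
Proof.
move=> sf; apply: rapid_decay_integrable; first by have [] := bm sf.
apply: (@rapid_decay_comp _ _ _ (expmx (t *: A))); first exact: expmxKN.
exact: schwartz_rapid_decay.
Qed.

Lemma noise_mulmx f x : gauss_avgs noise f (e *m x) = gauss_avgs l0 (fun x => f (e *m x)) x.
Proof. by rewrite gauss_avgs_mulmx. Qed.

Lemma integrable_noise f g : schwartz f -> schwartz g ->
  leb.-integrable setT (fun x =>
    (gauss_avgs noise f (e *m x) * gauss_avgs noise g (e *m x))%:E).
Proof.
move=> sf sg.
rewrite [X in _.-integrable _ X](_ : _ = fun x => (gauss_avgs l0 (fun x => f (e *m x)) x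
    * gauss_avgs l0 (fun x => g (e *m x)) x)%:E); last first.
  by apply/funext => x; rewrite !noise_mulmx.
apply: integrableM_bounded.
  by apply: gauss_avgs_integrable; [exact: bm|exact: ie].
by apply: gauss_avgs_bounded_measurable; exact: bm.
Qed.

(** Both averages go to the correlation, and the change of variables along the
    flow gives the exponential factor, which the prefactors of the solution
    compensate. *)
Lemma Rintegral_noise f g : schwartz f -> schwartz g ->
  \int[leb]_x (gauss_avgs noise f (e *m x) * gauss_avgs noise g (e *m x)) =
  expR (t * \tr A) * gauss_avgs noise2 (corr f g) 0.
Proof.
move=> sf sg.
have -> : \int[leb]_x (gauss_avgs noise f (e *m x) * gauss_avgs noise g (e *m x)) =
    corr (gauss_avgs l0 (fun x => f (e *m x))) (gauss_avgs l0 (fun x => g (e *m x))) 0.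
  by apply: eq_Rintegral => x _; rewrite !noise_mulmx addr0.
rewrite corr_gauss_avgs; [|exact: bm|exact: ie|exact: bm].
have -> : corr (fun x => f (e *m x)) (fun x => g (e *m x)) =
    fun w => \sum_(i <- [:: tt]) expR (t * \tr A) * corr f g (e *m w).
  by apply/funext => w; rewrite big_seq1 corr_expmx// opprK.
rewrite (gauss_avgs_mulmx e _ (fun w => \sum_(i <- [:: tt]) expR (t * \tr A) * corr f g w)).
rewrite gauss_avgs_lincomb; last by move=> _; exact: smooth_bounded_corr.
rewrite big_seq1 mulmx0 map_cat; congr (_ * gauss_avgs (_ ++ _) _ _).
by rewrite /noise -!map_comp; apply: eq_map => s /=; rewrite mulmxN.
Qed.

Lemma fp_solutionE rho0 : schwartz rho0 ->
  fp_solution A b rho0 t = fun x => c * gauss_avgs noise rho0 (e *m x).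
Proof.
move=> sr; apply/funext => x; rewrite /fp_solution convolution_gaussian; last first.
  have [m [C HC]] := bm sr; split; first exact: measurable_funM.
  by exists (c * C) => y; rewrite normrM [`|expR _|]ger0_norm ?expR_ge0// ler_wpM2l ?expR_ge0.
rewrite (_ : (fun x => _) = fun x => \sum_(i <- [:: tt]) c * rho0 (e *m x)); last first.
  by apply/funext => y; rewrite big_seq1.
rewrite (gauss_avgs_mulmx e _ (fun w => \sum_(i <- [:: tt]) c * rho0 w)).
rewrite gauss_avgs_lincomb; last by move=> _; exact: schwartz_smooth_bounded.
by rewrite big_seq1.
Qed.

Let dnoise f x v : schwartz f ->
  is_derive x v (fun x => gauss_avgs noise f (e *m x))
    (\sum_i (e *m v) i 0 * gauss_avgs noise (iter_partial [:: i] f) (e *m x)).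
Proof.
move=> sf; apply: is_derive_mulmx.
have sbf := schwartz_smooth_bounded sf.
have [+ _] := smooth_bounded_gauss_avgs noise sbf.
move=> /(_ [::] (e *m x) (e *m v)) H; apply: is_derive_eq H _.
by apply: eq_bigr => i _; rewrite iter_partial_gauss_avgs.
Qed.

Lemma derive_fp_solution rho0 x v : schwartz rho0 ->
  'D_v (fp_solution A b rho0 t) x =
  c * \sum_i (e *m v) i 0 * gauss_avgs noise (iter_partial [:: i] rho0) (e *m x).
Proof.
move=> sr; rewrite fp_solutionE//.
have D := is_deriveZ c (dnoise x v sr).
rewrite (_ : (fun x => _) = c *: (fun x => gauss_avgs noise rho0 (e *m x)))//.
by rewrite derive_val.
Qed.

Let edelta i k : (e *m (delta_mx i 0 : 'cV[R]_n)) k 0 = e k i.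
Proof.
rewrite mxE (bigD1 i)//= mxE !eqxx mulr1 big1 ?addr0// => j ji.
by rewrite mxE (negbTE ji) mulr0.
Qed.

Lemma gradient_fp_solution rho0 x : schwartz rho0 ->
  gradient (fp_solution A b rho0 t) x =
  c *: (e^T *m \col_k gauss_avgs noise (iter_partial [:: k] rho0) (e *m x)).
Proof.
move=> sr; apply/colP => i; rewrite !mxE derive_fp_solution//; congr (_ * _).
by apply: eq_bigr => k _; rewrite edelta !mxE.
Qed.

Lemma dgradient_fp_solution rho0 x v : schwartz rho0 ->
  dgradient v (fp_solution A b rho0 t) x =
  c *: (e^T *m \col_k \sum_j (e *m v) j 0 *
    gauss_avgs noise (iter_partial [:: j; k] rho0) (e *m x)).
Proof.
move=> sr; apply/colP => i; rewrite mxE.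
rewrite (_ : (fun y => _) = c *: (fun y => \sum_k e k i *:
    gauss_avgs noise (iter_partial [:: k] rho0) (e *m y))); last first.
  apply/funext => y; rewrite gradient_fp_solution// !mxE; congr (_ * _).
  by apply: eq_bigr => k _; rewrite !mxE.
have D k : is_derive x v (fun y => e k i *: gauss_avgs noise (iter_partial [:: k] rho0) (e *m y))
    (e k i * \sum_j (e *m v) j 0 * gauss_avgs noise (iter_partial [:: j; k] rho0) (e *m x)).
  apply: is_derive_eq (is_deriveZ (e k i) (dnoise x v (schwartz_partial [:: k] sr))) _.
  by [].
have S : is_derive x v (fun y => \sum_k e k i *:
    gauss_avgs noise (iter_partial [:: k] rho0) (e *m y))
    (\sum_k e k i * \sum_j (e *m v) j 0 *
      gauss_avgs noise (iter_partial [:: j; k] rho0) (e *m x)).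
  rewrite (_ : (fun y => _) = \sum_k (fun y => e k i *:
      gauss_avgs noise (iter_partial [:: k] rho0) (e *m y))); last first.
    by apply/funext => y; rewrite fct_sumE.
  exact: is_derive_sum.
have D' := is_deriveZ c S.
rewrite derive_val !mxE; congr (_ * _).
by apply: eq_bigr => k _; rewrite !mxE.
Qed.

Lemma sum_sqr (I : finType) (a f : I -> R) :
  (\sum_i a i * f i) ^+ 2 = \sum_i \sum_j (a i * a j) * (f i * f j).
Proof.
rewrite expr2 mulr_suml; apply: eq_bigr => i _; rewrite mulr_sumr.
by apply: eq_bigr => j _; ring.
Qed.

Lemma mxformE (D : 'M[R]_n) v : mxform D v = \sum_k \sum_l D k l * (v k 0 * v l 0).
Proof.
rewrite /mxform mxE; under eq_bigr do rewrite mxE mulr_suml.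
rewrite exchange_big/=; apply: eq_bigr => k _; apply: eq_bigr => l _.
by rewrite mxE; ring.
Qed.

Lemma mxformZ (D : 'M[R]_n) (a : R) v : mxform D (a *: v) = a ^+ 2 * mxform D v.
Proof.
rewrite /mxform; have -> : (a *: v)^T = a *: v^T by apply/matrixP => i j; rewrite !mxE.
by rewrite -scalemxAl -!scalemxAr -!scalemxAl mxE [in LHS]mxE mulrA -expr2.
Qed.

Let cc : expR (t * \tr A) * (c ^+ 2 * expR (t * \tr A)) = 1.
Proof. by rewrite /c expr2 -!expRD (_ : _ + _ = 0) ?expR0//; ring. Qed.

Lemma L2norm_fp_solution rho0 : schwartz rho0 ->
  expR (t * \tr A) * L2norm (fp_solution A b rho0 t) ^+ 2 =
  gauss_avgs noise2 (corr rho0 rho0) 0.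
Proof.
move=> sr; rewrite L2norm_sqr fp_solutionE//.
under eq_Rintegral do rewrite exprMn expr2 -mulrA [X in _ * (_ * X)]expr2 mulrA -expr2.
rewrite RintegralZl//; last exact: integrable_noise.
by rewrite Rintegral_noise// 2!mulrA -[_ * c ^+ 2 * _]mulrA cc mul1r.
Qed.

Lemma Rintegral_noise_sum (I : finType) (a : I -> I -> R) (f : I -> 'cV[R]_n -> R) :
  (forall i, schwartz (f i)) ->
  \int[leb]_x (c ^+ 2 * \sum_i \sum_j a i j *
     (gauss_avgs noise (f i) (e *m x) * gauss_avgs noise (f j) (e *m x))) =
  c ^+ 2 * (expR (t * \tr A) * \sum_i \sum_j a i j * gauss_avgs noise2 (corr (f i) (f j)) 0).
Proof.
move=> sf.
pose h (p : I * I) x := gauss_avgs noise (f p.1) (e *m x) * gauss_avgs noise (f p.2) (e *m x).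
have ih p : leb.-integrable setT (EFin \o h p) by exact: integrable_noise.
under eq_Rintegral do rewrite pair_bigA/=.
rewrite RintegralZl//; last first.
  apply: (integrable_EFin_sum _ (f := fun p x => a p.1 p.2 * h p x)) => p.
  by rewrite /comp; under eq_fun do rewrite EFinM; apply: integrableZl => //; exact: ih.
rewrite (Rintegral_lincomb _ (fun p => a p.1 p.2) ih) pair_bigA/=.
congr (_ * _); rewrite mulr_sumr; apply: eq_bigr => p _.
by rewrite Rintegral_noise//; ring.
Qed.

Lemma L2norm_derive_fp_solution rho0 : schwartz rho0 ->
  expR (t * \tr A) * L2norm ('D_b (fp_solution A b rho0 t)) ^+ 2 =
  \sum_i \sum_j ((e *m b) i 0 * (e *m b) j 0) *
    gauss_avgs noise2 (corr (iter_partial [:: i] rho0) (iter_partial [:: j] rho0)) 0.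
Proof.
move=> sr; rewrite L2norm_sqr.
under eq_Rintegral do rewrite derive_fp_solution// exprMn sum_sqr.
rewrite (Rintegral_noise_sum (fun i j => (e *m b) i 0 * (e *m b) j 0)
  (f := fun i => iter_partial [:: i] rho0)); last by move=> i; exact: schwartz_partial.
by rewrite 2!mulrA -[_ * c ^+ 2 * _]mulrA cc mul1r.
Qed.

Let form_eT (v : 'I_n -> R) :
  ((c *: (e^T *m \col_k v k))^T *m gramian A b t *m (c *: (e^T *m \col_k v k))) 0 0 =
  c ^+ 2 * \sum_k \sum_l Lagrangian_gramian A b t k l * (v k * v l).
Proof.
transitivity (c ^+ 2 * \sum_k \sum_l Lagrangian_gramian A b t k l *
    ((\col_k v k : 'cV[R]_n) k 0 * (\col_k v k : 'cV[R]_n) l 0)); last first.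
  congr (_ * _); apply: eq_bigr => k _; apply: eq_bigr => l _.
  by congr (_ * (_ * _)); rewrite mxE.
rewrite -/(mxform _ _) mxformZ -mxformE; congr (_ * _).
by rewrite /Lagrangian_gramian mxform_conj.
Qed.

(** The factor E (- t)^T in the gradient of the solution turns the Gramian into
    the Lagrangian one. *)
Lemma gramian_form_gradient rho0 : schwartz rho0 ->
  expR (t * \tr A) * gramian_form A b t (gradient (fp_solution A b rho0 t)) =
  \sum_k \sum_l Lagrangian_gramian A b t k l *
    gauss_avgs noise2 (corr (iter_partial [:: k] rho0) (iter_partial [:: l] rho0)) 0.
Proof.
move=> sr; rewrite /gramian_form.
under eq_Rintegral do rewrite gradient_fp_solution// form_eT.
rewrite (Rintegral_noise_sum _ (f := fun i => iter_partial [:: i] rho0)); last first.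
  by move=> i; exact: schwartz_partial.
by rewrite 2!mulrA -[_ * c ^+ 2 * _]mulrA cc mul1r.
Qed.

Lemma gramian_form_dgradient rho0 : schwartz rho0 ->
  expR (t * \tr A) * gramian_form A b t (dgradient b (fp_solution A b rho0 t)) =
  \sum_k \sum_l Lagrangian_gramian A b t k l * \sum_i \sum_j
    ((e *m b) i 0 * (e *m b) j 0) *
    gauss_avgs noise2 (corr (iter_partial [:: i; k] rho0) (iter_partial [:: j; l] rho0)) 0.
Proof.
move=> sr; rewrite /gramian_form.
pose a (p q : 'I_n * 'I_n) := Lagrangian_gramian A b t p.2 q.2 *
  ((e *m b) p.1 0 * (e *m b) q.1 0).
pose f (p : 'I_n * 'I_n) := iter_partial [:: p.1; p.2] rho0.
have sum4 (h : 'I_n * 'I_n -> 'I_n * 'I_n -> R) :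
    \sum_p \sum_q a p q * h p q =
    \sum_k \sum_l Lagrangian_gramian A b t k l * \sum_i \sum_j
      ((e *m b) i 0 * (e *m b) j 0) * h (i, k) (j, l).
  transitivity (\sum_i \sum_k \sum_j \sum_l a (i, k) (j, l) * h (i, k) (j, l)).
    rewrite [RHS]pair_bigA/=; apply: eq_bigr => -[i k] _; rewrite [RHS]pair_bigA/=.
    by apply: eq_bigr => -[j l] _.
  rewrite exchange_big/=; apply: eq_bigr => k _.
  under eq_bigr => i _ do rewrite exchange_big/=.
  rewrite exchange_big/=; apply: eq_bigr => l _; rewrite mulr_sumr.
  apply: eq_bigr => i _; rewrite mulr_sumr; apply: eq_bigr => j _.
  by rewrite /a/= !mulrA.
have Ex x : ((dgradient b (fp_solution A b rho0 t) x)^T *m gramian A b t *m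
      dgradient b (fp_solution A b rho0 t) x) 0 0 = c ^+ 2 * \sum_p \sum_q a p q *
      (gauss_avgs noise (f p) (e *m x) * gauss_avgs noise (f q) (e *m x)).
  rewrite dgradient_fp_solution// form_eT.
  rewrite (sum4 (fun p q => gauss_avgs noise (f p) (e *m x) * gauss_avgs noise (f q) (e *m x))).
  congr (_ * _); apply: eq_bigr => k _; apply: eq_bigr => l _; congr (_ * _).
  rewrite mulr_suml; apply: eq_bigr => i _; rewrite mulr_sumr; apply: eq_bigr => j _.
  exact: mulrACA.
under eq_Rintegral do rewrite Ex.
rewrite (Rintegral_noise_sum a (f := f)); last by move=> p; exact: schwartz_partial.
by rewrite 2!mulrA -[_ * c ^+ 2 * _]mulrA cc mul1r sum4.
Qed.

End energy_formula.

(** * One-sided difference quotients *)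

Section quotient.
Context {R : realType}.
Implicit Types (f g : R -> R) (t : R).

(** Two-sided for t > 0, right-sided at t = 0. *)
Definition onesided t := within `[0, +oo[ (t : R)^'.

Global Instance onesided_filter t : Filter (onesided t).
Proof. exact: within_filter. Qed.

Lemma near_onesided t : \forall s \near onesided t, [/\ 0 <= s, s - t != 0 & s != t].
Proof.
rewrite /onesided near_withinE; near=> s => /=; rewrite in_itv/= andbT => s0.
have st : s != t by near: s; exact: nbhs_dnbhs_neq.
by rewrite subr_eq0 st.
Unshelve. all: by end_near.
Qed.

Lemma cvg_shift0 t : s - t @[s --> t] --> (0 : R).
Proof. by apply/subr_cvg0; exact: cvg_id. Qed.

Lemma onesided_cvg0 t : s - t @[s --> onesided t] --> (0 : R).
Proof. by apply: cvg_within_filter; apply: cvg_within_filter; exact: cvg_shift0. Qed.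

Definition quotient f t (s : R) := (f s - f t) / (s - t).

(** Derivative relative to the half-line of nonnegative times. *)
Definition derivative_ge0 f t d := quotient f t s @[s --> onesided t] --> (d : R).

Lemma is_derive_ge0 f t d : is_derive t 1 f d -> derivative_ge0 f t d.
Proof.
move=> [df <-]; rewrite /derivative_ge0 /onesided; apply: cvg_within_filter.
have c0 : s - t @[s --> t^'] --> (0 : R)^'.
  move=> P; rewrite /dnbhs /within/= => P0.
  have c1 : s - t @[s --> t] --> (0 : R).
    exact: cvg_shift0.
  change (\forall s \near nbhs t, s != t -> P (s - t)).
  apply: (filterS _ (c1 _ P0 : nbhs t (fun s => s - t != 0 -> P (s - t)))) => s Ps st; apply: Ps.
  by rewrite subr_eq0.
have H : (s - t)^-1 *: ((f \o shift t) ((s - t) *: 1) - f t) @[s --> t^'] --> ('D_1 f t : R).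
  by move=> P HP; exact: (c0 _ (df P HP)).
apply: cvg_trans H; apply: near_eq_cvg; near=> s.
rewrite /quotient /= /GRing.scale/= mulr1 mulrC subrK.
by [].
Unshelve. all: by end_near.
Qed.

Lemma derivative_ge0_cvg f t d : derivative_ge0 f t d -> f s @[s --> onesided t] --> f t.
Proof.
move=> fd.
have : quotient f t s * (s - t) + f t @[s --> onesided t] --> d * 0 + f t.
  by apply: cvgD; [apply: cvgM; [exact: fd|exact: onesided_cvg0]|exact: cvg_cst].
rewrite mulr0 add0r; apply: cvg_trans; apply: near_eq_cvg.
apply: filterS (near_onesided t) => s [_ st _].
by rewrite /quotient mulfVK// subrK.
Qed.

Lemma derivative_ge0M f g t df dg : derivative_ge0 f t df -> derivative_ge0 g t dg ->
  derivative_ge0 (fun s => f s * g s) t (df * g t + f t * dg).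
Proof.
move=> fd gd.
have : quotient f t s * g s + f t * quotient g t s @[s --> onesided t] -->
    df * g t + f t * dg.
  apply: cvgD; apply: cvgM; [exact: fd|exact: derivative_ge0_cvg gd|exact: cvg_cst|exact: gd].
apply: cvg_trans; apply: near_eq_cvg.
apply: filterS (near_onesided t) => s [_ st _].
by rewrite /quotient; field.
Qed.

Lemma derivative_ge0_sum (I : Type) (r : seq I) (f : I -> R -> R) t (d : I -> R) :
  (forall i, derivative_ge0 (f i) t (d i)) ->
  derivative_ge0 (fun s => \sum_(i <- r) f i s) t (\sum_(i <- r) d i).
Proof.
move=> fd.
have : \sum_(i <- r) quotient (f i) t s @[s --> onesided t] --> \sum_(i <- r) d i.
  by apply: cvg_lsum => i; exact: fd.
apply: cvg_trans; apply: near_eq_cvg.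
by near=> s; rewrite /quotient -sumrB mulr_suml.
Unshelve. all: by end_near.
Qed.

Lemma derivative_ge0D f g t df dg : derivative_ge0 f t df -> derivative_ge0 g t dg ->
  derivative_ge0 (fun s => f s + g s) t (df + dg).
Proof.
move=> fd gd.
have : quotient f t s + quotient g t s @[s --> onesided t] --> df + dg by exact: cvgD.
apply: cvg_trans; apply: near_eq_cvg; near=> s.
by rewrite /quotient -mulrDl; congr (_ / _); ring.
Unshelve. all: by end_near.
Qed.

Lemma derivative_ge0Z f (c : R) t df : derivative_ge0 f t df ->
  derivative_ge0 (fun s => c * f s) t (c * df).
Proof.
move=> fd.
have : c * quotient f t s @[s --> onesided t] --> c * df.
  by apply: cvgM; [exact: cvg_cst|exact: fd].
apply: cvg_trans; apply: near_eq_cvg; near=> s.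
by rewrite /quotient mulrA mulrBr.
Unshelve. all: by end_near.
Qed.

Lemma eq_derivative_ge0 f g t d : 0 <= t -> (forall s, 0 <= s -> f s = g s) ->
  derivative_ge0 f t d -> derivative_ge0 g t d.
Proof.
move=> t0 fg; apply: cvg_trans; apply: near_eq_cvg.
by apply: filterS (near_onesided t) => s [s0 _ _]; rewrite /quotient !fg.
Qed.

End quotient.

(** * Evolution of the averages in time *)

Section derivative.
Context {R : realType} {n : nat}.
Variables (A : 'M[R]_n) (b : 'cV[R]_n).
Local Notation H := (Lagrangian_gramian A b).
Local Notation N t psi := (gauss_avgs (noise2 A b t) psi 0).
Local Notation c t := (expmx (- t *: A) *m b).

(** The heat equation in covariance form needs the covariance to grow, hence
    the order of s and t. *)
Lemma noise2_increment psi (M s t : R) : smooth_bounded psi -> bound4 psi M -> 0 <= M ->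
  0 <= s -> s <= t ->
  `|N t psi - N s psi - \sum_i \sum_j (H t - H s) i j * N s (iter_partial [:: i; j] psi)|
    <= (n%:R * \tr (H t - H s) *+ 2) ^+ 2 * M / 4.
Proof.
move=> sp pM M0 s0 st; have t0 := le_trans s0 st.
pose D := H t - H s.
have DT : (D + D)^T = D + D.
  have D1 : D^T = D.
    rewrite /D [LHS](_ : _ = (H t)^T - (H s)^T); first by rewrite !Lagrangian_gramian_sym.
    by apply/matrixP => i j; rewrite !mxE.
  rewrite -[RHS](_ : D^T + D^T = _); last by rewrite D1.
  by apply/matrixP => i j; rewrite !mxE.
have Dp v : 0 <= mxform (D + D) v.
  rewrite /mxform mulmxDr mulmxDl mxE addr_ge0//.
    exact: Lagrangian_gramian_nondecreasing.
  exact: Lagrangian_gramian_nondecreasing.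
have [S SE] := psd_root DT Dp.
have dE : cov (columns S) = D + D by rewrite cov_columns.
have cE : cov (noise2 A b t) = cov (noise2 A b s) + cov (columns S).
  by rewrite dE (cov_noise2 A b t0) (cov_noise2 A b s0) addrACA /D [H s + _]addrC subrK.
have := gauss_avgs_increment 0 sp pM M0 cE.
rewrite dE mxtraceD -/D (_ : _ * (_ + _) = n%:R * \tr D *+ 2); last by rewrite mulrDr mulr2n.
suff -> : gauss_avgs (noise2 A b s) (mxlap (D + D) psi) 0 / 2 =
  \sum_i \sum_j D i j * N s (iter_partial [:: i; j] psi) by [].
rewrite mxlapE (gauss_avgs_lincomb _ (fun p : 'I_n * 'I_n => (D + D) p.1 p.2)
  (f := fun p : 'I_n * 'I_n => iter_partial [:: p.1; p.2] psi)); last first.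
  by move=> p; exact: smooth_bounded_partial.
rewrite pair_bigA/= mulr_suml; apply: eq_bigr => p _.
by rewrite [(D + D) _ _]mxE; field.
Qed.

Lemma Lagrangian_gramian_derivative t i j : 0 <= t ->
  derivative_ge0 (fun s => H s i j) t (c t i 0 * c t j 0).
Proof.
move=> t0; have := mx_is_derive_Lagrangian_gramian A b t0 i j.
rewrite [X in is_derive _ _ _ X](_ : _ = c t i 0 * c t j 0); last first.
  by rewrite mxE big_ord1 [in X in _ * X]mxE.
move/is_derive_ge0; apply: eq_derivative_ge0 => // s s0.
by rewrite Lagrangian_gramianE.
Qed.

Let D t s := H s - H t.

Let DE t s i j : D t s i j = H s i j - H t i j.
Proof. by rewrite /D [LHS]mxE; congr (_ + _); rewrite [LHS]mxE. Qed.

(** The point of reference is the smaller of the two times, whichever it is. *)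
Lemma noise2_increment_sym psi (M s t : R) : smooth_bounded psi -> bound4 psi M -> 0 <= M ->
  0 <= s -> 0 <= t ->
  `|N s psi - N t psi -
    \sum_i \sum_j D t s i j * N (Num.min s t) (iter_partial [:: i; j] psi)|
    <= (n%:R * \tr (D t s) *+ 2) ^+ 2 * M / 4.
Proof.
move=> sp pM M0 s0 t0; have [ts|st] := leP t s; first exact: noise2_increment.
have := noise2_increment sp pM M0 s0 (ltW st).
have DN : H t - H s = - D t s by rewrite /D opprB.
rewrite DN linearN/= mulrN mulNrn sqrrN -normrN.
rewrite (_ : - (_ - _) = N s psi - N t psi - \sum_i \sum_j D t s i j * N s (iter_partial [:: i; j] psi))//.
rewrite (_ : \sum_i \sum_j (- D t s) i j * _ = - \sum_i \sum_j D t s i j * N s (iter_partial [:: i; j] psi)).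
  ring.
rewrite -sumrN; apply: eq_bigr => i _; rewrite -sumrN; apply: eq_bigr => j _.
by rewrite [X in X * _ = _]mxE mulNr.
Qed.

Let cvg_sum0 (f : 'I_n -> R -> R) t :
  (forall i, f i s @[s --> onesided t] --> (0 : R)) ->
  \sum_i f i s @[s --> onesided t] --> (0 : R).
Proof.
move=> f0; rewrite [X in _ --> X](_ : 0 = \sum_(i < n) (0 : R)); last by rewrite big1.
exact: cvg_lsum.
Qed.

Let cvgD0 t i j : 0 <= t -> D t s i j @[s --> onesided t] --> (0 : R).
Proof.
move=> t0.
have /subr_cvg0 := derivative_ge0_cvg (@Lagrangian_gramian_derivative t i j t0).
by apply: cvg_trans; apply: near_eq_cvg; near=> s; rewrite DE.
Unshelve. all: by end_near.
Qed.

Let cvgDq t i j : 0 <= t -> D t s i j / (s - t) @[s --> onesided t] --> c t i 0 * c t j 0.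
Proof.
move=> t0; have := @Lagrangian_gramian_derivative t i j t0.
apply: cvg_trans; apply: near_eq_cvg; near=> s.
by rewrite /quotient DE.
Unshelve. all: by end_near.
Qed.

Let trDE t s : \tr (D t s) = \sum_i D t s i i.
Proof. by []. Qed.

Let cvg_error (M t : R) : 0 <= t ->
  (n%:R * \tr (D t s) *+ 2) ^+ 2 * M / 4 @[s --> onesided t] --> (0 : R).
Proof.
move=> t0.
have T0 : \tr (D t s) @[s --> onesided t] --> (0 : R).
  by apply: cvg_sum0 => i; exact: cvgD0.
have : (n%:R * 2) ^+ 2 * M / 4 * (\tr (D t s) * \tr (D t s)) @[s --> onesided t] -->
    (n%:R * 2) ^+ 2 * M / 4 * (0 * 0).
  by apply: cvgM; [exact: cvg_cst|exact: cvgM].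
rewrite !mulr0; apply: cvg_trans; apply: near_eq_cvg; near=> s.
by rewrite -mulr_natr; field.
Unshelve. all: by end_near.
Qed.

Lemma noise2_cvg psi t : smooth_bounded psi -> 0 <= t ->
  N s psi @[s --> onesided t] --> N t psi.
Proof.
move=> sp t0; have [M M0 pM] := bound4_exists sp.
pose S s := \sum_i \sum_j D t s i j * N (Num.min s t) (iter_partial [:: i; j] psi).
have E0 : N s psi - N t psi - S s @[s --> onesided t] --> (0 : R).
  apply/norm_cvg0P; apply: (squeeze_cvgr _ (cvg_cst 0) (cvg_error M t0)).
  apply: filterS (near_onesided t) => s [s0 _ _]; rewrite normr_ge0/=.
  exact: noise2_increment_sym.
have S0 : S s @[s --> onesided t] --> (0 : R).
  apply: cvg_sum0 => i; apply: cvg_sum0 => j.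
  have [_ /(_ [:: i; j]) [C HC]] := sp.
  have D0 : `|D t s i j| * C @[s --> onesided t] --> (0 : R).
    rewrite -(mul0r C); apply: cvgM; last exact: cvg_cst.
    by apply/norm_cvg0P; exact: cvgD0.
  apply/norm_cvg0P; apply: (squeeze_cvgr _ (cvg_cst 0) D0).
  near=> s; rewrite normr_ge0/= normrM ler_wpM2l//.
  exact: (gauss_avgs_le _ (smooth_bounded_partial [:: i; j] sp) HC).
have : N s psi - N t psi - S s + S s @[s --> onesided t] --> (0 : R) + 0 by exact: cvgD.
rewrite addr0 => Z; apply/subr_cvg0; apply: cvg_trans Z; apply: near_eq_cvg; near=> s.
by rewrite subrK.
Unshelve. all: by end_near.
Qed.

(** Dividing the increment by s - t: the matrix (H s - H t) / (s - t) has a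
    limit, the reference time tends to t and the averages are continuous, and
    the error is of second order. *)
Lemma noise2_derivative psi t : smooth_bounded psi -> 0 <= t ->
  derivative_ge0 (fun s => N s psi) t
    (\sum_i \sum_j c t i 0 * c t j 0 * N t (iter_partial [:: i; j] psi)).
Proof.
move=> sp t0; have [M M0 pM] := bound4_exists sp.
pose S s := \sum_i \sum_j D t s i j / (s - t) * N (Num.min s t) (iter_partial [:: i; j] psi).
have S1 : S s @[s --> onesided t] -->
    \sum_i \sum_j c t i 0 * c t j 0 * N t (iter_partial [:: i; j] psi).
  apply: cvg_lsum => i; apply: cvg_lsum => j; apply: cvgM; first exact: cvgDq.
  have P1 := smooth_bounded_partial [:: i; j] sp.
  apply/cvgrPdist_lt => e e0; have /cvgrPdist_lt/(_ e e0) := noise2_cvg P1 t0.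
  apply: filterS => s; have [ts|//] := leP t s.
  by rewrite subrr normr0.
have E0 : quotient (fun s => N s psi) t s - S s @[s --> onesided t] --> (0 : R).
  have T1 : \sum_i D t s i i / (s - t) @[s --> onesided t] --> \sum_i c t i 0 * c t i 0.
    by apply: cvg_lsum => i; exact: cvgDq.
  have Q : (n%:R * 2) ^+ 2 * M / 4 * `|\sum_i D t s i i / (s - t)| * `|\sum_i D t s i i|
      @[s --> onesided t] --> (0 : R).
    rewrite -[X in _ --> X](mulr0 ((n%:R * 2) ^+ 2 * M / 4 * `|\sum_i c t i 0 * c t i 0|)).
    apply: cvgM; first apply: cvgM; first exact: cvg_cst.
      exact: cvg_norm T1.
    by apply/norm_cvg0P; apply: cvg_sum0 => i; exact: cvgD0.
  apply/norm_cvg0P; apply: (squeeze_cvgr _ (cvg_cst 0) Q).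
  apply: filterS (near_onesided t) => s [s0 st _]; rewrite normr_ge0/=.
  have := noise2_increment_sym sp pM M0 s0 t0.
  set X := \sum_i \sum_j _ => B.
  have -> : quotient (fun s => N s psi) t s - S s = (N s psi - N t psi - X) / (s - t).
    rewrite /quotient [RHS]mulrBl; congr (_ - _); rewrite mulr_suml; apply: eq_bigr => i _.
    by rewrite mulr_suml; apply: eq_bigr => j _; rewrite mulrAC.
  rewrite normrM normfV ler_pdivrMr ?normr_gt0//; apply: le_trans B _.
  rewrite -mulr_suml normrM normfV -trDE.
  rewrite -(real_normK (num_real (n%:R * \tr (D t s) *+ 2))) -mulr_natr !normrM !normr_nat.
  rewrite le_eqVlt; apply/orP; left; apply/eqP; have : `|s - t| != 0 by rewrite normr_eq0.
  move: `|s - t| `|\tr _| => u v u0; by field.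
have : quotient (fun s => N s psi) t s - S s + S s @[s --> onesided t] -->
    0 + \sum_i \sum_j c t i 0 * c t j 0 * N t (iter_partial [:: i; j] psi) by exact: (cvgD E0 S1).
rewrite add0r; apply: cvg_trans; apply: near_eq_cvg; near=> s.
by rewrite subrK.
Unshelve. all: by end_near.
Qed.

(** One of the two derivatives of the correlation is moved from g to f, with a
    change of sign: diffusion of the correlation is dissipation for f and g. *)
Lemma noise2_corr_derivative f g t : schwartz f -> schwartz g -> 0 <= t ->
  derivative_ge0 (fun s => N s (corr f g)) t
    (- \sum_i \sum_j c t i 0 * c t j 0 *
      N t (corr (iter_partial [:: i] f) (iter_partial [:: j] g))).
Proof.
move=> sf sg t0; have sb := smooth_bounded_corr sf sg.
rewrite (_ : - _ = \sum_i \sum_j c t i 0 * c t j 0 * N t (iter_partial [:: i; j] (corr f g))).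
  exact: noise2_derivative.
rewrite -sumrN; apply: eq_bigr => i _; rewrite -sumrN; apply: eq_bigr => j _.
rewrite iter_partial_corr//.
have -> : corr f (iter_partial [:: i; j] g) = fun w =>
    \sum_(k <- [:: tt]) - 1 * corr (iter_partial [:: i] f) (iter_partial [:: j] g) w.
  apply/funext => w; rewrite big_seq1 mulN1r corr_partial ?opprK//.
  exact: schwartz_partial.
rewrite gauss_avgs_lincomb; last by move=> _; apply: smooth_bounded_corr; exact: schwartz_partial.
by rewrite big_seq1; ring.
Qed.

End derivative.

(** * Monotonicity from one-sided derivatives *)

Section monotonicity.
Context {R : realType}.
Implicit Types (f : R -> R) (t : R).

Lemma derivative_ge0_is_derive f t d : 0 < t -> derivative_ge0 f t d -> is_derive t 1 f d.
Proof.
move=> t0 fd.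
have c0 : h + t @[h --> (0 : R)^'] --> onesided t.
  move=> P; rewrite /onesided /dnbhs /within/= => P0.
  change (\forall h \near nbhs (0 : R), h != 0 -> P (h + t)).
  have c1 : h + t @[h --> (0 : R)] --> t.
    by rewrite -[X in _ --> X]add0r; apply: cvgD; [exact: cvg_id|exact: cvg_cst].
  have P1 := c1 _ P0.
  have P2 := c1 _ (lt_nbhsr t0).
  near=> h => h0.
  have ht : h + t != t by rewrite -subr_eq0 addrK.
  have hp : 0 < h + t by near: h; exact: P2.
  have : h + t != t -> h + t \in `[0, +oo[ -> P (h + t) by near: h; exact: P1.
  by apply => //; rewrite in_itv/= ltW.
have H : h^-1 *: ((f \o shift t) (h *: 1) - f t) @[h --> (0 : R)^'] --> d.
  have H1 : quotient f t (h + t) @[h --> (0 : R)^'] --> d.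
    by move=> P HP; exact: (c0 _ (fd P HP)).
  apply: cvg_trans H1; apply: near_eq_cvg; near=> h.
  by rewrite /quotient /= /GRing.scale/= mulr1 mulrC addrK.
split; first by apply/cvg_ex; exists d.
exact: cvg_lim H.
Unshelve. all: by end_near.
Qed.

Lemma derivative_ge0_nonincreasing f (d : R -> R) :
  (forall t, 0 <= t -> derivative_ge0 f t (d t)) -> (forall t, 0 <= t -> d t <= 0) ->
  {in `[0, +oo[ &, nonincreasing_fun f}.
Proof.
move=> fd d0 x y; rewrite !in_itv/= !andbT => x0 y0 xy.
have D (t : R) : t \in `]0, +oo[ -> is_derive t 1 f (d t).
  by rewrite in_itv/= andbT => t0; apply: derivative_ge0_is_derive (fd _ (ltW t0)).
apply: (@ler0_derive1_nincry _ f 0) => //.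
- by move=> t /D [].
- move=> t t0; have [_ +] := D _ t0; rewrite derive1E => ->.
  by apply: d0; move: t0; rewrite in_itv/= andbT => /ltW.
- apply/subspace_continuousP => t; rewrite /= in_itv/= andbT => t0.
  move=> P HP; have := derivative_ge0_cvg (fd _ t0) HP.
  rewrite /onesided /dnbhs /within/=.
  change ((\forall s \near nbhs t, s != t -> s \in `[0, +oo[ -> P (f s)) ->
    (\forall s \near nbhs t, s \in `[0, +oo[ -> P (f s))).
  apply: filterS => s Ps s0; have [->|st] := eqVneq s t; first exact: nbhs_singleton.
  exact: Ps.
Qed.

(** The right-hand difference quotients are nonpositive. *)
Lemma derivative_ge0_nincr_le0 f t d : 0 <= t ->
  {in `[0, +oo[ &, nonincreasing_fun f} -> derivative_ge0 f t d -> d <= 0.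
Proof.
move=> t0 fn fd; rewrite leNgt; apply/negP => d0.
have : \forall s \near onesided t, 0 < quotient f t s by exact: fd (lt_nbhsr d0).
rewrite /onesided /dnbhs /within/=.
change ((\forall s \near nbhs t, s != t -> s \in `[0, +oo[ -> 0 < quotient f t s) -> False).
move=> /nbhs_ballP[e /= e0] /(_ (t + e / 2)).
have e2 : 0 < e / 2 by rewrite divr_gt0.
have te : t < t + e / 2 by rewrite ltrDl.
have tep : 0 <= t + e / 2 by rewrite (le_trans t0)// ltW.
have : ball t e (t + e / 2).
  by rewrite /ball/= opprD addrA subrr sub0r normrN gtr0_norm// gtr_pMr// invf_lt1// ltr1n.
move=> /[swap]/[apply]; rewrite gt_eqF// in_itv/= tep/= => /(_ isT isT).
rewrite /quotient ltNge => /negP; apply.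
rewrite [t + _ - t]addrAC subrr add0r mulr_le0_ge0 ?invr_ge0 ?(ltW e2)// subr_le0.
by apply: fn => //; rewrite ?in_itv/= ?andbT// ltW.
Qed.

End monotonicity.

Lemma derivative_ge0_eq (R : realType) (f : R -> R) (t d d' : R) :
  derivative_ge0 f t d -> d = d' -> derivative_ge0 f t d'.
Proof. by move=> + <-. Qed.

(** * The energy identity *)

Section energy_identity.
Context {R : realType} {n : nat}.
Variables (A : 'M[R]_n) (b : 'cV[R]_n) (rho0 : 'cV[R]_n -> R) (theta : R).
Hypothesis sr : schwartz rho0.
Local Notation H := (Lagrangian_gramian A b).
Local Notation N t psi := (gauss_avgs (noise2 A b t) psi 0).
Local Notation c t := (expmx (- t *: A) *m b).
Local Notation rho := (fp_solution A b rho0).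
Local Notation p1 k := (iter_partial [:: k] rho0).

Let F (t : R) := theta * N t (corr rho0 rho0) +
  \sum_k \sum_l H t k l * N t (corr (p1 k) (p1 l)).

Let FE t : 0 <= t -> F t = expR (t * \tr A) * energy A b theta rho t.
Proof.
move=> t0; rewrite /F -(@L2norm_fp_solution _ _ A b t _ sr) -(@gramian_form_gradient _ _ A b t _ sr).
by rewrite /energy mulrDr mulrCA.
Qed.

(** Up to the exponential factor, the first sum
    contributes - theta times the dissipation |D_b rho|^2. In the
    second sum the growth of H contributes + 1 times the same quantity, since
    H' = c c^T, and the evolution of the averages contributes the second-order
    form. *)
Lemma energy_derivative t : 0 <= t ->
  derivative_ge0 (fun t => expR (t * \tr A) * energy A b theta rho t) t
    (- expR (t * \tr A) * ((theta - 1) * L2norm ('D_b (rho t)) ^+ 2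
           + gramian_form A b t (dgradient b (rho t)))).
Proof.
move=> t0; apply: (eq_derivative_ge0 t0 FE).
have sp k : schwartz (p1 k) by exact: schwartz_partial.
have D1 := derivative_ge0Z (c := theta) (noise2_corr_derivative (A := A) (b := b) sr sr t0).
have D2 k l := derivative_ge0M (Lagrangian_gramian_derivative (A := A) (b := b) (i := k) (j := l) t0)
  (noise2_corr_derivative (A := A) (b := b) (sp k) (sp l) t0).
apply: (derivative_ge0_eq (derivative_ge0D D1
  (derivative_ge0_sum (fun k => derivative_ge0_sum (D2 k))))).
rewrite mulNr mulrDr [expR _ * (_ * _)]mulrCA.
rewrite (@L2norm_derive_fp_solution _ _ A b t _ sr) (@gramian_form_dgradient _ _ A b t _ sr).
have E (S T : R) : theta * - S + (S - T) = - ((theta - 1) * S + T) by ring.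
apply: etrans (E _ _); congr (_ + _); rewrite -sumrB; apply: eq_bigr => k _.
by rewrite -sumrB; apply: eq_bigr => l _; rewrite mulrN.
Qed.

Lemma energy_nonincreasing : 1 <= theta ->
  {in `[0, +oo[ &, nonincreasing_fun (fun t => expR (t * \tr A) * energy A b theta rho t)}.
Proof.
move=> th1; apply: (derivative_ge0_nonincreasing energy_derivative) => t t0.
rewrite mulNr oppr_le0 mulr_ge0 ?expR_ge0// addr_ge0//.
  by rewrite mulr_ge0 ?subr_ge0// sqr_ge0.
by apply: Rintegral_ge0 => x _; exact: gramian_psd.
Qed.

(** The root of the zero matrix is only known through its square, hence the use
    of gauss_avgs_cov. *)
Lemma fp_solution0 : rho 0 = rho0.
Proof.
rewrite fp_solutionE//; apply/funext => x; rewrite oppr0 mul0r expR0 mul1r expmx0 mul1mx.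
rewrite (@gauss_avgs_cov _ _ _ [::])//; first exact: schwartz_smooth_bounded.
by rewrite cov_noise// Lagrangian_gramian0 /cov big_nil.
Qed.

(** At time 0 the Gramian is zero, and nothing compensates the factor theta -
    1. *)
Lemma energy_derivative0 :
  derivative_ge0 (fun t => expR (t * \tr A) * energy A b theta rho t) 0
    ((1 - theta) * L2norm ('D_b rho0) ^+ 2).
Proof.
apply: (derivative_ge0_eq (energy_derivative (lexx 0))).
rewrite mul0r expR0 fp_solution0 (_ : gramian_form _ _ _ _ = 0); first by ring.
rewrite /gramian_form gramian0.
under eq_Rintegral do rewrite mulmx0 mul0mx mxE.
by rewrite Rintegral_cst// mul0r.
Qed.

End energy_identity.

(** * A Gaussian datum *)

Section gaussian_witness.
Context {R : realType} {n : nat}.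
Implicit Types (p : 'cV[R]_n -> R) (x v : 'cV[R]_n).

(** Polynomials as functions: the factors of the Gaussian in its iterated
    derivatives. *)
Inductive polyfun : ('cV[R]_n -> R) -> Prop :=
| polyfun_cst c : polyfun (fun=> c)
| polyfun_coord i : polyfun (fun x => x i 0)
| polyfunD p q : polyfun p -> polyfun q -> polyfun (fun x => p x + q x)
| polyfunM p q : polyfun p -> polyfun q -> polyfun (fun x => p x * q x).

Lemma eq_polyfun p q : polyfun p -> p =1 q -> polyfun q.
Proof. by move=> pp /funext <-. Qed.

Lemma polyfun_differentiable p x : polyfun p -> differentiable p x.
Proof.
elim=> [c|i|q r _ Hq _ Hr|q r _ Hq _ Hr].
- exact: differentiable_cst.
- exact: differentiable_coord.
- exact: differentiableD.
- exact: differentiableM.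
Qed.

Lemma polyfun_derive p i : polyfun p -> polyfun (fun x => 'D_(delta_mx i 0) p x).
Proof.
elim=> [c|j|q r pq Hq pr Hr|q r pq Hq pr Hr].
- by apply: eq_polyfun (polyfun_cst 0) _ => x; rewrite derive_cst.
- apply: eq_polyfun (polyfun_cst ((delta_mx i 0 : 'cV[R]_n) j 0)) _ => x.
  have : is_derive x (delta_mx i 0) (fun x : 'cV[R]_n => x j 0) ((delta_mx i 0 : 'cV[R]_n) j 0).
    apply/is_derive_line0.
    rewrite (_ : (fun h => _) = fun h : R => x j 0 + h * (delta_mx i 0 : 'cV[R]_n) j 0).
      by apply: is_derive_eq; rewrite add0r mul1r scaler0 add0r [_%:A]mulr1.
    by apply/funext => h; rewrite !mxE.
  by move=> [].
- apply: eq_polyfun (polyfunD Hq Hr) _ => x.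
  by rewrite deriveD//; apply: diff_derivable; exact: polyfun_differentiable.
- apply: eq_polyfun (polyfunD (polyfunM pq Hr) (polyfunM pr Hq)) _ => x.
  by rewrite deriveM//; apply: diff_derivable; exact: polyfun_differentiable.
Qed.

Lemma polyfun_sum (I : Type) (r : seq I) (f : I -> 'cV[R]_n -> R) :
  (forall i, polyfun (f i)) -> polyfun (fun x => \sum_(i <- r) f i x).
Proof.
move=> pf; elim: r => [|i r IH].
  by under eq_fun do rewrite big_nil; exact: polyfun_cst.
by under eq_fun do rewrite big_cons; exact: polyfunD.
Qed.

Lemma polyfun_prod (I : Type) (r : seq I) (f : I -> 'cV[R]_n -> R) :
  (forall i, polyfun (f i)) -> polyfun (fun x => \prod_(i <- r) f i x).
Proof.
move=> pf; elim: r => [|i r IH].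
  by under eq_fun do rewrite big_nil; exact: polyfun_cst.
by under eq_fun do rewrite big_cons; exact: polyfunM.
Qed.

Lemma polyfunX p k : polyfun p -> polyfun (fun x => p x ^+ k).
Proof.
move=> pp; elim: k => [|k IH]; first exact: polyfun_cst.
by under eq_fun do rewrite exprS; exact: polyfunM.
Qed.

Lemma polyfun_le p : polyfun p ->
  exists (C : R) (N : nat), 0 <= C /\ forall x, `|p x| <= C * (1 + `|x|) ^+ N.
Proof.
have x1 x : 1 <= 1 + `|x| by rewrite lerDl.
elim=> [c|i|q r _ [C [N [C0 HC]]] _ [D [M [D0 HD]]]|q r _ [C [N [C0 HC]]] _ [D [M [D0 HD]]]].
- by exists `|c|, 0%N; split=> // x; rewrite expr0 mulr1.
- exists 1, 1%N; split=> // x; rewrite mul1r expr1.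
  by rewrite (le_trans (normr_entry_le x i))// lerDr.
- exists (C + D), (N + M)%N; split=> [|x]; first exact: addr_ge0.
  rewrite mulrDl (le_trans (ler_normD _ _))// lerD//.
    by rewrite (le_trans (HC x))// ler_wpM2l// ler_weXn2l// leq_addr.
  by rewrite (le_trans (HD x))// ler_wpM2l// ler_weXn2l// leq_addl.
- exists (C * D), (N + M)%N; split=> [|x]; first exact: mulr_ge0.
  by rewrite normrM exprD mulrACA ler_pM.
Qed.

Definition sqnorm x : R := \sum_i x i 0 ^+ 2.

Definition bell x : R := expR (- (sqnorm x / 2)).

Lemma polyfun_sqnorm : polyfun (fun x => - (sqnorm x / 2)).
Proof.
apply: (@eq_polyfun (fun x => - 1 / 2 * sqnorm x)); last by move=> x; field.
apply: polyfunM; first exact: polyfun_cst.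
by apply: polyfun_sum => i; apply: polyfunX; exact: polyfun_coord.
Qed.

Lemma is_derive_bell x v : is_derive x v bell (- (\sum_i v i 0 * x i 0) * bell x).
Proof.
apply/is_derive_line0.
have d (h : R) : is_derive h 1 (fun h : R => - (sqnorm (x + h *: v) / 2))
    (- (\sum_i v i 0 * (x + h *: v) i 0)).
  have di i : is_derive h 1 (fun h : R => (x + h *: v) i 0 ^+ 2) (2 * (v i 0 * (x + h *: v) i 0)).
    rewrite (_ : (fun h => _) = (fun h : R => (x i 0 + h * v i 0) ^+ 2)).
      apply: is_derive_eq; rewrite /GRing.scale/= !mxE.
      by ring.
    by apply/funext => k; rewrite !mxE.
  have ds := is_derive_lsum (index_enum 'I_n) di.
  rewrite (_ : (fun h => _) = (- 1 / 2) *: (fun h : R => sqnorm (x + h *: v))); last first.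
    by apply/funext => k; rewrite -[RHS]/(- 1 / 2 * sqnorm (x + k *: v)); field.
  apply: is_derive_eq (is_deriveZ (- 1 / 2) ds) _.
  by rewrite /GRing.scale/= -mulr_sumr; field.
apply: is_derive_eq (is_derive1_comp (is_derive_expR _) (d 0)) _.
by rewrite /bell scale0r addr0 /GRing.scale/= mulrC.
Qed.

Lemma differentiable_bell x : differentiable bell x.
Proof.
apply: (@differentiable_comp _ _ _ _ (fun x => - (sqnorm x / 2)) expR).
  exact: polyfun_differentiable polyfun_sqnorm.
by apply/derivable1_diffP; exact: derivable_expR.
Qed.

Lemma iter_partial_bell (s : seq 'I_n) :
  exists2 p, polyfun p & iter_partial s bell = fun x => p x * bell x.
Proof.
elim: s => [|i s [p pp IH]].
  by exists (fun=> 1); [exact: polyfun_cst|apply/funext => x; rewrite mul1r].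
exists (fun x => 'D_(delta_mx i 0) p x + p x * (- 1 * x i 0)).
  apply: polyfunD; first exact: polyfun_derive.
  by apply: polyfunM => //; apply: polyfunM; [exact: polyfun_cst|exact: polyfun_coord].
rewrite /= IH; apply/funext => x.
have db := is_derive_bell x (delta_mx i 0).
have dp : is_derive x (delta_mx i 0) p ('D_(delta_mx i 0) p x).
  by apply/derivableP; apply: diff_derivable; exact: polyfun_differentiable.
have D := is_deriveM dp db.
rewrite (_ : (fun x => p x * bell x) = p * bell)// derive_val sum_delta.
by rewrite /GRing.scale/=; ring.
Qed.

Lemma sqnorm_ge0 x : 0 <= sqnorm x.
Proof. by apply: sumr_ge0 => i _; exact: sqr_ge0. Qed.

Lemma normr_le_sqnorm x : `|x| <= 1 + sqnorm x.
Proof.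
have B : 0 <= 1 + sqnorm x by rewrite addr_ge0// sqnorm_ge0.
rewrite [leLHS]/Num.Def.normr/= mx_normrE; apply: bigmax_le => // -[i j] _.
rewrite ord1/=; have : x i 0 ^+ 2 <= sqnorm x.
  by rewrite /sqnorm (bigD1 i)//= lerDl; apply: sumr_ge0 => k _; exact: sqr_ge0.
rewrite -(real_normK (num_real (x i 0))); have := normr_ge0 (x i 0); nra.
Qed.

(** From (1 + q / (2 m))^m <= exp (q / 2) with q = |x|^2, where m exceeds the
    degree to be absorbed. *)
Lemma polyfun_bell_rapid_decay p : polyfun p -> rapid_decay (fun x => p x * bell x).
Proof.
move=> /polyfun_le[C [N [C0 HC]]] k.
pose m := (N + k).+1; have m0 : 0 < m%:R :> R by rewrite ltr0n.
exists (C * (4 * m%:R) ^+ m) => x.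
have x1 : 1 <= 1 + `|x| by rewrite lerDl.
have E : (1 + `|x|) ^+ (N + k) <= (4 * m%:R) ^+ m * expR (sqnorm x / 2).
  apply: (@le_trans _ _ ((1 + `|x|) ^+ m)); first by rewrite ler_weXn2l.
  rewrite (_ : sqnorm x / 2 = m%:R * (sqnorm x / (2 * m%:R))); last by field; rewrite gt_eqF.
  rewrite expRM_natl -exprMn; apply: lerXn2r; rewrite ?nnegrE.
  - by rewrite (le_trans _ x1).
  - by rewrite mulr_ge0 ?expR_ge0// mulr_ge0 ?ler0n.
  - apply: (@le_trans _ _ (4 * m%:R * (1 + sqnorm x / (2 * m%:R)))); last first.
      by rewrite ler_wpM2l ?expR_ge1Dx// mulr_ge0 ?ler0n.
    rewrite (_ : 4 * _ * _ = 4 * m%:R + 2 * sqnorm x); last by field; rewrite gt_eqF.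
    have m1 : 1 <= m%:R :> R by rewrite ler1n.
    by have := normr_le_sqnorm x; have := sqnorm_ge0 x; lra.
rewrite normrM [`|bell x|]ger0_norm ?expR_ge0//.
apply: (@le_trans _ _ (C * (1 + `|x|) ^+ N * bell x * (1 + `|x|) ^+ k)).
  by do 2 (apply: ler_wpM2r; first by rewrite ?expR_ge0// exprn_ge0// (le_trans _ x1)).
rewrite -mulrA [bell x * _]mulrC mulrA -[C * _ * _]mulrA -exprD.
rewrite /bell expRN ler_pdivrMr ?expR_gt0// -mulrA ler_wpM2l//.
Qed.

Lemma schwartz_bell : schwartz bell.
Proof.
split=> [s x|a s]; have [p pp ->] := iter_partial_bell s.
  by apply: differentiableM; [exact: polyfun_differentiable|exact: differentiable_bell].
have pq : polyfun (fun x => \prod_i x i 0 ^+ a i * p x).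
  by apply: polyfunM => //; apply: polyfun_prod => i; apply: polyfunX; exact: polyfun_coord.
have [C HC] := rapid_decay_bounded (polyfun_bell_rapid_decay pq).
by exists C => x; rewrite mulrA.
Qed.

Lemma lebesgue_cV_setT_neq0 m : lebesgue_cV m [set: 'cV[R]_m] != 0%E.
Proof.
elim: m => [|m IH]; first by rewrite /lebesgue_cV/= diracT onee_neq0.
rewrite /lebesgue_cV/= /cons_measure /pushforward preimage_setT -setXTT product_measure1E//.
rewrite mule_eq0 negb_or IH andbT gt_eqF//.
apply: (@lt_le_trans _ _ (@lebesgue_measure R `[0, 1])).
  by rewrite lebesgue_measure_itv/= lte_fin ltr01 sube0 lte_fin ltr01.
by apply: le_measure; rewrite ?inE.
Qed.

(** Otherwise g would be zero almost everywhere, although Lebesgue measure is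
    not zero. *)
Lemma Rintegral_gt0 (g : 'cV[R]_n -> R) : (lebesgue_cV n).-integrable setT (EFin \o g) ->
  (forall x, 0 < g x) -> 0 < \int[lebesgue_cV n]_x g x.
Proof.
move=> gi g0; rewrite lt_neqAle Rintegral_ge0 ?andbT; last by move=> x _; exact: ltW.
apply/negP => /eqP I0.
have mg := measurable_int _ gi.
have : (\int[lebesgue_cV n]_x `|(EFin \o g) x| = 0)%E.
  rewrite (_ : (\int[lebesgue_cV n]_x `|(EFin \o g) x| = \int[lebesgue_cV n]_x (g x)%:E)%E).
    rewrite -[LHS]fineK; last exact: integrable_fin_num.
    by rewrite -[fine _]/(\int[lebesgue_cV n]_x g x) -I0.
  by apply: eq_integral => x _; rewrite /= ger0_norm// ltW.
move/(ae_eq_integral_abs (lebesgue_cV n) measurableT mg) => [Z [mZ Z0 sub]].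
have ZT : Z = setT.
  by apply/seteqP; split=> // x _; apply: sub => /= /(_ I) [] /eqP; rewrite gt_eqF.
by have := lebesgue_cV_setT_neq0 n; rewrite -ZT Z0 eqxx.
Qed.

(** The derivative of (b . x) bell^2 along b is |b|^2 bell^2 - 2 (b . x)^2
    bell^2 and has integral zero. Since D_b bell = - (b . x) bell, twice the
    squared norm is |b|^2 times the integral of bell^2, a positive function. *)
Lemma L2norm_derive_bell (b : 'cV[R]_n) : b != 0 -> 0 < L2norm ('D_b bell) ^+ 2.
Proof.
move=> b0; rewrite L2norm_sqr.
pose l x : R := \sum_i b i 0 * x i 0.
have pl : polyfun l.
  by apply: polyfun_sum => i; apply: polyfunM; [exact: polyfun_cst|exact: polyfun_coord].
have bell1 x : `|bell x| <= 1.
  by rewrite ger0_norm ?expR_ge0// -expR0 ler_expR oppr_le0 divr_ge0// sqnorm_ge0.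
have rd p : polyfun p -> rapid_decay (fun x => p x * bell x * bell x).
  by move=> pp; exact: rapid_decayM (polyfun_bell_rapid_decay pp) bell1.
have cont p x : polyfun p -> differentiable (fun x => p x * bell x * bell x) x.
  move=> pp; apply: differentiableM; last exact: differentiable_bell.
  by apply: differentiableM; [exact: polyfun_differentiable|exact: differentiable_bell].
have me p : polyfun p -> measurable_fun setT (fun x => p x * bell x * bell x).
  move=> pp; apply: continuous_measurable_cV; apply: differentiable_continuous_cV => x.
  exact: cont.
have ie p : polyfun p -> (lebesgue_cV n).-integrable setT (EFin \o (fun x => p x * bell x * bell x)).
  by move=> pp; apply: rapid_decay_integrable; [exact: me|exact: rd].
under eq_Rintegral => x _.
  have D := is_derive_bell x b; rewrite derive_val exprMn sqrrN -/(l x) [bell x ^+ 2]expr2 mulrA.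
  over.
have pl2 : polyfun (fun x => l x ^+ 2) by exact: polyfunX.
pose F x := l x * bell x * bell x.
pose F' x := sqnorm b * (1 * bell x * bell x) - 2 * (l x ^+ 2 * bell x * bell x).
have dF x : is_derive x b F (F' x).
  have dl : is_derive x b l (sqnorm b).
    apply/is_derive_line0; rewrite (_ : (fun h => _) = fun h : R => l x + h * sqnorm b).
      by apply: is_derive_eq; rewrite add0r mul1r scaler0 add0r [_%:A]mulr1.
    apply/funext => h; rewrite /l /sqnorm mulr_sumr -big_split/=; apply: eq_bigr => i _.
    by rewrite !mxE; ring.
  have db := is_derive_bell x b.
  apply: is_derive_eq (is_deriveM (is_deriveM dl db) db) _.
  by rewrite /F' -/(l x) /GRing.scale/= -[(l * bell) x]/(l x * bell x); ring.
have i1 : (lebesgue_cV n).-integrable setT (EFin \o (fun x => sqnorm b * (1 * bell x * bell x))).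
  rewrite /comp; under eq_fun do rewrite EFinM.
  by apply: integrableZl => //; exact: ie (polyfun_cst 1).
have i2 : (lebesgue_cV n).-integrable setT (EFin \o (fun x => 2 * (l x ^+ 2 * bell x * bell x))).
  by rewrite /comp; under eq_fun do rewrite EFinM; apply: integrableZl => //; exact: ie pl2.
have := Rintegral_dirder0 dF (me _ pl) (rd _ pl).
have rF' : rapid_decay F'.
  rewrite (_ : F' = fun x => sqnorm b * (1 * bell x * bell x) + - 2 * (l x ^+ 2 * bell x * bell x)).
    apply: rapid_decayD; apply: rapid_decay_scale; [exact: rd (polyfun_cst 1)|exact: rd pl2].
  by apply/funext => x; rewrite /F' mulNr.
move=> /(_ rF'); rewrite /F' RintegralB//.
rewrite RintegralZl//; last exact: ie (polyfun_cst 1).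
rewrite RintegralZl//; last exact: ie pl2.
have B0 : 0 < \int[lebesgue_cV n]_x (1 * bell x * bell x).
  apply: Rintegral_gt0 => [|x]; first exact: ie (polyfun_cst 1).
  by rewrite mul1r mulr_gt0// expR_gt0.
have sb : 0 < sqnorm b.
  rewrite lt_neqAle sqnorm_ge0 andbT; apply: contra_neq b0 => /esym H.
  apply/colP => i; rewrite mxE; apply/eqP; rewrite -sqrf_eq0; apply/eqP.
  by apply/psumr_eq0P: i (isT) => // i _; exact: sqr_ge0.
move/subr0_eq => E; rewrite -(@pmulr_rgt0 _ 2)// -E mulr_gt0//.
Qed.

End gaussian_witness.

(** * The energy dissipation and its sharp coefficient *)

Theorem proposition12 (R : realType) (n : nat) (A : 'M[R]_n) (b : 'cV[R]_n) :
  let F theta rho0 (t : R) :=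
    expR (t * \tr A) * energy A b theta (fp_solution A b rho0) t in
  let monotone theta :=
    forall rho0, schwartz rho0 ->
      {in `[0, +oo[ &, nonincreasing_fun (F theta rho0)} in
  [/\ forall rho0, schwartz rho0 -> forall theta, 0 <= theta ->
        forall t, 0 <= t ->
        let rho := fp_solution A b rho0 in
        (F theta rho0 s - F theta rho0 t) / (s - t)
          @[s --> within `[0, +oo[ t^'] -->
        - expR (t * \tr A) *
          ((theta - 1) * L2norm ('D_b (rho t)) ^+ 2
           + gramian_form A b t (dgradient b (rho t))),
      forall theta, 1 <= theta -> monotone theta &
      b != 0 -> monotone 1 /\ (forall theta, 0 <= theta -> monotone theta -> 1 <= theta)].
Proof.
move=> F monotone.
have mono theta : 1 <= theta -> monotone theta.
  by move=> th1 rho0 sr; exact: energy_nonincreasing.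
split=> //; first by move=> rho0 sr theta _ t t0; exact: energy_derivative.
move=> b0; split; first exact: mono.
move=> theta _ mt; rewrite leNgt; apply/negP => th1.
have := derivative_ge0_nincr_le0 (lexx 0) (mt _ schwartz_bell)
  (@energy_derivative0 _ _ A b _ theta schwartz_bell).
by rewrite leNgt mulr_gt0 ?subr_gt0// L2norm_derive_bell.
Qed.
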